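(* Let $k$ be a fixed positive integer (not depending on $n$). For the uniform random intersection graph $G_u(n,P_n,K_n)$, define the sequence $\alpha_n$ by $$\frac{K_n^2}{P_n}=\frac{\ln n+(k-1)\ln\ln n+\alpha_n}{n}.$$ If $K_n=\Omega(\sqrt{\ln n})$ and $|\alpha_n|=o(\ln n)$, then $$\lim_{n\to\infty}\mathbb{P}[G_u(n,P_n,K_n)\text{ is }k\text{-connected}]=\begin{cases}0,&\text{if }\lim_{n\to\infty}\alpha_n=-\infty,\\ 1,&\text{if }\lim_{n\to\infty}\alpha_n=\infty,\\ e^{-\frac{e^{-\alpha^*}}{(k-1)!}},&\text{if }\lim_{n\to\infty}\alpha_n=\alpha^*\in(-\infty,\infty).\end{cases}$$
   Context: Uniform random intersection graph $G_u(n,P_n,K_n)$: for integers $1\le K_n\le P_n$, there are $n$ nodes $v_1,\ldots,v_n$ and a pool of $P_n$ distinct objects; each node $v_i$ independently receives a uniformly random $K_n$-element subset $S_i$ of the pool. Distinct nodes $v_i,v_j$ are adjacent iff $S_i\cap S_j\neq\emptyset$. A graph is $k$-connected if every pair of nodes is joined by at least $k$ internally node-disjoint paths. All limits and asymptotic notation are as $n\to\infty$. *)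

(* Defs.v *)
From HB Require Import structures.
From mathcomp Require Import all_boot all_order all_algebra.
From mathcomp Require Import all_classical all_reals all_analysis.

Set Implicit Arguments.
Unset Strict Implicit.
Unset Printing Implicit Defensive.

Import Order.TTheory GRing.Theory Num.Theory.
Import numFieldNormedType.Exports.

Local Open Scope ring_scope.

(* A path from u to v is encoded by the sequence s of its internal nodes: its
   node sequence is u :: rcons s v. *)
Definition simple_path (T : eqType) (e : rel T) (u v : T) (s : seq T) : bool :=
  path e u (rcons s v) && uniq (u :: rcons s v).

(* The paths must also be distinct: the one-edge path has no internal node, so
   disjointness alone would allow it to be counted several times. *)
Definition k_connected (T : finType) (e : rel T) (k : nat) : Prop :=
  forall u v : T, u != v ->
    exists s : 'I_k -> seq T,
      [/\ injective s,
          forall i, simple_path e u v (s i) &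
          forall i j, i != j -> [disjoint s i & s j]].

(* S i is the set of objects received by node i. *)
Definition intersection_graph (n P : nat) (S : {ffun 'I_n -> {set 'I_P}}) :
    rel 'I_n :=
  fun i j => (i != j) && (S i :&: S j != finset.set0).

Definition unif_subset (R : realType) (P K : nat) (A : {set 'I_P}) : R :=
  if #|A| == K then ('C(P, K)%:R)^-1 else 0.

(* The S i being independent, their joint law is the product of the uniform laws
   on the K-element subsets of the pool. *)
Definition Gu_prob (R : realType) (n P K : nat) (E : rel 'I_n -> Prop) : R :=
  \sum_(S : {ffun 'I_n -> {set 'I_P}} | `[< E (intersection_graph S) >])
    \prod_(i < n) unif_subset R K (S i).

(* Main.v *)
(** Write [y = K^2 / P] and [L = n y], so that [L ~ ln n], and let [h = k - 1].

    If the graph has minimum degree at least [k] but is not [k]-connected, then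
    by Menger's theorem some connected set [A] of [r] nodes, [2 <= r <= n / 2],
    has fewer than [k] outside neighbours. Given the sets of the nodes of [A], the
    other nodes meet their union [U] independently, each missing it with
    probability at most [exp (- K |U| / P)]. Connectedness of [A] forces
    [|U| <= r K - (r - 1)], and [E z^(r K - |U|) <= exp (z r^2 y)]; with
    [z = n / (r L)] this bounds the expected number of such sets as long as
    [r L exp (L / K) <= n]. For larger [r] it is enough that [|U|] is at least a
    quarter of [min (r K) P], which fails with small probability by a union bound
    over the possible values of a superset of [U]. Hence [k]-connectivity and
    minimum degree at least [k] have the same limiting probability.

    The number of nodes of degree less than [k] has [m]-th factorial moment
    asymptotic to [mu^m] with [mu = n e^(-L) L^h / h!]: up to negligible events the
    sets of [m] given nodes are disjoint and every other node meets at most one of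
    them. As [mu ~ e^(-alpha) / h!], the three cases follow from the second moment
    method, the first moment method and the Bonferroni inequalities. *)

Require Import Defs.
From HB Require Import structures.
From mathcomp Require Import all_boot all_order all_algebra.
From mathcomp Require Import boolp zify.

Set Implicit Arguments.
Unset Strict Implicit.
Unset Printing Implicit Defensive.

(** * Menger's theorem and vertex connectivity *)

Section Menger.
Variable T : finType.
Implicit Types (e : rel T) (X Y C D : {set T}).

(** Edges are dependent, so every estimate conditions on the sets of the nodes of [A]; the
    difficulty is that the size of their pool is random. Put [lam = L / K]. A pool that falls short
    of [r K] by [T] weakens the bound on the probability that the other nodes avoid it by a factor
    [exp (lam T)]. This is absorbed by tilting: if [exp lam <= z], then on [T >= r - 1] one has
    [exp (lam T) <= (exp lam / z)^(r-1) z^T]. The choice of [z] makes the mean of [z^T] at most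
    [exp r], while the power of [exp lam / z = r L exp lam / n] cancels all but one factor [n] of
    the number of sets of size [r]; the remaining [n], about [exp L], is beaten by [exp (- r L)]
    because [r >= 2]. The requirement [exp lam <= z] is what confines this to small [r]. The
    assumption on [K_n] gives [L = O(K^2)], so that [K] tends to infinity and [lam = o(L)]; it also
    gives [lam = O(K)], which makes [lam exp (- K / 2)] small in the bound for large [r]. The
    assumption on [alpha] gives [L / ln n -> 1], so that [L^h] may replace [(ln n)^h] in [mu]. *)

Definition separates e X Y C : Prop :=
  forall x p, x \in X -> path e x p -> last x p \in Y -> has (mem C) (x :: p).

(* The paths of a linkage are indexed by their first nodes. *)
Definition linked e X Y k : Prop :=
  exists (D : {set T}) (p : T -> seq T),
    [/\ D \subset X, #|D| = k,
        forall x, x \in D ->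
          [/\ path e x (p x), uniq (x :: p x) & last x (p x) \in Y] &
        forall x y v, x \in D -> y \in D -> v \in x :: p x -> v \in y :: p y ->
          x = y].

(** Only the direction from [a] to [b] is removed: Menger's theorem is proved for arbitrary
    relations, by induction on the number of directed edges. *)
Definition remove_edge e (a b : T) : rel T :=
  fun x y => e x y && ((x, y) != (a, b)).

Definition edges e : {set T * T} := [set xy | e xy.1 xy.2].

Lemma remove_edge_sub e a b : subrel (remove_edge e a b) e.
Proof. by move=> x y /andP[]. Qed.

Lemma card_remove_edge e a b :
  e a b -> #|edges (remove_edge e a b)| < #|edges e|.
Proof.
move=> eab; apply: proper_card; apply/properP; split.
  by apply/subsetP=> -[x y]; rewrite !inE /= => /andP[].
by exists (a, b); rewrite !inE //= /remove_edge eqxx andbF.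
Qed.

Lemma remove_edge_path_src e a b x p :
  a \notin x :: p -> path e x p -> path (remove_edge e a b) x p.
Proof.
elim: p x => //= z p IH x; rewrite inE negb_or => /andP[ax azp] /andP[exz ep].
by rewrite IH // andbT /remove_edge exz xpair_eqE eq_sym (negPf ax).
Qed.

Lemma remove_edge_path_tgt e a b x p :
  b \notin p -> path e x p -> path (remove_edge e a b) x p.
Proof.
elim: p x => //= z p IH x; rewrite inE negb_or => /andP[bz bp] /andP[exz ep].
by rewrite IH // andbT /remove_edge exz xpair_eqE (eq_sym z) (negPf bz) andbF.
Qed.

(** The path is cut at its first vertex in [Q]: the earlier vertices differ from [a], so the removed
    edge is never left from its source. *)
Lemma path_prefix e a b (Q : {set T}) x p :
  a \in Q -> path e x p -> has (mem Q) (x :: p) ->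
  exists q, [/\ path (remove_edge e a b) x q, last x q \in Q &
    {subset x :: q <= x :: p}].
Proof.
move=> aQ; elim: p x => [|z p IH] x.
  move=> _ /=; rewrite orbF => xQ.
  by exists [::]; split.
have [xQ|xQ] := boolP (x \in Q).
  by move=> _ _; exists [::]; split=> // v; rewrite !inE => /eqP->; rewrite eqxx.
rewrite /= (negPf xQ) /= => /andP[exz ep] hQ.
have [q [eq lq sq]] := IH z ep hQ.
exists (z :: q); split=> //=; last first.
  move=> v; rewrite inE => /orP[/eqP->|/sq]; first by rewrite mem_head.
  by rewrite [in X in _ -> X]inE => ->; rewrite orbT.
rewrite eq andbT /remove_edge exz xpair_eqE; apply: contraNN xQ.
by case/andP=> /eqP->.
Qed.

(** What follows the last visit to [Q] is kept: no later vertex is [b], so the removed edge is never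
    entered at its target. *)
Lemma path_suffix e a b (Q : {set T}) x p :
  b \in Q -> path e x p -> has (mem Q) (x :: p) ->
  exists z q, [/\ z \in Q, path (remove_edge e a b) z q, last z q = last x p &
    {subset z :: q <= x :: p}].
Proof.
move=> bQ; elim: p x => [|z p IH] x.
  move=> _ /=; rewrite orbF => xQ.
  by exists x, [::]; split.
move=> ep hQ; have [hQ'|hQ'] := boolP (has (mem Q) (z :: p)).
  case/andP: ep => _ ep.
  have [w [q [wQ eq lq sq]]] := IH z ep hQ'.
  by exists w, q; split=> // v /sq; rewrite [in X in _ -> X]inE => ->; rewrite orbT.
exists x, (z :: p); split=> //.
  by move: hQ => /=; move: hQ' => /= /negPf ->; rewrite orbF.
apply: remove_edge_path_tgt => //.
by apply: contra hQ' => bp; apply/hasP; exists b.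
Qed.

Lemma linked_sub e e' X Y k : subrel e e' -> linked e X Y k -> linked e' X Y k.
Proof.
move=> ee' [D [p [DX cD pD dD]]]; exists D, p; split=> // x /pD[ep up lp].
by split=> //; apply: sub_path ep.
Qed.

(* Concatenation step of Göring's proof: [S] is a separator, of size [k - 1], of
   the graph without the edge [a -> b]. *)
Lemma linked_glue e X Y (S : {set T}) a b k :
  e a b -> separates (remove_edge e a b) X Y S -> a \notin S -> b \notin S ->
  #|S|.+1 = k ->
  linked (remove_edge e a b) X (a |: S) k ->
  linked (remove_edge e a b) (b |: S) Y k -> linked e X Y k.
Proof.
set e' := remove_edge e a b => eab sepS aS bS cS.
move=> [D [p [DX cD pD dD]]] [D' [q [D'Q cD' qD dq]]].
have ee' : subrel e' e := @remove_edge_sub e a b.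
have {}D'Q : D' = b |: S.
  by apply/eqP; rewrite eqEcard D'Q cD' cardsU1 bS /= -cS.
subst D'.
pose l x := last x (p x).
have linj : {in D &, injective l}.
  move=> x y xD yD lxy; apply: (dD _ _ (l x)) => //; first exact: mem_last.
  by rewrite lxy; exact: mem_last.
have lim : l @: D = a |: S.
  apply/eqP; rewrite eqEcard; apply/andP; split.
    by apply/subsetP=> z /imsetP[x xD ->]; case: (pD x xD).
  by rewrite card_in_imset // cD cardsU1 aS /= -cS.
have lastE x v : x \in D -> v \in x :: p x -> v \in a |: S -> v = l x.
  move=> xD vp; rewrite -lim => /imsetP[x' x'D vx'].
  rewrite (dD x x' v) // vx' /l; exact: mem_last.
have headQ z v : z \in b |: S -> v \in z :: q z -> v \in b |: S -> v = z.
  by move=> zQ vq vQ; apply: (dq v z v) => //; rewrite mem_head.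
(* If two such paths met at [v] outside [S], switching from the first to the second at [v] would
   join [X] to [Y] without the removed edge, hence hit [S] at some [w]. But the first path meets [S]
   only at its end and the second only at its start, so [w] would occur twice on one of them. *)
have meet x z v : x \in D -> z \in b |: S -> v \in x :: p x -> v \in z :: q z ->
    [/\ v \in S, v = l x & v = z].
  move=> xD zQ vp vq.
  suff vS : v \in S.
    by split=> //; [apply: lastE | apply: headQ]; rewrite // !inE vS orbT.
  apply/negPn/negP=> vS.
  case: (pD x xD) => ep up lp; case: (qD z zQ) => eq uq lq.
  have [p1 [p2 [pE lp1]]] : exists p1 p2, p x = p1 ++ p2 /\ last x p1 = v.
    by case/splitPl: vp => p1 p2 <-; exists p1, p2.
  have [q1 [q2 [qE lq1]]] : exists q1 q2, q z = q1 ++ q2 /\ last z q1 = v.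
    by case/splitPl: vq => q1 q2 <-; exists q1, q2.
  have ep1 : path e' x p1 by move: ep; rewrite pE cat_path => /andP[].
  have eq2 : path e' v q2 by move: eq; rewrite qE cat_path lq1 => /andP[].
  have /hasP[w] : has (mem S) (x :: p1 ++ q2).
    apply: sepS; first by apply: (subsetP DX).
      by rewrite cat_path ep1 lp1.
    by rewrite last_cat lp1; move: lq; rewrite qE last_cat lq1.
  move=> + /= wS; have {}wS : w \in S := wS.
  rewrite -cat_cons mem_cat => /orP[wp1|wq2].
    have wp : w \in x :: p x by rewrite pE -cat_cons mem_cat wp1.
    have wl : w = l x by apply: lastE => //; rewrite !inE wS orbT.
    case: (lastP p2) pE => [|p2' w'] pE.
      by move: vS; rewrite -lp1 -[p1]cats0 -pE -/(l x) -wl wS.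
    have ww' : w = w' by rewrite wl /l pE last_cat last_rcons.
    move: up; rewrite pE -cat_cons cat_uniq => /and3P[_ /hasPn/(_ w) + _].
    by rewrite -ww' mem_rcons mem_head wp1 => /(_ isT).
  have wz : w = z.
    apply: headQ => //; last by rewrite !inE wS orbT.
    by rewrite qE inE mem_cat wq2 !orbT.
  move: uq; rewrite qE -wz /= mem_cat wq2 orbT //.
(* The path that ends at [a] crosses the restored edge to [b]; every other path ends in [S], where
   its continuation starts. *)
exists D, (fun x => p x ++ if l x == a then b :: q b else q (l x)).
have bQ : b \in b |: S by rewrite setU11.
have lS x : x \in D -> l x != a -> l x \in S.
  by move=> /pD[_ _]; rewrite !inE -/(l x) => /orP[/eqP->|//]; rewrite eqxx.
have lQ x : x \in D -> l x != a -> l x \in b |: S.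
  by move=> xD la; rewrite !inE lS ?orbT.
split=> // [x xD|x y v xD yD].
  case: (pD x xD) => ep up lp; case: eqP => [la|/eqP la].
    case: (qD b bQ) => eq uq lq; split.
    - rewrite cat_path (sub_path ee' ep) /= -/(l x) la eab /=.
      exact: (sub_path ee').
    - rewrite -cat_cons cat_uniq up uq andbT andTb; apply/hasPn=> v vq.
      apply/negP=> vp; case: (meet x b v) => // vS vb _.
      by move: aS; rewrite -la -vb vS.
    - by rewrite last_cat.
  have lxQ := lQ x xD la; case: (qD _ lxQ) => eq uq lq; split.
  - by rewrite cat_path (sub_path ee' ep) /= -/(l x) (sub_path ee' eq).
  - rewrite -cat_cons cat_uniq up andTb.
    move: uq; rewrite cons_uniq => /andP[lnq uq]; rewrite uq andbT.
    apply/hasPn=> v vq; apply/negP=> vp.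
    case: (meet x (l x) v) => //; first by rewrite inE vq orbT.
    by move=> _ vl _; rewrite vl (negPf lnq) in vq.
  - by rewrite last_cat.
pose z x := if l x == a then b else l x.
have zQ t : t \in D -> z t \in b |: S.
  by move=> tD; rewrite /z; case: eqP => // /eqP la; apply: lQ.
have inq t u : u \in t :: p t ++ (if l t == a then b :: q b else q (l t)) ->
    u \in t :: p t \/ u \in z t :: q (z t).
  rewrite -cat_cons mem_cat => /orP[->|]; first by left.
  by rewrite /z; case: eqP => _ H; right=> //; rewrite inE H orbT.
have cross x1 x2 u : x1 \in D -> x2 \in D -> u \in x1 :: p x1 ->
    u \in z x2 :: q (z x2) -> x1 = x2.
  move=> x1D x2D up uq; case: (meet x1 (z x2) u) => // [|uS ul uz].
    exact: zQ.
  apply: linj => //; rewrite -ul uz /z; case: eqP => // la.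
  by move: bS; rewrite [b](_ : _ = u) ?uS // uz /z la eqxx.
move=> /inq[vx|vx] /inq[vy|vy].
- exact: dD vx vy.
- exact: cross vx vy.
- by apply/esym; apply: cross vy vx.
apply: linj => //.
have zz : z x = z y by apply: (dq _ _ v) => //; apply: zQ.
move: zz; rewrite /z; case: eqP => [la|/eqP la]; case: eqP => [lb|/eqP lb] //.
- by rewrite la lb.
- by move=> bl; move: bS; rewrite bl lS.
- by move=> bl; move: bS; rewrite -bl lS.
Qed.

(** Either the graph without some edge still has no separator smaller than [k], or it has one, [S].
    Adding to [S] either end of the edge gives a separator of the whole graph, so [S] has exactly
    [k - 1] elements, and the linkages from [X] to [a |: S] and from [b |: S] to [Y] can be
    glued. *)
Theorem menger e X Y k :
  (forall C, separates e X Y C -> k <= #|C|) -> linked e X Y k.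
Proof.
have [m] := ubnP #|edges e|; elim: m e X Y k => // m IH e X Y k; rewrite ltnS.
move=> em sep_ge.
have [[a b] /= eab|noe] := pickP (fun xy : T * T => e xy.1 xy.2); last first.
  (* Without edges the only paths are single vertices, so [X :&: Y] is itself a separator. *)
  have : k <= #|X :&: Y|.
    apply: sep_ge => x [|z p] xX /=; first by move=> _ xY; rewrite inE xX xY.
    by have /= -> := noe (x, z).
  move=> /card_geqP[s [us ss sXY]].
  have sXYE x : x \in s -> (x \in X) && (x \in Y).
    by move=> /sXY; rewrite inE.
  exists [set x in s], (fun=> [::]); split.
  - by apply/subsetP=> x; rewrite inE => /sXYE/andP[].
  - by rewrite cardsE (card_uniqP us).
  - by move=> x; rewrite inE => /sXYE/andP[].
  - by move=> x y v _ _; rewrite !inE => /eqP-> /eqP->.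
set e' := remove_edge e a b.
have em' : #|edges e'| < m by apply: leq_trans (card_remove_edge eab) em.
have [all_ge|] := EM (forall C, separates e' X Y C -> k <= #|C|).
  by apply: linked_sub (IH _ _ _ _ em' all_ge); apply: remove_edge_sub.
move=> /existsNP[S /not_implyP[sepS /negP]]; rewrite -ltnNge => Sk.
have sepa : separates e X Y (a |: S).
  move=> x p xX ep lp; have [ap|ap] := boolP (a \in x :: p).
    by apply/hasP; exists a; rewrite //=; apply: setU11.
  have /hasP[w wp wS] := sepS x p xX (remove_edge_path_src b ap ep) lp.
  by apply/hasP; exists w; rewrite //=; apply: setU1r.
have sepb : separates e X Y (b |: S).
  move=> x p xX ep lp; have [bp|bp] := boolP (b \in x :: p).
    by apply/hasP; exists b; rewrite //=; apply: setU11.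
  have bp' : b \notin p by apply: contra bp; rewrite inE => ->; rewrite orbT.
  have /hasP[w wp wS] := sepS x p xX (remove_edge_path_tgt a bp' ep) lp.
  by apply/hasP; exists w; rewrite //=; apply: setU1r.
have ka := sep_ge _ sepa; have kb := sep_ge _ sepb.
rewrite !cardsU1 in ka kb.
have aS : a \notin S.
  by apply/negP=> aS; move: ka; rewrite aS leqNgt Sk.
have bS : b \notin S.
  by apply/negP=> bS; move: kb; rewrite bS leqNgt Sk.
have cS : #|S|.+1 = k by apply/eqP; rewrite eqn_leq Sk; rewrite aS in ka.
apply: (linked_glue eab sepS aS bS cS).
(* Every path from [X] to [Y] begins with a path of the smaller graph from [X] to [a |: S], so a
   separator for the latter separates [X] from [Y]. The second half is symmetric. *)
- apply: IH => // C sepC; apply: sep_ge => x p xX ep lp.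
  have [q [eq lq sq]] := path_prefix b (setU11 a S) ep (sepa x p xX ep lp).
  by have /hasP[w /sq wp wC] := sepC x q xX eq lq; apply/hasP; exists w.
- apply: IH => // C sepC; apply: sep_ge => x p xX ep lp.
  have [z [q [zQ eq lq sq]]] := path_suffix a (setU11 b S) ep (sepb x p xX ep lp).
  rewrite -lq in lp.
  by have /hasP[w /sq wp wC] := sepC z q zQ eq lp; apply/hasP; exists w.
Qed.

End Menger.

(** * From a failure of k-connectivity to a small connected set with few neighbours *)

Section Connectivity.
Variable T : finType.
Implicit Types (e : rel T) (A B C : {set T}).

Definition nbhd e A : {set T} :=
  [set y | (y \notin A) && [exists x in A, e x y]].

(** Connectedness is expressed by cuts rather than by paths: this is the form used later to build up
    the set one node at a time. *)
Definition connected_set e A : bool :=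
  [forall B : {set T}, (B \subset A) && (B != set0) && (B != A) ==>
    [exists x in B, exists y in A :\: B, e x y]].

Lemma k_connected_degree e k u v :
  k_connected e k -> u != v -> k <= #|[set w | e u w]|.
Proof.
move=> kc uv; have [s [sinj spath sdisj]] := kc u v uv.
(* The first node after [u] is a neighbour of [u]; the default [v] is correct for the one-edge path.
   Equal first nodes would contradict disjointness, make [v] an internal node, or make two paths
   equal to the edge. *)
have hinj : injective (fun i => head v (s i)).
  move=> i j hij; apply/eqP/negPn/negP=> ij.
  have := sdisj i j ij; have := spath i; have := spath j.
  have : s i != s j by apply: contraNneq ij => /sinj ->.
  rewrite /simple_path; move: hij; case: (s i) (s j) => [|a p] [|b q] //=.
  - by move=> <- _; rewrite mem_rcons mem_head /= !andbF.
  - by move=> -> _ _; rewrite mem_rcons mem_head /= !andbF.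
  - by move=> -> _ _ _; rewrite disjoint_has /= mem_head.
rewrite -[k]card_ord -(card_codom hinj) cardsE; apply: subset_leq_card.
apply/subsetP=> w /codomP[i ->]; rewrite unfold_in.
by have := spath i; rewrite /simple_path; case: (s i) => [|a p] /= /andP[/andP[]].
Qed.

Section Internal.
Variables (e : rel T) (u v : T).
(** In the graph without [u] and [v], linkages from the neighbours of [u] to those of [v] are the
    interiors of internally disjoint paths. *)
Let inner a b := [&& e a b, a != u, a != v, b != u & b != v].
Let X := [set a | [&& e u a, a != u & a != v]].
Let Y := [set b | [&& e b v, b != u & b != v]].

Lemma inner_path a q :
  a \notin [:: u; v] -> path e a q -> u \notin q -> v \notin q -> path inner a q.
Proof.
elim: q a => //= b q IH a; rewrite !inE !negb_or => /andP[au av] /andP[ab ep].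
move=> /andP[ub uq] /andP[vb vq]; rewrite /inner ab au av eq_sym ub eq_sym vb /=.
by apply: IH => //; rewrite !inE eq_sym (negPf ub) eq_sym (negPf vb).
Qed.

Lemma inner_pathP a q :
  path inner a q -> [/\ path e a q, u \notin q & v \notin q].
Proof.
elim: q a => //= b q IH a /andP[/and5P[ab _ _ bu bv] /IH[-> uq vq]].
by rewrite ab !inE !negb_or eq_sym bu eq_sym bv uq vq.
Qed.

Lemma linked_k_connected k :
  u != v -> linked inner X Y (if e u v then k.-1 else k) ->
  exists s : 'I_k -> seq T,
    [/\ injective s, forall i, simple_path e u v (s i) &
        forall i j, i != j -> [disjoint s i & s j]].
Proof.
move=> uv [D [p [DX cD pD dD]]].
pose x i := nth u (enum D) i.
pose f i := x i :: p (x i).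
have xD i : i < #|D| -> x i \in D by move=> iD; rewrite -mem_enum mem_nth -?cardE.
have fs i : i < #|D| -> simple_path e u v (f i).
  move=> /xD xiD; case: (pD _ xiD) => /inner_pathP[ep up vp] uq.
  have := subsetP DX _ xiD; rewrite !inE => /and3P[ux xu xv] /and3P[lv lu lv'].
  rewrite /simple_path /= rcons_path ux ep lv /= rcons_uniq mem_rcons.
  rewrite !inE !mem_rcons !inE !negb_or uv (eq_sym u) xu up xv vp /=.
  by move: uq => /= /andP[-> ->].
have xinj i j : i < #|D| -> j < #|D| -> x i = x j -> i = j.
  by move=> iD jD /eqP; rewrite nth_uniq -?cardE ?enum_uniq // => /eqP.
have fd i j : i < #|D| -> j < #|D| -> i != j -> [disjoint f i & f j].
  move=> iD jD ij; rewrite disjoint_has; apply/hasPn=> w wi; apply/negP=> wj.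
  by case/eqP: ij; apply: xinj => //; apply: (dD _ _ w) => //; apply: xD.
have finj i j : i < #|D| -> j < #|D| -> f i = f j -> i = j.
  by move=> iD jD [/xinj->].
case: ifP cD => euv cD; last first.
  exists (fun i => f i); split=> [i j /finj|i|i j ij].
  - by rewrite cD !ltn_ord => /(_ isT isT) /val_inj.
  - by apply: fs; rewrite cD.
  - by apply: fd; rewrite ?cD.
(* Index [0] is the edge from [u] to [v]; the other indices are shifted by one along the linkage. *)
exists (fun i : 'I_k => if i == 0 :> nat then [::] else f i.-1).
have lt (i : 'I_k) : (i == 0 :> nat) = false -> i.-1 < #|D|.
  by case: i => -[|i] //= ik _; rewrite cD; case: (k) ik.
split=> [i j|i|i j ij].
- case: eqP => [i0|/eqP/negPf i0]; case: eqP => [j0|/eqP/negPf j0] //.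
    by move=> _; apply: val_inj; rewrite /= i0 j0.
  move=> /finj; rewrite !lt // => /(_ isT isT) E; apply: val_inj => /=.
  by case: (i : nat) (j : nat) i0 j0 E => [|a] [|b] //= _ _ ->.
- case: eqP => [i0|/eqP/negPf i0]; last by apply/fs/lt.
  by rewrite /simple_path /= euv inE uv.
- case: eqP => [i0|/eqP/negPf i0]; first by rewrite disjoint_has.
  case: eqP => [j0|/eqP/negPf j0]; first by rewrite disjoint_sym disjoint_has.
  apply: fd; rewrite ?lt //; apply: contraNneq ij => E; apply/eqP/val_inj => /=.
  by case: (i : nat) (j : nat) i0 j0 E => [|a] [|b] //= _ _ ->.
Qed.

End Internal.

Lemma k_connected_of_avoiding e k :
  k < #|T| ->
  (forall C u v, #|C| < k -> u \notin C -> v \notin C ->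
    exists p, [/\ path e u p, last u p = v & ~~ has (mem C) p]) ->
  k_connected e k.
Proof.
move=> kT H.
have {}H C u v : #|C| < k -> u \notin C -> v \notin C ->
    exists p, [/\ path e u p, last u p = v, ~~ has (mem C) p & uniq (u :: p)].
  move=> Ck uC vC; have [p [ep lp pC]] := H C u v Ck uC vC.
  move: lp pC; case/shortenP: ep => q eq uq sq lq pC; exists q; split=> //.
  by apply: contra pC => /hasP[w /sq wq wC]; apply/hasP; exists w.
move=> u v uv; apply: linked_k_connected => //.
apply: menger => C sepC; rewrite leqNgt; apply/negP=> Ck.
pose C0 := C :\: [set u; v].
have C0C : #|C0| <= #|C| by apply/subset_leq_card/subsetDl.
have uC0 : u \notin C0 by rewrite !inE eqxx.
have vC0 : v \notin C0 by rewrite !inE eqxx orbT.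
suff [a [q [eua eaq elv [uq vq]]]] : exists a q, [/\ e u a, path e a q,
    e (last a q) v & [/\ u \notin a :: q, v \notin a :: q & ~~ has (mem C0) (a :: q)]].
  move=> qC.
  have [au av] : a != u /\ a != v.
    by split; [apply: contraNneq uq | apply: contraNneq vq] => ->; rewrite mem_head.
  have uq' : u \notin q by apply: contra uq => uq; rewrite inE uq orbT.
  have vq' : v \notin q by apply: contra vq => vq; rewrite inE vq orbT.
  have /hasP[w wq wC] : has (mem C) (a :: q).
    apply: sepC; rewrite ?inE ?eua ?au ?av //.
      by apply: inner_path => //; rewrite !inE negb_or au.
    rewrite elv /=; apply/andP; split.
      by apply: contraNneq uq => <-; apply: mem_last.
    by apply: contraNneq vq => <-; apply: mem_last.
  case/negP: qC; apply/hasP; exists w => //=; rewrite !inE (wC : w \in C) andbT.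
  by rewrite negb_or; apply/andP; split; [apply: contraNneq uq | apply: contraNneq vq];
    move=> <-.
case: ifP Ck => euv Ck.
  (* The edge from [u] to [v] avoids every such set and gives no interior path, so the route goes
     through a third node [w]. Since [C] now has fewer than [k - 1] elements, [v] may also be
     removed on the way to [w], and [u] on the way from it. *)
  have [w] : exists w, w \notin u |: (v |: C0).
    apply/existsP; rewrite -negb_forall; apply/negP=> /forallP allw.
    suff : #|T| <= #|u |: (v |: C0)|.
      rewrite !cardsU1; have := leq_ltn_trans C0C Ck.
      move: kT; move: #|C0| #|T| => c t.
      by case: (u \notin _); case: (v \notin _) => /=; lia.
    by apply: subset_leq_card; apply/subsetP=> w _.
  rewrite in_setU1 negb_or => /andP[wu]; rewrite in_setU1 negb_or => /andP[wv wC0].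
  have small z : #|z |: C0| < k by rewrite cardsU1; case: (z \notin _) => /=; lia.
  have [||p [ep lp pC up]] := H (v |: C0) u w (small _).
  - by rewrite !inE negb_or uv eqxx.
  - by rewrite inE negb_or inE wv wC0.
  have [||q [eq lq qC uq]] := H (u |: C0) w v (small _).
  - by rewrite inE negb_or inE wu wC0.
  - by rewrite inE negb_or inE eq_sym uv vC0.
  case: p ep lp pC up => [|a p] /=; first by move=> _ E; rewrite E eqxx in wu.
  move=> /andP[eua ep] lp pC /and3P[uap ap up].
  case/lastP: q eq lq qC uq => [|q v'] /=; first by move=> _ E; rewrite E eqxx in wv.
  rewrite rcons_path last_rcons => /andP[eq ev] vv'; rewrite vv' in ev *.
  rewrite has_rcons rcons_uniq mem_rcons inE !negb_or.
  move=> /andP[_ qC] /and3P[/andP[_ wq] vq uq].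
  exists a, (p ++ q); split=> //; first by rewrite cat_path ep lp.
    by rewrite last_cat lp.
  move: pC; rewrite negb_or => /andP[aC pC].
  have hp z : z \in a :: p -> z \notin v |: C0.
    rewrite inE => /orP[/eqP->//|zp]; apply: contra pC => zC.
    by apply/hasP; exists z.
  have hq z : z \in q -> z \notin u |: C0.
    by move=> zq; apply: contra qC => zC; apply/hasP; exists z.
  split.
  - by rewrite -cat_cons mem_cat negb_or uap; apply/negP=> /hq; rewrite setU11.
  - by rewrite -cat_cons mem_cat negb_or vq andbT; apply/negP=> /hp; rewrite setU11.
  - rewrite -[_ || _]/(has (mem C0) ((a :: p) ++ q)) has_cat negb_or.
    apply/andP; split; apply/hasPn=> z.
      by move=> /hp; rewrite inE negb_or => /andP[].
    by move=> /hq; rewrite inE negb_or => /andP[].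
have [p [ep lp pC up]] := H C0 u v (leq_ltn_trans C0C Ck) uC0 vC0.
case/lastP: p ep lp pC up => [|p v'] /=; first by move=> _ E; rewrite E eqxx in uv.
rewrite rcons_path last_rcons => /andP[ep ev] vv'; rewrite vv' in ev *.
rewrite has_rcons rcons_uniq mem_rcons inE !negb_or.
move=> /andP[_ pC] /and3P[/andP[_ up] vp _].
case: p ep ev pC up vp => [|a p] /=; first by rewrite euv.
move=> /andP[eua ep] ev pC up vp; exists a, p; split=> //; split=> //.
Qed.

(** Fewer than [k] nodes [C] separate some [u] from some [v]. The components of [u] and [v] outside
    [C] are disjoint, so one has at most half of the nodes, and its neighbours lie in [C]. It is not
    a single node, whose degree would then be less than [k]. *)
Lemma small_connected_set e k :
  symmetric e -> irreflexive e -> k < #|T| -> ~ k_connected e k ->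
  (forall u, k <= #|[set w | e u w]|) ->
  exists A, [/\ 1 < #|A|, #|A|.*2 <= #|T|, connected_set e A & #|nbhd e A| < k].
Proof.
move=> esy eirr kT nkc deg.
have [C [u [v [Ck uC vC nouv]]]] : exists C u v, [/\ #|C| < k, u \notin C,
    v \notin C & ~ exists p, [/\ path e u p, last u p = v & ~~ has (mem C) p]].
  apply: contra_notP nkc => H; apply: k_connected_of_avoiding => // C u v Ck uC vC.
  by apply: contrapT => nop; apply: H; exists C, u, v.
pose eC a b := [&& e a b, a \notin C & b \notin C].
have eCs : connect_sym eC.
  by apply: sym_connect_sym => a b; rewrite /eC esy [(a \notin C) && _]andbC.
pose comp x := [set a | connect eC x a].
have pathC x p : path eC x p -> path e x p /\ ~~ has (mem C) p.
  elim: p x => //= y p IH x /andP[/and3P[exy xC yC] /IH[ep pC]].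
  by rewrite exy ep (negPf yC).
have compC x a : x \notin C -> a \in comp x -> a \notin C.
  move=> xC; rewrite inE => /connectP[p /pathC[_ pC] ->].
  by case/lastP: p pC => //= p y; rewrite has_rcons last_rcons negb_or => /andP[].
have nbC x : x \notin C -> nbhd e (comp x) \subset C.
  move=> xC; apply/subsetP=> y; rewrite inE => /andP[yA /exists_inP[z zA ezy]].
  apply/negPn/negP=> yC; case/negP: yA; move: (zA); rewrite !inE => /connect_trans.
  by apply; apply: connect1; rewrite /eC ezy yC (compC x).
have big x : x \notin C -> 1 < #|comp x|.
  move=> xC; have xA : x \in comp x by rewrite inE.
  rewrite ltnNge; apply/negP=> A1.
  have AE : comp x = [set x].
    by apply/esym/eqP; rewrite eqEcard sub1set xA cards1.
  suff sub : [set w | e x w] \subset nbhd e (comp x).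
    have := subset_leq_card (subset_trans sub (nbC x xC)).
    by move/(leq_trans (deg x)); rewrite leqNgt Ck.
  apply/subsetP=> w; rewrite AE !inE => exw.
  apply/andP; split; last by apply/exists_inP; exists x; rewrite ?inE.
  by apply: contraTneq exw => ->; rewrite eirr.
have conn x : x \notin C -> connected_set e (comp x).
  move=> xC; apply/forallP=> B; apply/implyP=> /andP[/andP[BA B0] BnA].
  apply: contraT => nex; case/negP: BnA; rewrite eqEsubset BA /=.
  case/set0Pn: B0 => b bB; apply/subsetP=> c cA.
  have clB : closed eC B.
    apply: intro_closed => // z w ezw zB; apply/negPn/negP=> wB.
    case/negP: nex; apply/exists_inP; exists z => //; apply/exists_inP; exists w.
      rewrite inE wB; have := subsetP BA z zB; rewrite !inE => /connect_trans; apply.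
      exact: connect1.
    by case/and3P: ezw.
  rewrite -(closed_connect clB (_ : connect eC b c)) //.
  apply: connect_trans (_ : connect eC b x) _; last by rewrite inE in cA.
  by rewrite eCs; have := subsetP BA b bB; rewrite inE.
have dis : [disjoint comp u & comp v].
  rewrite -setI_eq0; apply/eqP/setP=> a; rewrite !inE; apply/negP=> /andP[ua va].
  have /connectP[p /pathC[ep pC] lp] : connect eC u v.
    by apply: connect_trans ua _; rewrite eCs.
  by apply: nouv; exists p.
have sum : #|comp u| + #|comp v| <= #|T|.
  by have := leq_card_setU (comp u) (comp v) => -[_]; rewrite dis => /eqP <-; apply: max_card.
have fin x : x \notin C -> #|comp x|.*2 <= #|T| ->
    exists A, [/\ 1 < #|A|, #|A|.*2 <= #|T|, connected_set e A & #|nbhd e A| < k].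
  move=> xC xT; exists (comp x); split; [exact: big|done|exact: conn|].
  by apply: leq_ltn_trans Ck; apply/subset_leq_card/nbC.
by have [cle|/ltnW cle] := leqP #|comp u| #|comp v|; [apply: (fin u)|apply: (fin v)];
  rewrite // -addnn; apply: leq_trans sum; rewrite ?leq_add2l ?leq_add2r.
Qed.

End Connectivity.

(** * Independent uniform subsets *)

From mathcomp Require Import reals sequences exp ring lra.

Import Order.TTheory GRing.Theory Num.Theory.
Local Open Scope ring_scope.

Section Expectation.
Variables (R : realType) (I T : finType) (w : T -> R).
Implicit Types (S : {ffun I -> T}) (F G : {ffun I -> T} -> R).

Definition weight S : R := \prod_i w (S i).
Definition Ex F : R := \sum_S weight S * F S.
Definition upd S i t : {ffun I -> T} := [ffun j => if j == i then t else S j].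

Lemma ExD F G : Ex (fun S => F S + G S) = Ex F + Ex G.
Proof. by rewrite /Ex -big_split; apply: eq_bigr => S _; rewrite mulrDr. Qed.

Lemma ExZ c F : Ex (fun S => c * F S) = c * Ex F.
Proof. by rewrite /Ex mulr_sumr; apply: eq_bigr => S _; rewrite mulrCA. Qed.

Lemma ExN F : Ex (fun S => - F S) = - Ex F.
Proof. by rewrite /Ex -sumrN; apply: eq_bigr => S _; rewrite mulrN. Qed.

Lemma Ex_sum (J : Type) (r : seq J) (Q : pred J) (F : J -> {ffun I -> T} -> R) :
  Ex (fun S => \sum_(j <- r | Q j) F j S) = \sum_(j <- r | Q j) Ex (F j).
Proof.
by rewrite /Ex exchange_big; apply: eq_bigr => S _; rewrite mulr_sumr.
Qed.

Lemma eq_Ex F G : F =1 G -> Ex F = Ex G.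
Proof. by move=> FG; apply: eq_bigr => S _; rewrite FG. Qed.

Lemma upd_id S i t : upd S i t i = t.
Proof. by rewrite ffunE eqxx. Qed.

Lemma upd_other S i j t : j != i -> upd S i t j = S j.
Proof. by move=> /negPf ji; rewrite ffunE ji. Qed.

Hypothesis w_sum1 : \sum_t w t = 1.

(** Exchanging the coordinate [i] with an independent fresh copy is an involution that preserves the
    product weight. *)
Lemma Ex_resample i F : Ex F = Ex (fun S => \sum_t w t * F (upd S i t)).
Proof.
pose h (p : {ffun I -> T} * T) := (upd p.1 i p.2, p.1 i).
have hK : involutive h.
  move=> [S t]; rewrite /h /= upd_id; congr pair.
  by apply/ffunP=> j; rewrite !ffunE; case: eqP => // ->.
have wh p : weight (h p).1 * w (h p).2 = weight p.1 * w p.2.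
  rewrite /weight /= (bigD1 i) //= [in RHS](bigD1 i) //= upd_id.
  rewrite [X in _ * X * _](eq_bigr (fun j => w (p.1 j))); first by ring.
  by move=> j ji; rewrite upd_other.
transitivity (\sum_p weight p.1 * w p.2 * F p.1).
  rewrite -(pair_bigA _ (fun S t => weight S * w t * F S)) /=.
  by apply: eq_bigr => S _; rewrite -mulr_suml -mulr_sumr w_sum1 mulr1.
rewrite (reindex h) /=; last by exists h => p _; apply: hK.
under eq_bigr => p _ do rewrite wh.
rewrite -(pair_bigA _ (fun S t => weight S * w t * F (upd S i t))) /=.
by apply: eq_bigr => S _; rewrite mulr_sumr; apply: eq_bigr => t _; rewrite mulrA.
Qed.

Lemma Ex_prod_seq (s : seq I) g (h : I -> T -> {ffun I -> T} -> R) :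
  uniq s -> (forall i t S, i \in s -> g (upd S i t) = g S) ->
  (forall i t S, i \in s -> forall j t', h j t' (upd S i t) = h j t' S) ->
  Ex (fun S => g S * \prod_(j <- s) h j (S j) S) =
  Ex (fun S => g S * \prod_(j <- s) \sum_t w t * h j t S).
Proof.
elim: s g => [|i s IH] g /=; first by move=> *; apply: eq_Ex => S; rewrite !big_nil.
case/andP=> si us gs hs.
have hs' j t S : j \in s -> forall j' t', h j' t' (upd S j t) = h j' t' S.
  by move=> js; apply: hs; rewrite inE js orbT.
transitivity (Ex (fun S => g S * h i (S i) S * \prod_(j <- s) h j (S j) S)).
  by apply: eq_Ex => S; rewrite big_cons mulrA.
rewrite (IH (fun S => g S * h i (S i) S)) //; last first.
  move=> j t S js; rewrite hs' // upd_other ?gs // ?inE ?js ?orbT //.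
  by apply: contraNneq si => ->.
rewrite (Ex_resample i); apply: eq_Ex => S.
rewrite big_cons mulrA mulr_sumr mulr_suml; apply: eq_bigr => t _.
rewrite gs ?mem_head // hs ?mem_head // upd_id.
rewrite [X in _ * (_ * X)](eq_bigr (fun j => \sum_t w t * h j t S)); first by ring.
move=> j _; apply: eq_bigr => t' _; by rewrite hs ?mem_head.
Qed.

(* Conditional independence: given the coordinates outside [B], those in [B] are
   averaged out one by one. *)
Lemma Ex_prod (B : {set I}) g (h : I -> T -> {ffun I -> T} -> R) :
  (forall i t S, i \in B -> g (upd S i t) = g S) ->
  (forall i t S, i \in B -> forall j t', h j t' (upd S i t) = h j t' S) ->
  Ex (fun S => g S * \prod_(j in B) h j (S j) S) =
  Ex (fun S => g S * \prod_(j in B) \sum_t w t * h j t S).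
Proof.
move=> gB hB; have := @Ex_prod_seq (enum B) g h (enum_uniq _).
under eq_Ex do rewrite big_enum.
under [in X in (_ -> _ -> _ = X)]eq_Ex do rewrite big_enum.
by apply=> i t S; rewrite mem_enum => iB; [apply: gB | apply: hB].
Qed.

Lemma Ex_cst c : Ex (fun=> c) = c.
Proof.
rewrite /Ex -mulr_suml -(bigA_distr_bigA (fun=> w)) big1 ?mul1r //.
Qed.

Hypothesis w_ge0 : forall t, 0 <= w t.

Lemma weight_ge0 S : 0 <= weight S.
Proof. by apply: prodr_ge0. Qed.

(** Comparing only on families of nonzero weight lets later bounds assume that every set has exactly
    [K] elements. *)
Lemma Ex_le F G : (forall S, weight S != 0 -> F S <= G S) -> Ex F <= Ex G.
Proof.
move=> FG; apply: ler_sum => S _; have [->|wS] := eqVneq (weight S) 0.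
  by rewrite !mul0r.
by rewrite ler_wpM2l ?weight_ge0 ?FG.
Qed.

Lemma Ex_ge0 F : (forall S, 0 <= F S) -> 0 <= Ex F.
Proof. by move=> F0; apply: sumr_ge0 => S _; rewrite mulr_ge0 ?weight_ge0. Qed.

End Expectation.

(** * Estimates for a single uniform subset *)

Section UniformSubset.
Variables (R : realType) (P K : nat).
Hypotheses (P_gt0 : (0 < P)%N) (KP : (K <= P)%N).
Notation u := (@unif_subset R P K).
Definition avg (g : {set 'I_P} -> R) : R := \sum_s u s * g s.

Lemma bin_gt0R : 0 < ('C(P, K)%:R : R).
Proof. by rewrite ltr0n bin_gt0. Qed.

Lemma unif_ge0 s : 0 <= u s.
Proof. by rewrite /unif_subset; case: ifP => // _; rewrite invr_ge0 ler0n. Qed.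

Lemma unif_sum1 : \sum_s u s = 1.
Proof.
rewrite /unif_subset -big_mkcond /= sumr_const.
have -> : #|[pred s : {set 'I_P} | #|s| == K]| = 'C(P, K).
  by rewrite -[in RHS](card_ord P) -card_draws cardsE.
by rewrite -[LHS]mulr_natr mulVf // gt_eqF ?bin_gt0R.
Qed.

Lemma avg_count (Q : pred {set 'I_P}) :
  avg (fun s => (Q s)%:R) = #|[set s | Q s & #|s| == K]|%:R / 'C(P, K)%:R.
Proof.
rewrite -sum1_card natr_sum mulr_suml [RHS]big_mkcond /=.
apply: eq_bigr => s _; rewrite inE /unif_subset.
by case: (Q s); case: eqP => _ /=; rewrite ?mulr0 ?mul0r ?mulr1 ?mul1r.
Qed.

Lemma avg_le g1 g2 :
  (forall s : {set 'I_P}, #|s| = K -> g1 s <= g2 s) -> avg g1 <= avg g2.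
Proof.
move=> g12; apply: ler_sum => s _; rewrite /unif_subset.
by case: eqP => [sK|_]; rewrite ?mul0r // ler_wpM2l ?invr_ge0 ?ler0n ?g12.
Qed.

Lemma eq_avg g1 g2 : g1 =1 g2 -> avg g1 = avg g2.
Proof. by move=> g12; apply: eq_bigr => s _; rewrite g12. Qed.

Lemma avg_sum (J : Type) (r : seq J) (Q : pred J) (F : J -> {set 'I_P} -> R) :
  avg (fun s => \sum_(j <- r | Q j) F j s) = \sum_(j <- r | Q j) avg (F j).
Proof.
by rewrite /avg exchange_big; apply: eq_bigr => S _; rewrite mulr_sumr.
Qed.

Lemma avgZ c g : avg (fun s => c * g s) = c * avg g.
Proof. by rewrite /avg mulr_sumr; apply: eq_bigr => S _; rewrite mulrCA. Qed.

Lemma avg_cst c : avg (fun=> c) = c.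
Proof. by rewrite /avg -mulr_suml unif_sum1 mul1r. Qed.

Lemma avgB g1 g2 : avg (fun s => g1 s - g2 s) = avg g1 - avg g2.
Proof.
by rewrite /avg -sumrN -big_split; apply: eq_bigr => S _; rewrite mulrBr.
Qed.

Lemma ffact_ratio x m : (x <= P)%N -> (x ^_ m * P ^ m <= x ^ m * P ^_ m)%N.
Proof.
move=> xP; elim: m => // m IH; rewrite !ffactnSr !expnSr.
have [mx|xm] := leqP m x; last by rewrite (eqP (ltnW xm)) muln0 mul0n.
rewrite mulnACA [leqRHS]mulnACA; apply: leq_mul => //.
by rewrite mulnBl mulnBr leq_sub2l // mulnC leq_mul2l xP orbT.
Qed.

Lemma bin_ratio x m : (x <= P)%N -> (m <= P)%N ->
  'C(x, m)%:R / 'C(P, m)%:R <= (x%:R / P%:R : R) ^+ m.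
Proof.
move=> xP mP; rewrite expr_div_n ler_pdivlMr ?exprn_gt0 ?ltr0n //.
rewrite mulrAC ler_pdivrMr ?ltr0n ?bin_gt0 //.
rewrite -!natrX -!natrM ler_nat -(leq_pmul2r (fact_gt0 m)).
by rewrite mulnAC bin_ffact -mulnA bin_ffact ffact_ratio.
Qed.

Lemma avg_sub (X : {set 'I_P}) :
  avg (fun s => (s \subset X)%:R) <= (#|X|%:R / P%:R) ^+ K.
Proof.
by rewrite avg_count cards_draws bin_ratio // -[leqRHS]card_ord max_card.
Qed.

(** The quotient is the probability that [d] given objects all lie in a uniform [K]-set, counted
    through complements. It is a product of factors [(K - j) / (P - j)], each at most [K / P]. *)
Lemma bin_ratio_top d : (d <= P)%N ->
  'C(P - d, P - K)%:R / 'C(P, K)%:R <= (K%:R / P%:R : R) ^+ d.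
Proof.
rewrite ler_pdivrMr ?bin_gt0R // -(bin_sub KP).
elim: d => [|d IH] dP; first by rewrite subn0 expr0 mul1r.
have := mul_bin_down (P - d) (P - K); have -> : (P - d).-1 = (P - d.+1)%N by lia.
move=> E; have Pd : (0 : R) < (P - d)%:R by rewrite ltr0n; lia.
rewrite -(ler_pM2l Pd) -natrM E natrM exprS.
apply: (@le_trans _ _ ((P - d - (P - K))%:R * ((K%:R / P%:R) ^+ d * 'C(P, P - K)%:R))).
  by rewrite ler_wpM2l ?ler0n ?IH // ltnW.
set q := (_ / _) ^+ d.
have q0 : 0 <= q * 'C(P, P - K)%:R by rewrite mulr_ge0 ?exprn_ge0 ?divr_ge0 ?ler0n.
suff H : (P - d - (P - K))%:R <= (P - d)%:R * (K%:R / P%:R) :> R.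
  apply: le_trans (ler_wpM2r q0 H) _.
  by rewrite le_eqVlt; apply/orP; left; apply/eqP; ring.
rewrite mulrA ler_pdivlMr ?ltr0n // -!natrM ler_nat.
have [dK|Kd] := leqP d K; last by have -> : (P - d - (P - K) = 0)%N by lia.
have -> : (P - d - (P - K) = K - d)%N by lia.
by rewrite !mulnBl [(P * K)%N]mulnC leq_sub2l // leq_mul2l KP orbT.
Qed.

Lemma avg_sup (J : {set 'I_P}) :
  avg (fun s => (J \subset s)%:R) <= (K%:R / P%:R) ^+ #|J|.
Proof.
have JP : (#|J| <= P)%N by rewrite -[leqRHS]card_ord max_card.
rewrite avg_count.
have -> : #|[set s : {set 'I_P} | J \subset s & #|s| == K]| = 'C(P - #|J|, P - K).
  have -> : (P - #|J| = #|~: J|)%N by rewrite [in RHS]cardsCs setCK card_ord.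
  rewrite -cards_draws -(card_imset _ (inv_inj (@setCK _))).
  apply: eq_card => s; rewrite !inE; apply/imsetP/andP=> [[t]|[sJ sK]].
    rewrite inE => /andP[Jt /eqP tK] ->; rewrite setCS Jt; split=> //.
    by rewrite cardsCs setCK card_ord tK.
  exists (~: s); rewrite ?setCK // inE -setCS setCK sJ.
  by rewrite cardsCs setCK card_ord (eqP sK) subKn ?eqxx.
exact: bin_ratio_top.
Qed.

Lemma avg_avoid_le (W : {set 'I_P}) :
  avg (fun s => (s :&: W == set0)%:R) <= expR (- (K%:R * #|W|%:R / P%:R)).
Proof.
have -> : avg (fun s => (s :&: W == set0)%:R) = avg (fun s => (s \subset ~: W)%:R).
  by apply: eq_avg => s; rewrite setI_eq0 disjoints_subset.
apply: le_trans (avg_sub _) _.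
have -> : - (K%:R * #|W|%:R / P%:R) = K%:R * (- (#|W|%:R / P%:R)) :> R by ring.
rewrite expRM_natl lerXn2r ?nnegrE ?expR_ge0 ?divr_ge0 ?ler0n //.
apply: le_trans (expR_ge1Dx _).
have WP : (#|W| <= P)%N by rewrite -[leqRHS]card_ord max_card.
rewrite cardsCs setCK card_ord natrB // mulrBl divff //.
by rewrite pnatr_eq0 -lt0n.
Qed.

Lemma avg_touch_le (W : {set 'I_P}) :
  avg (fun s => (s :&: W != set0)%:R) <= K%:R * #|W|%:R / P%:R.
Proof.
apply: (@le_trans _ _ (avg (fun s => \sum_(x in W) ([set x] \subset s)%:R))).
  apply: avg_le => s _; case: set0Pn => [[x /setIP[xs xW]]|_]; last first.
    by rewrite sumr_ge0.
  by rewrite (bigD1 x) //= sub1set xs lerDl sumr_ge0.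
rewrite avg_sum; apply: (@le_trans _ _ (\sum_(x in W) K%:R / P%:R)).
  by apply: ler_sum => x _; apply: le_trans (avg_sup _) _; rewrite cards1.
by rewrite sumr_const -[leLHS]mulr_natr mulrAC.
Qed.

Lemma avg_touchE (W : {set 'I_P}) :
  avg (fun s => (s :&: W != set0)%:R) = 1 - avg (fun s => (s :&: W == set0)%:R).
Proof.
rewrite -[X in X - _](avg_cst 1) -avgB; apply: eq_avg => s.
by case: eqP; rewrite ?subrr ?subr0.
Qed.

Lemma sum_subsets (T : finType) (W : {set T}) (y : R) :
  \sum_(J : {set T}) \prod_(x in J) (y * (x \in W)%:R) = (1 + y) ^+ #|W|.
Proof.
transitivity (\prod_x (y * (x \in W)%:R + 1)).
  by rewrite bigA_distr; apply: eq_bigr => J _; rewrite [LHS]big_mkcond.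
rewrite (bigID (mem W)) /= [X in _ * X]big1 ?mulr1; last first.
  by move=> x /negPf ->; rewrite mulr0 add0r.
by under eq_bigr => x -> do rewrite mulr1 addrC; rewrite prodr_const.
Qed.

(* Binomial expansion of [z = 1 + (z - 1)], bounded termwise with [avg_sup]. *)
Lemma avg_exp (W : {set 'I_P}) (z : R) : 1 <= z ->
  avg (fun s => z ^+ #|s :&: W|) <= expR ((z - 1) * (K%:R * #|W|%:R / P%:R)).
Proof.
move=> z1; have y0 : 0 <= z - 1 by rewrite subr_ge0.
apply: (@le_trans _ _ ((1 + (z - 1) * (K%:R / P%:R)) ^+ #|W|)); last first.
  have -> : (z - 1) * (K%:R * #|W|%:R / P%:R) =
    #|W|%:R * ((z - 1) * (K%:R / P%:R)) by ring.
  rewrite expRM_natl lerXn2r ?nnegrE ?expR_ge0 ?expR_ge1Dx //.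
  by rewrite addr_ge0 // mulr_ge0 // divr_ge0.
rewrite -sum_subsets.
have -> : avg (fun s => z ^+ #|s :&: W|) = avg (fun s => \sum_(J : {set 'I_P})
    (\prod_(x in J) ((z - 1) * (x \in W)%:R)) * (J \subset s)%:R).
  apply: eq_avg => s; have -> : z = 1 + (z - 1) by ring.
  rewrite -sum_subsets; apply: eq_bigr => J _; have -> : 1 + (z - 1) - 1 = z - 1 by ring.
  have [/subsetP Js|/subsetPn[x xJ xs]] := boolP (J \subset s); rewrite ?mulr1 ?mulr0.
    by apply: eq_bigr => x xJ; rewrite inE Js.
  by apply/eqP; rewrite prodf_seq_eq0; apply/hasP; exists x;
    rewrite ?mem_index_enum // inE (negPf xs) mulr0 eqxx xJ.
rewrite avg_sum; apply: ler_sum => J _; rewrite avgZ.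
have -> : \prod_(x in J) ((z - 1) * (K%:R / P%:R) * (x \in W)%:R) =
  \prod_(x in J) ((z - 1) * (x \in W)%:R) * (K%:R / P%:R) ^+ #|J|.
  by rewrite -prodr_const -big_split; apply: eq_bigr => x _; rewrite /= mulrAC.
rewrite ler_wpM2l ?avg_sup //; apply: prodr_ge0 => x _.
by rewrite mulr_ge0.
Qed.

(** Choose one common object with each [F i]. The chosen objects are distinct by disjointness, so
    [avg_sup] gives a factor [K / P] for each, and there are [K] choices for each. *)
Lemma avg_touch_all (I : finType) (B : {set I}) (F : I -> {set 'I_P}) :
  (forall i, i \in B -> #|F i| = K) ->
  (forall i j, i \in B -> j \in B -> i != j -> [disjoint F i & F j]) ->
  avg (fun s => [forall i in B, s :&: F i != set0]%:R) <=
  (K%:R ^+ 2 / P%:R) ^+ #|B|.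
Proof.
move=> FK Fd.
pose x0 := Ordinal P_gt0.
apply: (@le_trans _ _ (avg (fun s => \prod_(i in B) \sum_(x in F i) (x \in s)%:R))).
  apply: avg_le => s _; case: forall_inP => [sF|_]; last first.
    by apply: prodr_ge0 => i _; apply: sumr_ge0.
  apply: (@le_trans _ _ (\prod_(i in B) 1)); first by rewrite big1.
  apply: ler_prod => i iB; rewrite ler01 /=; have /set0Pn[x] := sF i iB.
  by rewrite inE => /andP[xs xF]; rewrite (bigD1 x) //= xs lerDl sumr_ge0.
have distr := big_distr_big_dep x0 (mem B) (fun i x => x \in F i).
under eq_avg do rewrite distr.
rewrite avg_sum.
have -> : (K%:R ^+ 2 / P%:R) ^+ #|B| = \prod_(i in B) \sum_(x in F i) (K%:R / P%:R) :> R.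
  rewrite -prodr_const; apply: eq_bigr => i iB.
  by rewrite sumr_const FK // -[RHS]mulr_natr expr2 mulrAC.
rewrite distr; apply: ler_sum => f /pfamilyP[_ fF].
rewrite prodr_const.
have finj : {in B &, injective f}.
  move=> i j iB jB fij; apply: contraTeq (fF j jB) => ij.
  have := Fd i j iB jB ij; rewrite disjoints_subset => /subsetP/(_ (f i) (fF i iB)).
  by rewrite fij inE.
rewrite -(card_in_imset finj); apply: le_trans (avg_sup _).
apply: avg_le => s _; have [/subsetP fs|/subsetPn[_ /imsetP[i iB ->] fs]] :=
  boolP (f @: B \subset s).
  by rewrite big1 // => i iB; rewrite fs // imset_f.
by rewrite (bigD1 i) //= (negPf fs) mul0r.
Qed.

End UniformSubset.

(** * Pools and neighbourhoods in the intersection graph *)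

Lemma binR_le (R : realType) (n c : nat) :
  'C(n, c)%:R <= n%:R ^+ c / c`!%:R :> R.
Proof.
rewrite ler_pdivlMr ?ltr0n ?fact_gt0 // -natrX -natrM ler_nat bin_ffact.
by elim: c => // c IH; rewrite ffactnSr expnSr leq_mul // leq_subr.
Qed.

Lemma sum_small_sets (R : realType) (T : finType) (c0 : nat) (x : R) :
  \sum_(C : {set T} | (#|C| <= c0)%N) x ^+ #|C| =
  \sum_(c < c0.+1) 'C(#|T|, c)%:R * x ^+ c.
Proof.
pose f (C : {set T}) : 'I_c0.+1 := inord #|C|.
rewrite (partition_big f xpredT) //=; apply: eq_bigr => c _.
rewrite -card_draws -sum1_card natr_sum mulr_suml.
apply: eq_big => [C|C /andP[Cc /eqP <-]]; last by rewrite inordK // mul1r.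
rewrite inE; apply/andP/eqP=> [[Cc /eqP <-]|Cc]; first by rewrite inordK.
have Cc0 : (#|C| <= c0)%N by rewrite Cc -ltnS.
by split=> //; apply/eqP; rewrite /f Cc inord_val.
Qed.

Lemma sum_small_sets_le (R : realType) (T : finType) (c0 : nat) (x : R) :
  0 <= x -> \sum_(C : {set T} | (#|C| <= c0)%N) x ^+ #|C| <=
  \sum_(c < c0.+1) (#|T|%:R * x) ^+ c / c`!%:R.
Proof.
move=> x0; rewrite sum_small_sets; apply: ler_sum => c _.
by rewrite exprMn mulrAC ler_wpM2r ?exprn_ge0 ?binR_le.
Qed.

Lemma sum_pow_le (R : realType) (c0 : nat) (x : R) :
  1 <= x -> \sum_(c < c0.+1) x ^+ c / c`!%:R <= c0.+1%:R * x ^+ c0.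
Proof.
move=> x1; rewrite -[c0.+1]card_ord mulrC mulr_natr -sumr_const.
rewrite [X in _ <= X]big_mkcond /= card_ord; apply: ler_sum => c _.
rewrite ler_pdivrMr ?ltr0n ?fact_gt0 // -[leLHS]mulr1.
rewrite ler_pM ?exprn_ge0 ?(le_trans ler01) ?ler1n ?fact_gt0 //.
by rewrite ler_weXn2l // -ltnS.
Qed.

Section IntersectionGraph.
Variables (R : realType) (n P K : nat).
Hypotheses (P_gt0 : (0 < P)%N) (KP : (K <= P)%N).
Notation u := (@unif_subset R P K).
Notation E := (@Ex R 'I_n {set 'I_P} u).
Notation y := (K%:R ^+ 2 / P%:R : R).
Implicit Types (A B C : {set 'I_n}) (S : {ffun 'I_n -> {set 'I_P}}).

Let u1 := @unif_sum1 R P K KP.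
Let u0 := @unif_ge0 R P K.

Definition pool A S : {set 'I_P} := \bigcup_(i in A) S i.

Lemma weight_neq0 S : weight u S != 0 -> forall i, #|S i| = K.
Proof.
move=> /prodf_neq0 H i; have := H i isT; rewrite /unif_subset.
by case: ifP => [/eqP //|_]; rewrite eqxx.
Qed.

Lemma pool_upd A S j t : j \notin A -> pool A (upd S j t) = pool A S.
Proof.
move=> jA; apply: eq_bigr => i iA; rewrite upd_other //.
by apply: contraNneq jA => <-.
Qed.

Lemma nbhd_intersection_graph A S :
  nbhd (intersection_graph S) A = [set j | (j \notin A) && (S j :&: pool A S != set0)].
Proof.
apply/setP=> j; rewrite !inE; have [//|jA] := boolP (j \in A); rewrite /=.
apply/exists_inP/set0Pn=> [[i iA /andP[_ /set0Pn[x /setIP[xi xj]]]]|[x]].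
  by exists x; rewrite inE xj; apply/bigcupP; exists i.
case/setIP=> xj /bigcupP[i iA xi]; exists i => //; apply/andP; split.
  by apply: contraNneq jA => <-.
by apply/set0Pn; exists x; rewrite inE xi.
Qed.

Lemma card_pool A S : (forall i, #|S i| = K) -> (#|pool A S| <= #|A| * K)%N.
Proof.
move=> SK; rewrite -sum_nat_const /pool.
elim/big_ind2: _ => [|X a Y b Xa Yb|i _]; rewrite ?cards0 ?SK //.
by apply: leq_trans (leq_add Xa Yb); apply: leq_card_setU.
Qed.

Lemma y_ge0 : 0 <= y.
Proof. by rewrite divr_ge0 ?exprn_ge0. Qed.

(** Union bound over the neighbourhood [C] of [A]. Given the sets in [A], the other nodes are
    independent: each node of [C] meets the pool with probability at most [#|A| y], and at least
    [n - #|A| - c0] nodes must miss it. The weight [g] carries any information on the sets in [A]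
    themselves. *)
Lemma nbhd_tail A c0 (g : {ffun 'I_n -> {set 'I_P}} -> R) :
  (forall S, 0 <= g S) -> (forall i t S, i \notin A -> g (upd S i t) = g S) ->
  E (fun S => g S * (#|nbhd (intersection_graph S) A| <= c0)%:R) <=
  (\sum_(C : {set 'I_n} | (#|C| <= c0)%N) (#|A|%:R * y) ^+ #|C|) *
  E (fun S => g S * expR (- ((n - #|A| - c0)%:R * (K%:R * #|pool A S|%:R / P%:R)))).
Proof.
move=> g0 gA.
have ry0 : 0 <= #|A|%:R * y := mulr_ge0 (ler0n _ _) y_ge0.
pose h C j (t : {set 'I_P}) S : R := ((t :&: pool A S != set0) == (j \in C))%:R.
apply: (@le_trans _ _ (\sum_(C : {set 'I_n} | (C \subset ~: A) && (#|C| <= c0)%N)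
    E (fun S => g S * \prod_(j in ~: A) h C j (S j) S))).
  rewrite -Ex_sum; apply: Ex_le => // S _; rewrite -mulr_sumr ler_wpM2l //.
  set N := nbhd _ _; have NA : N \subset ~: A.
    by rewrite /N nbhd_intersection_graph; apply/subsetP=> j; rewrite !inE => /andP[].
  have h0 C j t : 0 <= h C j t S by rewrite /h; case: (_ == _).
  have [Nc|_] := leqP; last by apply: sumr_ge0 => C _; apply: prodr_ge0.
  rewrite (bigD1 N) /= ?NA // big1 ?lerDl.
    by apply: sumr_ge0 => C _; apply: prodr_ge0.
  move=> j; rewrite !inE => jA.
  by rewrite /h /N nbhd_intersection_graph !inE jA eqxx.
pose f S C := (#|A|%:R * y) ^+ #|C| *
  expR (- ((n - #|A| - c0)%:R * (K%:R * #|pool A S|%:R / P%:R))).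
apply: (@le_trans _ _ (\sum_(C : {set 'I_n} | (C \subset ~: A) && (#|C| <= c0)%N)
    E (fun S => g S * f S C))); last first.
  rewrite mulr_suml [leRHS](bigID (fun C : {set 'I_n} => C \subset ~: A)) /=.
  rewrite -[leLHS]addr0 lerD //; last first.
    apply: sumr_ge0 => C _; rewrite mulr_ge0 ?exprn_ge0 //.
    by apply: Ex_ge0 => // S; rewrite mulr_ge0 ?expR_ge0.
  under [leRHS]eq_bigl do rewrite andbC.
  apply: ler_sum => C _; rewrite -ExZ; apply: Ex_le => // S _.
  by rewrite mulrCA.
apply: ler_sum => C /andP[CA Cc].
rewrite (Ex_prod u1); last 2 first.
- by move=> i t S; rewrite inE => iA; apply: gA.
- by move=> i t S; rewrite inE => iA j t'; rewrite /h pool_upd.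
apply: Ex_le => // S wS; rewrite ler_wpM2l //.
set q := K%:R * #|pool A S|%:R / P%:R : R.
have q0 : 0 <= q by rewrite divr_ge0 ?mulr_ge0.
have qy : q <= #|A|%:R * y.
  have := card_pool A (weight_neq0 wS); rewrite -(ler_nat R) natrM => H.
  have -> : #|A|%:R * y = K%:R * (#|A|%:R * K%:R) / P%:R by ring.
  by rewrite ler_pM2r ?invr_gt0 ?ltr0n // ler_wpM2l.
have avg_h0 j : 0 <= \sum_t u t * h C j t S.
  by apply: sumr_ge0 => t _; rewrite mulr_ge0 ?u0 // /h; case: (_ == _).
rewrite (big_setID C) /= (setIidPr CA).
apply: ler_pM; [by apply: prodr_ge0|by apply: prodr_ge0| |].
  rewrite -prodr_const; apply: ler_prod => j jC; rewrite avg_h0 /=.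
  apply: le_trans qy; rewrite /q -/(avg _ _); apply: le_trans (avg_touch_le R P_gt0 KP _).
  apply: ler_sum => t _; rewrite ler_wpM2l ?u0 // /h jC.
  by case: (_ != _).
apply: (@le_trans _ _ (\prod_(j in ~: A :\: C) expR (- q))).
  apply: ler_prod => j; rewrite inE => /andP[/negPf jC _]; rewrite avg_h0 /=.
  apply: le_trans (avg_avoid_le R P_gt0 KP (pool A S)).
  apply: ler_sum => t _; rewrite ler_wpM2l ?u0 // /h jC.
  by case: (t :&: _ == set0).
rewrite prodr_const -expRM_natl ler_expR mulrN lerN2 ler_wpM2r // ler_nat.
rewrite cardsD (setIidPr CA) [#|~: A|]cardsCs setCK card_ord.
by rewrite leq_sub2l.
Qed.

(** Nodes are exposed one at a time: a new node adds to the deficit the size of its intersection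
    with the pool so far, whose exponential moment is bounded by [avg_exp]. The exponents add up
    because [b + b^2 <= (b + 1)^2]. *)
Lemma E_overlap A (z : R) : 1 <= z ->
  E (fun S => z ^+ (#|A| * K - #|pool A S|)) <= expR ((z - 1) * (#|A|%:R ^+ 2 * y)).
Proof.
move=> z1; have [m] := ubnP #|A|; elim: m A => // m IH A; rewrite ltnS => Am.
have z0 : 0 <= z by apply: le_trans z1.
have [->|[a aA]] := set_0Vmem A.
  rewrite (_ : E _ = E (fun=> 1)); last first.
    by apply: eq_Ex => S; rewrite cards0 mul0n sub0n.
  by rewrite (Ex_cst _ u1) cards0 expr0n mul0r mulr0 expR0.
set B := A :\ a; have cA : #|A| = #|B|.+1 by rewrite /B (cardsD1 a A) aA.
have aB : a \notin B by rewrite !inE eqxx.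
have UA S : pool A S = S a :|: pool B S by rewrite /pool -(setD1K aA) big_setU1.
apply: (@le_trans _ _ (E (fun S => z ^+ (#|B| * K - #|pool B S|) *
    \prod_(j in [set a]) z ^+ #|S j :&: pool B S|))).
  apply: Ex_le => // S wS; have SK := weight_neq0 wS.
  rewrite big_set1 -exprD UA cA ler_weXn2l // cardsU SK.
  have := card_pool B SK; have := subset_leq_card (subsetIl (S a) (pool B S)).
  by rewrite SK; lia.
rewrite (Ex_prod u1 (h := fun j t S => z ^+ #|t :&: pool B S|)); last 2 first.
- by move=> i t S; rewrite inE => /eqP ->; rewrite pool_upd.
- by move=> i t S; rewrite inE => /eqP -> j t'; rewrite pool_upd.
apply: (@le_trans _ _ (expR ((z - 1) * (#|B|%:R * y)) *
    E (fun S => z ^+ (#|B| * K - #|pool B S|)))).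
  rewrite -ExZ; apply: Ex_le => // S wS; rewrite big_set1 mulrC.
  rewrite ler_wpM2r ?exprn_ge0 //; apply: le_trans (avg_exp P_gt0 KP _ z1) _.
  rewrite ler_expR ler_wpM2l ?subr_ge0 //.
  have := card_pool B (weight_neq0 wS); rewrite -(ler_nat R) natrM => H.
  have -> : #|B|%:R * y = K%:R * (#|B|%:R * K%:R) / P%:R by ring.
  by rewrite ler_pM2r ?invr_gt0 ?ltr0n // ler_wpM2l.
apply: (@le_trans _ _ (expR ((z - 1) * (#|B|%:R * y)) *
    expR ((z - 1) * (#|B|%:R ^+ 2 * y)))).
  by rewrite ler_wpM2l ?expR_ge0 // IH //; rewrite cA in Am.
rewrite -expRD ler_expR -mulrDr ler_wpM2l ?subr_ge0 // -mulrDl ler_wpM2r ?y_ge0 //.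
by rewrite cA -natr1; have := ler0n R #|B|; nra.
Qed.

(** A deficit [T] of the pool costs a factor [exp (lam T)] in [nbhd_tail], where [lam = n K / P]. On
    [T >= t] it is at most [(exp lam / z)^t z^T], and [E_overlap] bounds the mean of [z^T]. *)
Lemma overlap_nbhd_tail A t c0 (z : R) :
  1 <= z -> expR (n%:R * (K%:R / P%:R)) <= z ->
  E (fun S => (t <= #|A| * K - #|pool A S|)%:R *
              (#|nbhd (intersection_graph S) A| <= c0)%:R) <=
  (\sum_(C : {set 'I_n} | (#|C| <= c0)%N) (#|A|%:R * y) ^+ #|C|) *
  (expR (- ((n - #|A| - c0)%:R * (#|A|%:R * y))) *
   (expR (n%:R * (K%:R / P%:R)) / z) ^+ t * expR (z * (#|A|%:R ^+ 2 * y))).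
Proof.
set z0 := expR _ => z1 z0z; have zgt0 : 0 < z by apply: lt_le_trans z1.
apply: le_trans (nbhd_tail _ _ _) _.
- by move=> S; case: leqP.
- by move=> i s S iA; rewrite pool_upd.
rewrite ler_wpM2l //.
  by apply: sumr_ge0 => C _; rewrite exprn_ge0 // mulr_ge0 // y_ge0.
set M := (_ - _ - _)%N.
have q0 : 0 <= z0 / z by rewrite divr_ge0 ?expR_ge0 ?ltW.
apply: (@le_trans _ _ (expR (- (M%:R * (#|A|%:R * y))) * (z0 / z) ^+ t *
    E (fun S => z ^+ (#|A| * K - #|pool A S|)))); last first.
  rewrite ler_wpM2l ?mulr_ge0 ?expR_ge0 ?exprn_ge0 //.
  apply: le_trans (E_overlap A z1) _; rewrite ler_expR ler_wpM2r //.
    by rewrite mulr_ge0 ?exprn_ge0 ?y_ge0.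
  by rewrite gerBl.
rewrite -ExZ; apply: Ex_le => // S wS.
case: leqP => [tT|_]; last first.
  by rewrite mul0r !mulr_ge0 ?expR_ge0 ?exprn_ge0 // ltW.
rewrite mul1r.
have pA := card_pool A (weight_neq0 wS).
set T := (_ - _)%N in tT *.
have -> : #|pool A S|%:R = #|A|%:R * K%:R - T%:R :> R.
  by rewrite -natrM -natrB ?leq_subr // /T subKn.
have -> : - (M%:R * (K%:R * (#|A|%:R * K%:R - T%:R) / P%:R)) =
  - (M%:R * (#|A|%:R * y)) + T%:R * (M%:R * (K%:R / P%:R)) :> R by ring.
rewrite expRD -mulrA ler_wpM2l ?expR_ge0 // expRM_natl.
apply: (@le_trans _ _ (z0 ^+ T)).
  rewrite lerXn2r ?nnegrE ?expR_ge0 // ler_expR ler_wpM2r ?divr_ge0 // ler_nat.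
  by rewrite /M -subnDA leq_subr.
have -> : z0 ^+ T = (z0 / z) ^+ T * z ^+ T.
  by rewrite -exprMn divfK // gt_eqF.
apply: ler_wpM2r; first by rewrite exprn_ge0 // ltW.
by apply: ler_wiXn2l => //; rewrite ler_pdivrMr ?mul1r.
Qed.

Lemma pool_small A x : (x <= P)%N ->
  E (fun S => (#|pool A S| <= x)%:R) <=
  'C(P, x)%:R * (x%:R / P%:R) ^+ (K * #|A|).
Proof.
move=> xP.
apply: (@le_trans _ _ (\sum_(X : {set 'I_P} | #|X| == x)
    E (fun S => 1 * \prod_(j in A) (S j \subset X)%:R))).
  rewrite -Ex_sum; apply: Ex_le => // S _; case: leqP => [Ux|_]; last first.
    by apply: sumr_ge0 => X _; rewrite mul1r prodr_ge0.
  (* The pool is padded with objects outside it to a set of exactly [x] elements, so that only sets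
     of this size enter the union bound. *)
  have : (x - #|pool A S| <= #|~: pool A S|)%N.
    by rewrite [leqRHS]cardsCs setCK card_ord leq_sub2r.
  case/card_geqP=> s [us ss sU].
  pose X := pool A S :|: [set i in s].
  have Xx : #|X| = x.
    rewrite cardsU cardsE (card_uniqP us) ss.
    have -> : pool A S :&: [set i in s] = set0.
      apply/setP=> i; rewrite !inE; apply/negP=> /andP[iU /sU].
      by rewrite inE iU.
    by rewrite cards0 subn0 subnKC.
  rewrite (bigD1 X) ?Xx //= mul1r big1.
    by rewrite lerDl sumr_ge0 // => Y _; rewrite mul1r prodr_ge0.
  move=> i iA; suff -> : S i \subset X by [].
  by apply: subset_trans (subsetUl _ _); apply: (bigcup_sup i).
apply: (@le_trans _ _ (\sum_(X : {set 'I_P} | #|X| == x) (x%:R / P%:R) ^+ (K * #|A|))).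
  apply: ler_sum => X /eqP Xx.
  rewrite (Ex_prod u1 (g := fun=> 1) (h := fun j t S => (t \subset X)%:R)) //.
  rewrite -[leRHS](Ex_cst 'I_n u1); apply: Ex_le => // S _.
  rewrite mul1r prodr_const exprM lerXn2r ?nnegrE ?exprn_ge0 ?divr_ge0 //.
    by apply: sumr_ge0 => t _; rewrite mulr_ge0 ?u0.
  by rewrite -Xx avg_sub.
rewrite (eq_bigl (mem [set X : {set 'I_P} | #|X| == x])); last first.
  by move=> X; rewrite /= inE.
by rewrite sumr_const card_draws card_ord -[leLHS]mulr_natl.
Qed.

(* Each node added along a connected order meets the pool collected so far, hence
   contributes at most [K - 1] new objects. *)
Lemma connected_overlap A S :
  (forall i, #|S i| = K) -> A != set0 ->
  connected_set (intersection_graph S) A -> (#|A|.-1 <= #|A| * K - #|pool A S|)%N.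
Proof.
clear u0 u1 P_gt0 KP; move=> SK A0 /forallP conn.
suff H m : (m < #|A|)%N -> exists B, [/\ B \subset A, #|B| = m.+1 &
    (m + #|pool B S| <= #|B| * K)%N].
  have [B [BA cB]] := H #|A|.-1 (ltac:(by rewrite prednK // card_gt0)).
  have -> : B = A.
    have A1 : (0 < #|A|)%N by rewrite card_gt0.
    by apply/eqP; rewrite eqEcard BA; move: cB A1 => /=; lia.
  by lia.
elim: m => [_|m IH mA].
  case/set0Pn: A0 => a aA; exists [set a]; rewrite sub1set aA cards1; split=> //.
  by rewrite /pool big_set1 SK mul1n.
have [B [BA cB UB]] := IH (ltnW mA).
have /implyP := conn B; rewrite BA -card_gt0 cB /=.
have BnA : B != A by apply: contraTneq mA => <-; rewrite cB ltnn.
move=> /(_ BnA)/exists_inP[b bB /exists_inP[a]]; rewrite inE => /andP[aB aA].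
case/andP=> _ /set0Pn[x /setIP[xb xa]].
exists (a |: B); rewrite subUset sub1set aA BA cardsU1 aB cB; split=> //.
rewrite /pool big_setU1 //= -/(pool B S) cardsU SK.
have : (0 < #|S a :&: pool B S|)%N.
  by rewrite card_gt0; apply/set0Pn; exists x; rewrite inE xa; apply/bigcupP; exists b.
have := subset_leq_card (subsetIl (S a) (pool B S)); rewrite SK.
by rewrite cB in UB; move: UB; rewrite mulnDl !mulSn; lia.
Qed.

End IntersectionGraph.

(** * Nodes of low degree *)

Definition disjoint_on (n Q : nat) (A : {set 'I_n}) (S : {ffun 'I_n -> {set 'I_Q}}) :=
  [forall i in A, forall j in A, (i != j) ==> (S i :&: S j == set0)].

Definition low_degree (T : finType) (e : rel T) (k : nat) (i : T) : bool :=
  (#|[set j | e i j]| < k)%N.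

Section LowDegree.
Variables (R : realType) (n P K : nat).
Hypotheses (P_gt0 : (0 < P)%N) (KP : (K <= P)%N).
Notation u := (@unif_subset R P K).
Notation E := (@Ex R 'I_n {set 'I_P} u).
Notation y := (K%:R ^+ 2 / P%:R : R).
Implicit Types (A B C : {set 'I_n}) (S : {ffun 'I_n -> {set 'I_P}}).

Let u1 := @unif_sum1 R P K KP.
Let u0 := @unif_ge0 R P K.
Let y0 : 0 <= y := y_ge0 R P K.

Lemma disjoint_onP A S :
  reflect (forall i j, i \in A -> j \in A -> i != j -> S i :&: S j = set0)
    (disjoint_on A S).
Proof.
apply: (iffP forall_inP) => [H i j iA jA ij|H i iA].
  by have /forall_inP/(_ j jA)/implyP/(_ ij)/eqP := H i iA.
by apply/forall_inP=> j jA; apply/implyP=> ij; apply/eqP/H.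
Qed.

Lemma disjoint_on_upd A S i t :
  i \notin A -> disjoint_on A (upd S i t) = disjoint_on A S.
Proof.
move=> iA; have ne j : j \in A -> j != i by move=> jA; apply: contraNneq iA => <-.
by apply/disjoint_onP/disjoint_onP=> H a b aA bA ab;
  have := H a b aA bA ab; rewrite !upd_other ?ne.
Qed.

Lemma disjoint_on_pool A S :
  (forall i, #|S i| = K) -> disjoint_on A S -> #|pool A S| = (#|A| * K)%N.
Proof.
move=> SK; have [m] := ubnP #|A|; elim: m A => // m IH A; rewrite ltnS => Am.
have [->|[a aA]] := set_0Vmem A; first by rewrite /pool big_set0 !cards0.
set B := A :\ a; have cA : #|A| = #|B|.+1 by rewrite /B (cardsD1 a A) aA.
have aB : a \notin B by rewrite !inE eqxx.
move=> /disjoint_onP dA.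
rewrite /pool -(setD1K aA) big_setU1 //= -/B -/(pool B S) cardsU SK.
have -> : S a :&: pool B S = set0.
  apply/eqP; rewrite setIC; apply/set0Pn=> -[x /setIP[/bigcupP[i iB xi] xa]].
  have [ia iA] : i != a /\ i \in A by move: iB; rewrite !inE => /andP[].
  by have /setP/(_ x) := dA i a iA aA ia; rewrite !inE xi xa.
rewrite cards0 subn0 IH //.
- by rewrite setD1K // cA mulSn.
- by rewrite cA in Am.
- apply/disjoint_onP=> i j; rewrite !inE => /andP[_ iA] /andP[_ jA]; exact: dA.
Qed.

Lemma not_disjoint_on_overlap A S :
  (forall i, #|S i| = K) -> ~~ disjoint_on A S -> (0 < #|A| * K - #|pool A S|)%N.
Proof.
clear u0 u1 y0 P_gt0 KP; move=> SK; rewrite subn_gt0 ltnNge; apply: contra => ge.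
apply/disjoint_onP=> a b aA bA ab; apply/eqP/set0Pn=> -[x /setIP[xa xb]].
set B := A :\ a; have cA : #|A| = #|B|.+1 by rewrite /B (cardsD1 a A) aA.
have aB : a \notin B by rewrite !inE eqxx.
have bB : b \in B by rewrite !inE eq_sym ab.
have UA : pool A S = S a :|: pool B S by rewrite /pool -(setD1K aA) big_setU1.
move: ge; rewrite UA cardsU SK cA mulSn.
have : (0 < #|S a :&: pool B S|)%N.
  by rewrite card_gt0; apply/set0Pn; exists x; rewrite inE xa; apply/bigcupP; exists b.
have := subset_leq_card (subsetIl (S a) (pool B S)); rewrite SK.
by have := card_pool B SK; lia.
Qed.

Lemma E_edge_le i j : i != j -> E (fun S => (S i :&: S j != set0)%:R) <= y.
Proof.
move=> ij.
have -> : E (fun S => (S i :&: S j != set0)%:R) =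
    E (fun S => 1 * \prod_(l in [set i]) (S l :&: S j != set0)%:R).
  by apply: eq_Ex => S; rewrite big_set1 mul1r.
rewrite (Ex_prod u1 (g := fun=> 1) (h := fun l t S => (t :&: S j != set0)%:R)) //.
  rewrite -[leRHS](Ex_cst 'I_n u1); apply: Ex_le => // S wS.
  rewrite big_set1 mul1r; apply: le_trans (avg_touch_le R P_gt0 KP _) _.
  by rewrite (weight_neq0 wS) expr2.
by move=> l t S; rewrite inE => /eqP -> l' t'; rewrite upd_other // eq_sym.
Qed.

Lemma E_disjoint_on A : 1 - #|A|%:R ^+ 2 * y <= E (fun S => (disjoint_on A S)%:R).
Proof.
apply: (@le_trans _ _ (1 - \sum_(i in A) \sum_(j in A | i != j)
    E (fun S => (S i :&: S j != set0)%:R))).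
  rewrite lerD2l lerN2 -[#|A|%:R ^+ 2]/(#|A|%:R * #|A|%:R) -mulrA.
  apply: (@le_trans _ _ (\sum_(i in A) #|A|%:R * y)); last first.
    by rewrite sumr_const -[leLHS]mulr_natl.
  apply: ler_sum => i _; apply: (@le_trans _ _ (\sum_(j in A) y)); last first.
    by rewrite sumr_const -[leLHS]mulr_natl.
  rewrite big_mkcondr /=; apply: ler_sum => j _.
  by case: ifP => // ij; apply: E_edge_le.
under eq_bigr do rewrite -Ex_sum.
rewrite -Ex_sum -[X in X - _](Ex_cst 'I_n u1) -ExN -ExD; apply: Ex_le => // S _.
have s0 i : 0 <= \sum_(j in A | i != j) (S i :&: S j != set0)%:R :> R.
  by rewrite sumr_ge0.
have [dA|] := boolP (disjoint_on A S); first by rewrite gerBl sumr_ge0.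
rewrite subr_le0; case/forall_inPn=> i iA /forall_inPn[j jA].
rewrite negb_imply => /andP[ij Sij].
rewrite (bigD1 i) //= (bigD1 j) ?jA //= Sij -addrA lerDl addr_ge0 //.
  by rewrite sumr_ge0.
by rewrite sumr_ge0.
Qed.

Definition outer_nbhd A S i := [set j | (j \notin A) && (S j :&: S i != set0)].

Lemma outer_nbhd_le A S i : i \in A ->
  (#|outer_nbhd A S i| <= #|[set j | intersection_graph S i j]|)%N.
Proof.
move=> iA; apply: subset_leq_card; apply/subsetP=> j; rewrite !inE => /andP[jA Sji].
apply/andP; split; last by rewrite setIC.
by apply: contraNneq jA => <-.
Qed.

Lemma outer_nbhd_disjoint A S i : i \in A -> disjoint_on A S ->
  [set j | intersection_graph S i j] = outer_nbhd A S i.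
Proof.
move=> iA /disjoint_onP dA; apply/setP=> j; rewrite !inE /intersection_graph.
rewrite [S j :&: S i]setIC.
have [jA|jA] /= := boolP (j \in A).
  by have [//|ij] := eqVneq i j; rewrite /= dA // eqxx.
by have [ij|//] := eqVneq i j; rewrite -ij iA in jA.
Qed.

(** The prescription of [J i] as the set of outer neighbours of every [i] in [A], read off at one
    outer node [j] with set [t]. In this form the conditions for distinct [j] are independent given
    the sets in [A]. *)
Definition pattern A (J : {ffun 'I_n -> {set 'I_n}}) j (t : {set 'I_P}) S : R :=
  [forall i in A, (t :&: S i != set0) == (j \in J i)]%:R.

Definition hit A (J : {ffun 'I_n -> {set 'I_n}}) j := [set i in A | j \in J i].

Lemma pattern_upd A J i t S : i \in ~: A ->
  forall j t', pattern A J j t' (upd S i t) = pattern A J j t' S.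
Proof.
rewrite inE => iA j t'; rewrite /pattern; congr (nat_of_bool _)%:R.
apply: eq_forallb => l; have [lA|] //= := boolP (l \in A).
by rewrite upd_other //; apply: contraNneq iA => <-.
Qed.

Lemma disjoint_on_set A S : disjoint_on A S ->
  forall i j, i \in A -> j \in A -> i != j -> [disjoint S i & S j].
Proof. by move=> /disjoint_onP dA i j iA jA ij; rewrite -setI_eq0 dA. Qed.

Lemma pattern_ge0 A J j t S : 0 <= pattern A J j t S.
Proof. exact: ler0n. Qed.

(** If some hits are prescribed, the required misses are dropped and [avg_touch_all] applies; if
    none is, the node avoids a pool of the full size [#|A| K]. *)
Lemma avg_pattern_le A J j S : (forall i, #|S i| = K) -> disjoint_on A S ->
  avg K (fun t => pattern A J j t S) <=
  y ^+ #|hit A J j| * (if hit A J j == set0 then expR (- (#|A|%:R * y)) else 1).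
Proof.
move=> SK dA; case: eqP => [h0|_].
  rewrite h0 cards0 mul1r.
  have -> : #|A|%:R * y = K%:R * #|pool A S|%:R / P%:R.
    by rewrite disjoint_on_pool // natrM; ring.
  apply: le_trans (avg_avoid_le R P_gt0 KP _); apply: avg_le => t _.
  rewrite /pattern ler_nat; case: forall_inP => // H.
  suff -> : t :&: pool A S = set0 by rewrite eqxx.
  apply/eqP/set0Pn=> -[x /setIP[xt /bigcupP[i iA xi]]].
  have /setP/(_ i) := h0; rewrite !inE iA /= => jJ.
  have /eqP := H i iA; rewrite jJ => /negbFE/eqP/setP/(_ x).
  by rewrite !inE xt xi.
rewrite mulr1; apply: le_trans (@avg_touch_all R P K P_gt0 KP _ _ S _ _) => //.
  apply: avg_le => t _; rewrite /pattern ler_nat; case: forall_inP => // H.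
  suff -> : [forall i in hit A J j, t :&: S i != set0] by [].
  by apply/forall_inP=> i; rewrite inE => /andP[iA jJ]; rewrite (eqP (H i iA)).
move=> i i'; rewrite !inE => /andP[iA _] /andP[i'A _].
by move=> ii'; apply: (disjoint_on_set dA).
Qed.

Lemma expR_N_le (x : R) : 0 <= x -> expR (- x) <= 1 - x + x ^+ 2.
Proof.
move=> x0; rewrite expRN -[leLHS]mul1r ler_pdivrMr ?expR_gt0 //.
apply: (@le_trans _ _ ((1 - x + x ^+ 2) * (1 + x))); first by nra.
by rewrite ler_wpM2l ?expR_ge1Dx //; nra.
Qed.

(** For a single prescribed hit [i]: meeting [S i] has probability at least [y - y^2], and each of
    the [#|A| - 1] other sets spoils this with probability at most [y^2]. *)
Lemma avg_pattern_ge A J j S : (forall i, #|S i| = K) -> disjoint_on A S ->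
  (#|hit A J j| <= 1)%N -> (0 < #|A|)%N ->
  (if hit A J j == set0 then 1 - #|A|%:R * y else y - #|A|%:R * y ^+ 2) <=
  avg K (fun t => pattern A J j t S).
Proof.
move=> SK dA hit1 A0; case: eqP => [h0|].
  have -> : #|A|%:R * y = K%:R * #|pool A S|%:R / P%:R.
    by rewrite disjoint_on_pool // natrM; ring.
  apply: (@le_trans _ _ (avg K (fun t => (t :&: pool A S == set0)%:R))).
    by have := avg_touch_le R P_gt0 KP (pool A S); rewrite avg_touchE //; lra.
  apply: avg_le => t _; rewrite ler_nat; case: eqP => // tU.
  suff -> : [forall i in A, (t :&: S i != set0) == (j \in J i)] by [].
  apply/forall_inP=> i iA; have /setP/(_ i) := h0; rewrite !inE iA /= => ->.
  rewrite eqbF_neg; apply/set0Pn=> -[x /setIP[xt xi]].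
  have /setP/(_ x) := tU; rewrite !inE xt /= => /negP; apply.
  by apply/bigcupP; exists i.
move=> /eqP/set0Pn[i ih].
have hE : hit A J j = [set i].
  by apply/eqP; rewrite eq_sym eqEcard sub1set ih cards1.
have [iA jJ] : i \in A /\ j \in J i by move: ih; rewrite inE => /andP[].
apply: (@le_trans _ _ (avg K (fun t => (t :&: S i != set0)%:R) -
    \sum_(l in A :\ i) avg K (fun t => [forall a in [set i; l], t :&: S a != set0]%:R))).
  have H1 : y - y ^+ 2 <= avg K (fun t => (t :&: S i != set0)%:R).
    rewrite avg_touchE //; have := avg_avoid_le R P_gt0 KP (S i).
    have -> : K%:R * #|S i|%:R / P%:R = y by rewrite SK expr2.
    by have := expR_N_le y0; lra.
  have H2 : \sum_(l in A :\ i)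
      avg K (fun t => [forall a in [set i; l], t :&: S a != set0]%:R) <=
      (#|A|.-1)%:R * y ^+ 2.
    have -> : #|A|.-1 = #|A :\ i| by rewrite (cardsD1 i A) iA.
    rewrite mulr_natl -sumr_const; apply: ler_sum => l; rewrite !inE => /andP[li lA].
    apply: le_trans (@avg_touch_all R P K P_gt0 KP _ _ S _ _) _ => //.
      move=> a b; rewrite !inE => aa bb; apply: disjoint_on_set dA _ _ _ _.
        by case/orP: aa => /eqP ->.
      by case/orP: bb => /eqP ->.
    by rewrite cards2 eq_sym li.
  have -> : #|A|%:R * y ^+ 2 = (#|A|.-1)%:R * y ^+ 2 + y ^+ 2.
    by rewrite -[in LHS](prednK A0) -natr1 mulrDl mul1r.
  by lra.
rewrite -avg_sum -avgB; apply: avg_le => t _.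
have s0 : 0 <= \sum_(l in A :\ i) [forall a in [set i; l], t :&: S a != set0]%:R :> R.
  by rewrite sumr_ge0.
have [ti|ti] := boolP (t :&: S i != set0); last first.
  by apply: le_trans (pattern_ge0 A J j t S); rewrite subr_le0.
have [ex|nex] := boolP [exists l in A :\ i, t :&: S l != set0].
  apply: le_trans (pattern_ge0 A J j t S); rewrite subr_le0.
  case/exists_inP: ex => l lA tl; rewrite (bigD1 l) //=.
  have -> : [forall a in [set i; l], t :&: S a != set0].
    by apply/forall_inP=> a; rewrite !inE => /orP[]/eqP->.
  by rewrite lerDl sumr_ge0.
suff -> : pattern A J j t S = 1 by rewrite gerBl.
rewrite /pattern; suff -> : [forall l in A, (t :&: S l != set0) == (j \in J l)] by [].
apply/forall_inP=> l lA; have [->|li] := eqVneq l i; first by rewrite ti jJ.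
have -> : (j \in J l) = false.
  by have /setP/(_ l) := hE; rewrite !inE lA (negPf li).
apply/eqP; apply: contraNF nex => tl; apply/exists_inP; exists l => //.
by rewrite !inE li.
Qed.

Lemma sum_hit A (J : {ffun 'I_n -> {set 'I_n}}) :
  (forall i, i \in A -> J i \subset ~: A) ->
  (\sum_(j in ~: A) #|hit A J j| = \sum_(i in A) #|J i|)%N.
Proof.
move=> JA; transitivity (\sum_(j in ~: A) \sum_(i in A) (j \in J i : nat))%N.
  apply: eq_bigr => j _; rewrite -sum1_card big_mkcond [RHS]big_mkcond /=.
  by apply: eq_bigr => i _; rewrite inE; case: (i \in A); case: (j \in J i).
rewrite exchange_big; apply: eq_bigr => i iA.
rewrite -sum1_card big_mkcond [RHS]big_mkcond /=; apply: eq_bigr => j _.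
have := subsetP (JA i iA) j; case: (j \in J i) => [->//|_].
by case: (j \in ~: A).
Qed.

(** The prescribed neighbourhoods contain at most [#|A| h] nodes altogether; all other outer nodes
    are hit by none of them. *)
Lemma hit_bound A (J : {ffun 'I_n -> {set 'I_n}}) h :
  (forall i, i \in A -> (#|J i| <= h)%N) ->
  (forall i, i \in A -> J i \subset ~: A) ->
  (n - #|A| - #|A| * h <= #|[set j in ~: A | hit A J j == set0]|)%N.
Proof.
clear u0 u1 y0 P_gt0 KP; move=> Jh JA.
have cA : (#|~: A| = n - #|A|)%N by rewrite cardsCs setCK card_ord.
have : (#|[set j in ~: A | hit A J j != set0]| <= #|A| * h)%N.
  apply: (@leq_trans (\sum_(j in ~: A) #|hit A J j|)%N); last first.
    by rewrite sum_hit // -sum_nat_const leq_sum.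
  rewrite -sum1_card big_mkcond [leqRHS]big_mkcond /=; apply: leq_sum => j _.
  by rewrite !inE -card_gt0; case: (j \notin A); case: (#|hit A J j|).
have := cardsID [set j | hit A J j == set0] (~: A).
have -> : ~: A :&: [set j | hit A J j == set0] = [set j in ~: A | hit A J j == set0].
  by apply/setP=> j; rewrite !inE.
have -> : ~: A :\: [set j | hit A J j == set0] = [set j in ~: A | hit A J j != set0].
  by apply/setP=> j; rewrite !inE andbC.
by rewrite cA; lia.
Qed.

(** Union bound over the families [J] of outer neighbourhoods. Each node that is not hit contributes
    [exp (- #|A| y)], and the hits contribute [y] to the total size of the [J i]; the latter splits
    over [i], so the sum over families becomes a power. *)
Lemma E_low_disjoint_le A h :
  E (fun S => (disjoint_on A S)%:R *
    [forall i in A, low_degree (intersection_graph S) h.+1 i]%:R) <=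
  expR (- ((n - #|A| - #|A| * h)%:R * (#|A|%:R * y))) *
  (\sum_(c < h.+1) (n%:R * y) ^+ c / c`!%:R) ^+ #|A|.
Proof.
pose Q (i : 'I_n) (C : {set 'I_n}) := (#|C| <= h)%N && (C \subset ~: A).
apply: (@le_trans _ _ (\sum_(J in pfamily set0 (mem A) Q)
    E (fun S => (disjoint_on A S)%:R * \prod_(j in ~: A) pattern A J j (S j) S))).
  rewrite -Ex_sum; apply: Ex_le => // S _; rewrite -mulr_sumr ler_wpM2l //.
  have s0 J : 0 <= \prod_(j in ~: A) pattern A J j (S j) S.
    by apply: prodr_ge0 => j _; apply: pattern_ge0.
  case: forall_inP => [low|_]; last by rewrite sumr_ge0.
  pose J := [ffun i => if i \in A then outer_nbhd A S i else set0].
  have JQ : J \in pfamily set0 (mem A) Q.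
    apply/pfamilyP; split=> [|i iA].
      by apply/supportP=> i /negPf iA; rewrite ffunE iA.
    change (Q i (J i)); rewrite ffunE (iA : i \in A) /Q -ltnS.
    rewrite (leq_ltn_trans (outer_nbhd_le S iA)) //=.
      by apply/subsetP=> j; rewrite !inE => /andP[].
    exact: low.
  rewrite (bigD1 J) //= big1 ?lerDl ?sumr_ge0 // => j; rewrite inE => jA.
  rewrite /pattern; suff -> : [forall i in A, (S j :&: S i != set0) == (j \in J i)] by [].
  by apply/forall_inP=> i iA; rewrite ffunE iA inE jA.
set c := expR _.
apply: (@le_trans _ _ (\sum_(J in pfamily set0 (mem A) Q) c * \prod_(i in A) y ^+ #|J i|)).
  apply: ler_sum => J /pfamilyP[_ JQ].
  have Jh i : i \in A -> (#|J i| <= h)%N by move=> /JQ/andP[].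
  have JA i : i \in A -> J i \subset ~: A by move=> /JQ/andP[].
  rewrite (Ex_prod u1 (h := pattern A J)); last 2 first.
  - by move=> i t S; rewrite inE => iA; rewrite disjoint_on_upd.
  - by move=> i t S iA j t'; apply: pattern_upd.
  have c0 : 0 <= c * \prod_(i in A) y ^+ #|J i|.
    by rewrite mulr_ge0 ?expR_ge0 // prodr_ge0 // => i _; rewrite exprn_ge0.
  rewrite -[leRHS](Ex_cst 'I_n u1); apply: Ex_le => // S wS.
  have [dA|_] := boolP (disjoint_on A S); last by rewrite mul0r.
  rewrite mul1r; apply: (@le_trans _ _ (\prod_(j in ~: A)
      (y ^+ #|hit A J j| * (if hit A J j == set0 then expR (- (#|A|%:R * y)) else 1)))).
    apply: ler_prod => j _; rewrite avg_pattern_le ?andbT //; last exact: weight_neq0 wS.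
    by apply: sumr_ge0 => t _; rewrite mulr_ge0 ?u0 ?pattern_ge0.
  rewrite big_split /= -expr_sum sum_hit // expr_sum mulrC ler_wpM2r //.
    by rewrite prodr_ge0 // => i _; rewrite exprn_ge0.
  rewrite -big_mkcondr /= -big_set /= prodr_const -expRM_natl ler_expR.
  rewrite mulrN lerN2; apply: ler_wpM2r; first exact: mulr_ge0.
  rewrite ler_nat.
  apply: leq_trans (hit_bound Jh JA) _; apply: subset_leq_card.
  by apply/subsetP=> j; rewrite !inE.
rewrite -mulr_sumr ler_wpM2l ?expR_ge0 //.
rewrite -(big_distr_big_dep set0 (mem A) Q (fun _ C => y ^+ #|C|)) /=.
rewrite -prodr_const; apply: ler_prod => i _; apply/andP; split.
  by rewrite sumr_ge0 // => C _; rewrite exprn_ge0.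
have := @sum_small_sets_le R 'I_n h y y0; rewrite card_ord; apply: le_trans.
rewrite /Q big_mkcondr /=; apply: ler_sum => C _; case: ifP => // _.
by rewrite exprn_ge0.
Qed.

Lemma low_degree_nbhd A S h :
  [forall i in A, low_degree (intersection_graph S) h.+1 i] ->
  (#|nbhd (intersection_graph S) A| <= #|A| * h)%N.
Proof.
move=> /forall_inP low; rewrite -sum_nat_const.
apply: (@leq_trans (\sum_(i in A) #|[set j | intersection_graph S i j]|)%N); last first.
  by apply: leq_sum => i /low.
apply: (@leq_trans #|\bigcup_(i in A) [set j | intersection_graph S i j]|).
  apply: subset_leq_card; apply/subsetP=> j; rewrite inE => /andP[_ /exists_inP[i iA ij]].
  by apply/bigcupP; exists i; rewrite ?inE.
elim/big_ind2: _ => [|X a Y b Xa Yb|i _]; rewrite ?cards0 //.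
by apply: leq_trans (leq_add Xa Yb); apply: leq_card_setU.
Qed.

(** When the sets in [A] are not disjoint, the pool has deficit at least [1] while [A] has at most
    [#|A| h] neighbours, so [overlap_nbhd_tail] applies with [t = 1]. *)
Lemma E_low_le A h (z : R) :
  1 <= z -> expR (n%:R * (K%:R / P%:R)) <= z ->
  E (fun S => [forall i in A, low_degree (intersection_graph S) h.+1 i]%:R) <=
  expR (- ((n - #|A| - #|A| * h)%:R * (#|A|%:R * y))) *
  ((\sum_(c < h.+1) (n%:R * y) ^+ c / c`!%:R) ^+ #|A| +
   (\sum_(c < (#|A| * h).+1) (n%:R * (#|A|%:R * y)) ^+ c / c`!%:R) *
   (expR (n%:R * (K%:R / P%:R)) / z) * expR (z * (#|A|%:R ^+ 2 * y))).
Proof.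
move=> z1 z0; rewrite mulrDr.
apply: le_trans (lerD (E_low_disjoint_le A h) (le_trans
  (@overlap_nbhd_tail R n P K P_gt0 KP A 1 (#|A| * h) z z1 z0) _)).
  rewrite -ExD; apply: Ex_le => // S wS; case: (boolP [forall i in A, _]) => low; last first.
    by rewrite mulr0 add0r mulr_ge0.
  rewrite low_degree_nbhd // !mulr1.
  have [_|/(not_disjoint_on_overlap (weight_neq0 wS)) ->] := boolP (disjoint_on A S).
    by rewrite lerDl.
  by rewrite add0r.
have ny0 : 0 <= #|A|%:R * y by rewrite mulr_ge0.
have := @sum_small_sets_le R 'I_n (#|A| * h) _ ny0; rewrite card_ord => H.
rewrite expr1; apply: le_trans (ler_wpM2r _ H) _.
  by rewrite !mulr_ge0 ?expR_ge0 // invr_ge0 (le_trans ler01).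
set s := \sum_(c < _) _; by rewrite le_eqVlt; apply/orP; left; apply/eqP; ring.
Qed.

End LowDegree.

(** * Lower bound for the probability that given nodes have low degree *)

Section LowDegreeLower.
Variables (R : realType) (n P K h : nat).
Hypotheses (P_gt0 : (0 < P)%N) (KP : (K <= P)%N) (n_gt0 : (0 < n)%N) (hn : (h <= n)%N).
Notation u := (@unif_subset R P K).
Notation v := (@unif_subset R n h).
Notation E := (@Ex R 'I_n {set 'I_P} u).
Notation EJ := (@Ex R 'I_n {set 'I_n} v).
Notation y := (K%:R ^+ 2 / P%:R : R).
Implicit Types (A : {set 'I_n}) (S : {ffun 'I_n -> {set 'I_P}}).

Let u1 := @unif_sum1 R P K KP.
Let u0 := @unif_ge0 R P K.
Let v1 := @unif_sum1 R n h hn.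
Let v0 := @unif_ge0 R n h.
Let y0 : 0 <= y := y_ge0 R P K.

(* Families of prescribed outer neighbourhoods: averaging over a uniformly random
   family counts them and reduces the count to [E_disjoint_on]. *)
Definition good_family A (J : {ffun 'I_n -> {set 'I_n}}) :=
  disjoint_on A J && [forall i in A, J i :&: A == set0].

Lemma EJ_good A : 1 - #|A|%:R ^+ 2 * (h%:R ^+ 2 / n%:R) - #|A|%:R ^+ 2 * (h%:R / n%:R)
  <= EJ (fun J => (good_family A J)%:R).
Proof.
have H1 := @E_disjoint_on R n n h n_gt0 hn A.
have H2 : EJ (fun J => \sum_(i in A) (J i :&: A != set0)%:R) <=
    #|A|%:R ^+ 2 * (h%:R / n%:R).
  rewrite Ex_sum -[_ ^+ 2]/(#|A|%:R * #|A|%:R) -mulrA [leRHS]mulr_natl -sumr_const.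
  apply: ler_sum => i _.
  have -> : EJ (fun J => (J i :&: A != set0)%:R) =
      EJ (fun J => 1 * \prod_(l in [set i]) (J l :&: A != set0)%:R).
    by apply: eq_Ex => J; rewrite big_set1 mul1r.
  rewrite (Ex_prod v1 (g := fun=> 1)
    (h := fun l t (_ : {ffun 'I_n -> {set 'I_n}}) => (t :&: A != set0)%:R)) //.
  rewrite -[leRHS](Ex_cst 'I_n v1); apply: Ex_le => // J _.
  rewrite big_set1 mul1r; apply: le_trans (avg_touch_le R n_gt0 hn _) _.
  by rewrite mulrCA mulrA.
apply: le_trans (lerB H1 H2) _; rewrite -ExN -ExD; apply: Ex_le => // J _.
have s0 : 0 <= \sum_(i in A) (J i :&: A != set0)%:R :> R by rewrite sumr_ge0.
rewrite /good_family; case: (disjoint_on A J); last by rewrite sub0r oppr_le0.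
case: forall_inP => [_|/forall_inP/forall_inPn[i iA Ji]]; first by rewrite gerBl.
by rewrite subr_le0 (bigD1 i) //= Ji lerDl sumr_ge0.
Qed.

Lemma E_pattern_ge A (J : {ffun 'I_n -> {set 'I_n}}) :
  (0 < #|A|)%N -> #|A|%:R * y <= 1 -> weight v J != 0 -> good_family A J ->
  (1 - #|A|%:R * y) ^+ n * (y - #|A|%:R * y ^+ 2) ^+ (#|A| * h) *
  E (fun S => (disjoint_on A S)%:R) <=
  E (fun S => (disjoint_on A S)%:R * \prod_(j in ~: A) pattern R A J j (S j) S).
Proof.
move=> A0 Ay wJ /andP[/disjoint_onP dJ /forall_inP JA].
have {}JA i : i \in A -> J i \subset ~: A.
  by move=> /JA; rewrite setI_eq0 disjoints_subset.
have Jh := weight_neq0 wJ.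
have hit1 j : (#|hit A J j| <= 1)%N.
  rewrite leqNgt; apply/negP=> /card_gt1P[a [b [ah bh ab]]].
  move: ah bh; rewrite !inE => /andP[aA ja] /andP[bA jb].
  by have /setP/(_ j) := dJ a b aA bA ab; rewrite !inE ja jb.
have a1 : 0 <= 1 - #|A|%:R * y by rewrite subr_ge0.
have a2 : 0 <= y - #|A|%:R * y ^+ 2.
  have -> : y - #|A|%:R * y ^+ 2 = y * (1 - #|A|%:R * y) by ring.
  by rewrite mulr_ge0.
rewrite (Ex_prod u1 (h := pattern R A J)); last 2 first.
- by move=> i t S; rewrite inE => iA; rewrite disjoint_on_upd.
- by move=> i t S iA j t'; apply: pattern_upd.
rewrite -ExZ; apply: Ex_le => // S wS.
have [dA|_] := boolP (disjoint_on A S); last by rewrite mulr0 mul0r.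
rewrite mulr1 mul1r; apply: (@le_trans _ _ (\prod_(j in ~: A)
    (if hit A J j == set0 then 1 - #|A|%:R * y else y - #|A|%:R * y ^+ 2))); last first.
  apply: ler_prod => j _; rewrite avg_pattern_ge ?andbT //; last exact: weight_neq0 wS.
  by case: ifP.
rewrite (bigID (fun j => hit A J j == set0)) /=.
rewrite (eq_bigr (fun=> 1 - #|A|%:R * y)); last by move=> j /andP[_ ->].
rewrite [X in _ <= _ * X](eq_bigr (fun=> y - #|A|%:R * y ^+ 2)); last first.
  by move=> j /andP[_ /negPf ->].
rewrite !prodr_const ler_pM ?exprn_ge0 //.
  apply: ler_wiXn2l => //; first by rewrite gerBl; apply: mulr_ge0.
  by rewrite -[X in (_ <= X)%N](card_ord n) max_card.
suff -> : #|[pred i | (i \in ~: A) && (hit A J i != set0)]| = (#|A| * h)%N by [].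
have <- : (\sum_(j in ~: A) #|hit A J j| = #|A| * h)%N.
  by rewrite sum_hit // -sum_nat_const; apply: eq_bigr => i _; apply: Jh.
rewrite -sum1_card big_mkcond [RHS]big_mkcond /=; apply: eq_bigr => j _.
have := hit1 j; rewrite !inE -card_gt0.
by case: (j \notin A) => //=; case: (#|hit A J j|) => [|[|]].
Qed.

(** For a fixed [S], the pattern forces [J i] to be the outer neighbourhood of [i] for all [i] in
    [A]. For a random [J] this has probability ['C(n, h)^-#|A|] if these all have size [h], and [0]
    otherwise, so the factor ['C(n, h) ^+ #|A|] turns it into the indicator of an event of low
    degrees. *)
Lemma E_low_ge A : (0 < #|A|)%N -> #|A|%:R * y <= 1 ->
  'C(n, h)%:R ^+ #|A| *
  ((1 - #|A|%:R * y) ^+ n * (y - #|A|%:R * y ^+ 2) ^+ (#|A| * h) *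
   E (fun S => (disjoint_on A S)%:R)) * EJ (fun J => (good_family A J)%:R) <=
  E (fun S => [forall i in A, low_degree (intersection_graph S) h.+1 i]%:R).
Proof.
move=> A0 Ay; set c := _ * E _.
pose F J := E (fun S => (disjoint_on A S)%:R * \prod_(j in ~: A) pattern R A J j (S j) S).
apply: (@le_trans _ _ ('C(n, h)%:R ^+ #|A| * EJ (fun J => (good_family A J)%:R * F J))).
  rewrite -mulrA ler_wpM2l ?exprn_ge0 // -ExZ; apply: Ex_le => // J wJ.
  rewrite mulrC; have [gJ|_] := boolP (good_family A J); last by rewrite !mul0r.
  by rewrite !mul1r; apply: E_pattern_ge.
(* The two expectations are exchanged, so that the average over [J] can be computed for a fixed
   [S]. *)
have -> : 'C(n, h)%:R ^+ #|A| * EJ (fun J => (good_family A J)%:R * F J) =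
  E (fun S => (disjoint_on A S)%:R * ('C(n, h)%:R ^+ #|A| *
    EJ (fun J => (good_family A J)%:R * \prod_(j in ~: A) pattern R A J j (S j) S))).
  rewrite -ExZ [LHS]/Ex; rewrite [RHS](_ : _ = E (fun S => \sum_J weight v J *
      ('C(n, h)%:R ^+ #|A| * ((good_family A J)%:R * ((disjoint_on A S)%:R *
       \prod_(j in ~: A) pattern R A J j (S j) S))))); last first.
    apply: eq_Ex => S; rewrite -ExZ -ExZ; apply: eq_bigr => J _; congr (_ * _); ring.
  rewrite Ex_sum; apply: eq_bigr => J _; rewrite /F -!ExZ; apply: eq_Ex => S; ring.
apply: Ex_le => // S wS.
have [dA|_] := boolP (disjoint_on A S); last by rewrite mul0r.
rewrite mul1r; apply: (@le_trans _ _ ('C(n, h)%:R ^+ #|A| *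
    EJ (fun J => 1 * \prod_(i in A) (J i == outer_nbhd A S i)%:R))).
  rewrite ler_wpM2l ?exprn_ge0 //; apply: Ex_le => // J _.
  have p0 : 0 <= \prod_(i in A) (J i == outer_nbhd A S i)%:R :> R by rewrite prodr_ge0.
  rewrite mul1r /good_family; case: (disjoint_on A J); last by rewrite mul0r.
  case: forall_inP => [JA|_]; last by rewrite mul0r.
  rewrite mul1r; have [/exists_inP[j jA /negPf pj]|] :=
    boolP [exists j in ~: A, ~~ [forall i in A, (S j :&: S i != set0) == (j \in J i)]].
    by rewrite (bigD1 j) //= /pattern pj mul0r.
  move=> /exists_inPn H; rewrite [leLHS]big1; last first.
    by move=> j /H; rewrite negbK /pattern => ->.
  rewrite big1 // => i iA; suff -> : J i = outer_nbhd A S i by rewrite eqxx.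
  apply/setP=> j; rewrite inE; have [jA|jA] /= := boolP (j \in A).
    by have /setP/(_ j) := eqP (JA i iA); rewrite !inE jA andbT.
  have := H j; rewrite inE => /(_ jA); rewrite negbK => /forall_inP/(_ i iA)/eqP.
  by move=> ->.
rewrite (Ex_prod v1 (g := fun=> 1) (h := fun i t J => (t == outer_nbhd A S i)%:R)) //.
rewrite (Ex_cst _ v1) mul1r -prodr_const -big_split /=.
rewrite (eq_bigr (fun i => (#|outer_nbhd A S i| == h)%:R)); last first.
  move=> i _; rewrite (bigD1 (outer_nbhd A S i)) //= eqxx mulr1 big1 ?addr0.
    rewrite /unif_subset; case: eqP; rewrite ?mulr0 // divff //.
    by rewrite gt_eqF ?bin_gt0R.
  by move=> t /negPf ->; rewrite mulr0.
have [/exists_inP[i iA /negPf Ni]|/exists_inPn H] :=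
  boolP [exists i in A, #|outer_nbhd A S i| != h].
  by rewrite (bigD1 i) //= Ni mul0r.
suff -> : [forall i in A, low_degree (intersection_graph S) h.+1 i].
  by rewrite big1 // => i /H; rewrite negbK => ->.
apply/forall_inP=> i iA; rewrite /low_degree (outer_nbhd_disjoint iA dA).
by have := H i iA; rewrite negbK => /eqP ->.
Qed.

End LowDegreeLower.

(** * Bonferroni inequalities *)

Section Bonferroni.
Variable R : realType.

Lemma sum_sign_bin N M :
  \sum_(m < M.+1) (-1) ^+ m * 'C(N.+1, m)%:R = (-1) ^+ M * 'C(N, M)%:R :> R.
Proof.
elim: M => [|M IH]; first by rewrite big_ord1 !bin0.
by rewrite big_ord_recr IH /= binS natrD exprS; ring.
Qed.

(** For positive [N] the truncated sum is, up to sign, ['C(N.-1, M)], one of the two summands of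
    ['C(N, M.+1)] in Pascal's rule. *)
Lemma bonferroni N M :
  `|(N == 0%N)%:R - \sum_(m < M.+1) (-1) ^+ m * 'C(N, m)%:R| <= 'C(N, M.+1)%:R :> R.
Proof.
case: N => [|N].
  rewrite big_ord_recl /= bin0 big1 ?addr0 ?mul1r ?subrr ?normr0 ?ler0n //.
  by move=> i _; rewrite bin0n mulr0.
rewrite sum_sign_bin sub0r normrN normrM normrX normrN1 expr1n mul1r.
by rewrite ger0_norm ?ler0n // binS natrD lerDr.
Qed.

End Bonferroni.

(** * Moments of the number of low-degree nodes, and their link with connectivity *)

Section Events.
Variables (R : realType) (n P K k : nat).
Hypotheses (P_gt0 : (0 < P)%N) (KP : (K <= P)%N).
Notation u := (@unif_subset R P K).
Notation E := (@Ex R 'I_n {set 'I_P} u).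
Implicit Types (A : {set 'I_n}) (S : {ffun 'I_n -> {set 'I_P}}).

Let u1 := @unif_sum1 R P K KP.
Let u0 := @unif_ge0 R P K.

Definition low_nodes S : {set 'I_n} := [set i | low_degree (intersection_graph S) k i].

(** The factorial moment is divided by [m!]: it is then the expected number of [m]-sets of
    low-degree nodes, and it has limit [l^m / m!] in the Poisson case. *)
Definition factorial_moment m : R := E (fun S => 'C(#|low_nodes S|, m)%:R).

Definition prob_no_low : R := E (fun S => (#|low_nodes S| == 0)%N%:R).

Definition small_cut S A : bool :=
  connected_set (intersection_graph S) A && (#|nbhd (intersection_graph S) A| < k)%N.

Lemma factorial_momentE m : factorial_moment m =
  \sum_(A : {set 'I_n} | #|A| == m)
    E (fun S => [forall i in A, low_degree (intersection_graph S) k i]%:R).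
Proof.
rewrite -Ex_sum; apply: eq_Ex => S; rewrite -cards_draws -sum1_card natr_sum.
rewrite [RHS]big_mkcond [LHS]big_mkcond /=; apply: eq_bigr => A _; rewrite inE andbC.
case: (_ == _) => //=; case: (boolP (A \subset _)) => [/subsetP AS|/subsetPn[i iA]].
  suff -> : [forall i in A, low_degree (intersection_graph S) k i] by [].
  by apply/forall_inP=> i /AS; rewrite inE.
rewrite inE => il; case: forall_inP => // H.
by rewrite (H i iA) in il.
Qed.

Lemma factorial_moment_le m (c : R) :
  (forall A, #|A| = m ->
    E (fun S => [forall i in A, low_degree (intersection_graph S) k i]%:R) <= c) ->
  factorial_moment m <= 'C(n, m)%:R * c.
Proof.
move=> H; rewrite factorial_momentE.
rewrite (eq_bigl (fun A => A \in [set A : {set 'I_n} | #|A| == m])); last first.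
  by move=> A; rewrite inE.
rewrite -[n in 'C(n, m)]card_ord -card_draws mulr_natl -sumr_const.
by apply: ler_sum => A; rewrite inE => /eqP; apply: H.
Qed.

Lemma factorial_moment_ge m (c : R) :
  (forall A, #|A| = m ->
    c <= E (fun S => [forall i in A, low_degree (intersection_graph S) k i]%:R)) ->
  'C(n, m)%:R * c <= factorial_moment m.
Proof.
move=> H; rewrite factorial_momentE.
rewrite (eq_bigl (fun A => A \in [set A : {set 'I_n} | #|A| == m])); last first.
  by move=> A; rewrite inE.
rewrite -[n in 'C(n, m)]card_ord -card_draws mulr_natl -sumr_const.
by apply: ler_sum => A; rewrite inE => /eqP; apply: H.
Qed.

Lemma factorial_moment0 : factorial_moment 0 = 1.
Proof.
by rewrite /factorial_moment (eq_Ex _ (G := fun=> 1)) ?(Ex_cst _ u1) // => S; rewrite bin0.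
Qed.

Lemma prob_no_low_bonferroni M :
  `|prob_no_low - \sum_(m < M.+1) (-1) ^+ m * factorial_moment m| <=
  factorial_moment M.+1.
Proof.
have -> : \sum_(m < M.+1) (-1) ^+ m * factorial_moment m =
    E (fun S => \sum_(m < M.+1) (-1) ^+ m * 'C(#|low_nodes S|, m)%:R).
  by rewrite Ex_sum; apply: eq_bigr => m _; rewrite ExZ.
rewrite /prob_no_low -ExN -ExD ler_norml /factorial_moment -ExN; apply/andP; split;
  apply: Ex_le => // S _;
  by have := bonferroni R #|low_nodes S| M; rewrite ler_norml => /andP[].
Qed.

(* Chebyshev's inequality for the number of nodes of low degree. *)
Lemma prob_no_low_le : 0 < factorial_moment 1 ->
  prob_no_low <= (2 * factorial_moment 2 + factorial_moment 1) /
    factorial_moment 1 ^+ 2 - 1.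
Proof.
clear P_gt0; set s := factorial_moment 1 => s0; have s1 : s != 0 by rewrite gt_eqF.
have -> : (2 * factorial_moment 2 + s) / s ^+ 2 - 1 =
    E (fun S => (2 * 'C(#|low_nodes S|, 2)%:R + 'C(#|low_nodes S|, 1)%:R) / s ^+ 2
      - 2 * ('C(#|low_nodes S|, 1)%:R / s) + 1).
  rewrite (eq_Ex _ (G := fun S => (s ^+ 2)^-1 *
    (2 * 'C(#|low_nodes S|, 2)%:R + 'C(#|low_nodes S|, 1)%:R) +
    - (2 * s^-1) * 'C(#|low_nodes S|, 1)%:R + 1)); last by move=> S; field.
  rewrite ExD (Ex_cst _ u1) ExD !ExZ ExD ExZ.
  rewrite -/(factorial_moment 1) -/(factorial_moment 2) -/s.
  by field.
apply: Ex_le => // S _; set N := #|_|.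
have H : 2 * 'C(N, 2)%:R + 'C(N, 1)%:R = N%:R ^+ 2 :> R.
  rewrite -natrM -natrD -natrX; congr _%:R; rewrite bin1 mul2n bin2.
  case: N => // N; rewrite -pred_Sn even_halfK ?expn2; first by lia.
  by rewrite oddM /=; case: (odd N).
rewrite H bin1.
have -> : N%:R ^+ 2 / s ^+ 2 - 2 * (N%:R / s) + 1 = (N%:R / s - 1) ^+ 2 by field.
by case: eqP => [->|_]; rewrite ?sqr_ge0 // mul0r sub0r sqrrN expr1n.
Qed.

Lemma prob_no_low_ge : 1 - factorial_moment 1 <= prob_no_low.
Proof.
rewrite -[X in X - _](Ex_cst 'I_n u1) /factorial_moment -ExN -ExD.
apply: Ex_le => // S _; rewrite bin1; case: #|low_nodes S| => [|N] /=.
  by rewrite subr0.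
by rewrite subr_le0 ler1n.
Qed.

Lemma Gu_probE :
  Gu_prob R P K (fun e : rel 'I_n => k_connected e k) =
  E (fun S => `[< k_connected (intersection_graph S) k >]%:R).
Proof.
rewrite /Gu_prob big_mkcond /=; apply: eq_bigr => S _.
by case: asbool; rewrite ?mulr1 ?mulr0.
Qed.

Lemma Gu_prob_le : (1 < n)%N ->
  Gu_prob R P K (fun e : rel 'I_n => k_connected e k) <= prob_no_low.
Proof.
clear P_gt0 u1 KP; move=> n1; rewrite Gu_probE; apply: Ex_le => // S _; rewrite ler_nat.
case: asboolP => // kc; suff -> : low_nodes S = set0 by rewrite cards0.
apply/setP=> i; rewrite !inE /low_degree; apply/negbTE; rewrite -leqNgt.
have [j ij] : exists j : 'I_n, i != j.
  have : (0 < #|[set~ i]|)%N by rewrite cardsC1 card_ord; lia.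
  by rewrite card_gt0 => /set0Pn[j]; rewrite !inE => ji; exists j; rewrite eq_sym.
exact: k_connected_degree kc ij.
Qed.

Lemma Gu_prob_ge : (k < n)%N ->
  prob_no_low - \sum_(A : {set 'I_n} | (1 < #|A|)%N && (#|A|.*2 <= n)%N)
    E (fun S => (small_cut S A)%:R) <=
  Gu_prob R P K (fun e : rel 'I_n => k_connected e k).
Proof.
move=> kn; rewrite Gu_probE -Ex_sum -ExN -ExD; apply: Ex_le => // S _.
have s0 : 0 <= \sum_(A : {set 'I_n} | (1 < #|A|)%N && (#|A|.*2 <= n)%N)
  (small_cut S A)%:R :> R by rewrite sumr_ge0.
case: asboolP => [_|nkc].
  by apply: le_trans (_ : (#|low_nodes S| == 0)%N%:R <= 1); [rewrite gerBl|case: eqP].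
rewrite subr_le0; case: eqP => [/cards0_eq l0|//].
have [||||A [A1 A2 cA nA]] := small_connected_set _ _ _ nkc.
- move=> i j; rewrite /intersection_graph eq_sym; congr (_ && (_ != _)).
  exact: setIC.
- by move=> i; rewrite /intersection_graph eqxx.
- by rewrite card_ord.
- by move=> i; have /setP/(_ i) := l0; rewrite !inE /low_degree ltnNge => /negbFE.
rewrite card_ord in A2; rewrite (bigD1 A) /=; last by rewrite A1 A2.
by rewrite /small_cut cA nA lerDl sumr_ge0.
Qed.

Lemma sum_by_card (F : {set 'I_n} -> R) (Q : pred nat) (c : nat -> R) :
  (forall A, Q #|A| -> 'C(n, #|A|)%:R * F A <= c #|A|) ->
  (forall r, 0 <= c r) ->
  \sum_(A : {set 'I_n} | Q #|A|) F A <= \sum_(r < n.+1) c r.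
Proof.
move=> H c0.
have cn (A : {set 'I_n}) : (#|A| < n.+1)%N by rewrite ltnS -[n in (_ <= n)%N]card_ord max_card.
pose f (A : {set 'I_n}) : 'I_n.+1 := inord #|A|.
rewrite (partition_big f xpredT) //=; apply: ler_sum => r _.
apply: (@le_trans _ _ (\sum_(A in [set A : {set 'I_n} | #|A| == r]) c r / 'C(n, r)%:R)).
  rewrite big_mkcond [leRHS]big_mkcond /=; apply: ler_sum => A _; rewrite inE.
  have fA : (f A == r) = (#|A| == r).
    by rewrite -val_eqE /= inordK.
  rewrite fA andbC; case: eqP => //= Ar; case: ifP => QA; last first.
    by rewrite divr_ge0.
  rewrite ler_pdivlMr ?ltr0n ?bin_gt0 -?Ar; last by rewrite -ltnS.
  by rewrite mulrC; apply: H.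
rewrite sumr_const card_draws card_ord -[leLHS]mulr_natr divfK //.
by rewrite pnatr_eq0 -lt0n bin_gt0 -ltnS.
Qed.

End Events.

(** * Small cuts *)

Lemma quarter_le_sub x a K : (x * 4 <= a * K -> 48 <= K -> a <= K * a - x)%N.
Proof. by nia. Qed.

Lemma quarter_sub_double x a K :
  (x * 4 <= a * K -> K * a + 2 * x <= 2 * (K * a - x))%N.
Proof. by rewrite [(K * a)%N]mulnC; lia. Qed.

Lemma third_le_rest n a h : (a.*2 <= n -> 40 * h <= n -> n <= 3 * (n - a - h))%N.
Proof. by lia. Qed.

Section SmallCut.
Variables (R : realType) (n P K h : nat).
Hypotheses (P_gt0 : (0 < P)%N) (KP : (K <= P)%N).
Notation u := (@unif_subset R P K).
Notation E := (@Ex R 'I_n {set 'I_P} u).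
Notation y := (K%:R ^+ 2 / P%:R : R).
Notation L := (n%:R * y).
Notation lam := (n%:R * (K%:R / P%:R) : R).
Implicit Types (A : {set 'I_n}) (S : {ffun 'I_n -> {set 'I_P}}).

Let u1 := @unif_sum1 R P K KP.
Let u0 := @unif_ge0 R P K.
Let y0 : 0 <= y := y_ge0 R P K.

Lemma pow_fact_le (x : R) r : 0 <= x -> x ^+ r / r`!%:R <= expR x.
Proof.
case: r => [|r] x0; first by rewrite expr0 fact0 divr1 -expR0 ler_expR.
by apply: le_trans (expR_ge1Dxn r x0); rewrite lerDr.
Qed.

Lemma expR1_le4 : expR 1 <= 4 :> R.
Proof.
have -> : 1 = - (-1/2) + - (-1/2) :> R by field.
have h2 : expR (- (-1/2)) <= 2 :> R.
  rewrite expRN -[2]invrK lef_pV2 ?posrE ?invr_gt0 ?expR_gt0 //.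
  by apply: le_trans (expR_ge1Dx _); lra.
have := expR_ge0 (- (-1/2) : R); rewrite expRD; nra.
Qed.

Lemma sum_small_sets_pow_le A : (0 < #|A|)%N -> 1 <= L ->
  \sum_(C : {set 'I_n} | (#|C| <= h)%N) (#|A|%:R * y) ^+ #|C| <=
  h.+1%:R * (#|A|%:R * L) ^+ h.
Proof.
move=> A0 L1; have ry0 : 0 <= #|A|%:R * y by rewrite mulr_ge0.
have := @sum_small_sets_le R 'I_n h _ ry0; rewrite card_ord => /le_trans.
have -> : n%:R * (#|A|%:R * y) = #|A|%:R * L by ring.
by apply; apply: sum_pow_le; have : 1 <= #|A|%:R :> R by [rewrite ler1n]; nra.
Qed.

(** The deficit [r - 1] forced by connectedness cancels the choice of [A] up to one factor [n],
    which is at most [exp (11 L / 10)]. The other nodes contribute about [exp (- r L)], which wins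
    because [r >= 2]; all remaining factors are small powers of [exp (r L)]. *)
Lemma small_cut_sparse A :
  (1 < #|A|)%N -> (40 * h <= n)%N -> 100 <= L ->
  L * expR lam <= expR (L / 100) ->
  (forall x, L <= x -> h.+1%:R * x ^+ h <= expR (x / 100)) ->
  n%:R <= expR (L * (11 / 10)) ->
  #|A|%:R * (L * expR lam) <= n%:R ->
  'C(n, #|A|)%:R * E (fun S => (small_cut h.+1 S A)%:R) <=
  expR (- (L / 40)) * (1 / 2) ^+ #|A|.
Proof.
move=> A1 hn; have [l lE] : exists l, l = L by exists L.
rewrite -lE => L100 Lexp polyexp nexp Asmall.
set r : R := #|A|%:R in Asmall *.
have A0 : (0 < #|A|)%N by apply: ltnW.
have r2 : 2 <= r by rewrite ler_nat.
have r0 : 0 < r by lra.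
have L0 : 0 < l by lra.
have n0 : 0 < n%:R :> R.
  rewrite lt0r ler0n andbT; apply: contraTneq L100 => H.
  by rewrite lE H mul0r -ltNge; lra.
have [rge0 lge0] : 0 <= r /\ 0 <= l by split; apply: ltW.
have Pi0 : 0 <= P%:R^-1 :> R by rewrite invr_ge0.
have e1 : 1 <= expR lam.
  by apply: le_trans (expR_ge1Dx _); rewrite lerDl mulr_ge0 ?divr_ge0.
have rLn : r * l <= n%:R.
  by apply: le_trans Asmall; rewrite ler_pM2l //; nra.
pose z := n%:R / (r * l).
have rL0 : 0 < r * l by rewrite mulr_gt0.
have lamz : expR lam <= z.
  by rewrite ler_pdivlMr // mulrC -mulrA.
have z1 : 1 <= z by apply: le_trans lamz.
have zgt0 : 0 < z by lra.
have := @overlap_nbhd_tail R n P K P_gt0 KP A #|A|.-1 h z z1 lamz.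
set M := (n - #|A| - h)%N.
have MR : n%:R - r - h%:R <= M%:R :> R.
  by rewrite lerBlDr lerBlDr -!natrD ler_nat -addnA addnC -leq_subLR [(h + _)%N]addnC subnDA.
have -> : z * (#|A|%:R ^+ 2 * y) = r.
  have -> : z * (#|A|%:R ^+ 2 * y) = r * ((n%:R * y) / l).
    by rewrite /z -/r; field; rewrite !gt_eqF ?ltr0n.
  by rewrite -lE divff ?mulr1 // gt_eqF.
move=> tail.
have {tail} tail : E (fun S => (small_cut h.+1 S A)%:R) <=
    h.+1%:R * (r * l) ^+ h * (expR (- (M%:R * (r * y))) *
      (expR lam / z) ^+ #|A|.-1 * expR r).
  apply: le_trans (le_trans tail _); last first.
    apply: ler_wpM2r; last by rewrite lE; apply: sum_small_sets_pow_le => //; rewrite -lE; lra.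
    by rewrite !mulr_ge0 ?expR_ge0 // exprn_ge0 // divr_ge0 ?expR_ge0 // ltW.
  apply: Ex_le => // S wS; rewrite /small_cut -mulnb natrM.
  apply: ler_pM => //; rewrite ler_nat; case: (boolP (connected_set _ _)) => // cA.
  by rewrite (connected_overlap (weight_neq0 wS)) // -card_gt0.
apply: le_trans (ler_wpM2l (ler0n _ _) tail) _.
have -> : expR lam / z = (l * expR lam) * (r / n%:R).
  by rewrite /z; field; rewrite !gt_eqF.
have binr : 'C(n, #|A|)%:R * (r / n%:R) ^+ #|A|.-1 <= n%:R * expR r.
  apply: (@le_trans _ _ (n%:R ^+ #|A| / #|A|`!%:R * (r / n%:R) ^+ #|A|.-1)).
    by rewrite ler_wpM2r ?binR_le // exprn_ge0 // divr_ge0.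
  have -> : n%:R ^+ #|A| / #|A|`!%:R * (r / n%:R) ^+ #|A|.-1 =
      n%:R / r * (r ^+ #|A| / #|A|`!%:R).
    rewrite -(prednK A0) /= expr_div_n !exprS.
    by field; rewrite pnatr_eq0 -lt0n fact_gt0 !gt_eqF ?exprn_gt0.
  apply: ler_pM; rewrite ?divr_ge0 ?exprn_ge0 //; last exact: pow_fact_le.
  by rewrite ler_pdivrMr // ler_peMr //; lra.
set q := l * expR lam in Lexp Asmall *.
have q0 : 0 <= q by rewrite mulr_ge0 ?expR_ge0.
have q1 : 1 <= q by rewrite /q; nra.
have -> : 'C(n, #|A|)%:R * (h.+1%:R * (r * l) ^+ h * (expR (- (M%:R * (r * y))) *
    (q * (r / n%:R)) ^+ #|A|.-1 * expR r)) =
  ('C(n, #|A|)%:R * (r / n%:R) ^+ #|A|.-1) * (h.+1%:R * (r * l) ^+ h) *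
    (q ^+ #|A|.-1 * expR (- (M%:R * (r * y))) * expR r).
  rewrite [(q * _) ^+ _]exprMn; move: ((r / _) ^+ _) (q ^+ _) ((r * l) ^+ h).
  by move=> a1 a2 a3; ring.
have rLexp := polyexp (r * l) (ltac:(nra)).
have qexp : q ^+ #|A|.-1 <= expR (r * l / 100).
  apply: (@le_trans _ _ (q ^+ #|A|)); first by rewrite ler_weXn2l // leq_pred.
  have -> : r * l / 100 = #|A|%:R * (l / 100) by rewrite -/r mulrA.
  by rewrite expRM_natl lerXn2r ?nnegrE ?expR_ge0.
(* The constant [19 / 20] is safe: [r <= n / 100] since [r l <= n] and [l >= 100], and
   [h <= n / 40]. *)
have Mexp : expR (- (M%:R * (r * y))) <= expR (- (19 / 20 * (r * l))).
  rewrite ler_expR lerN2.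
  have -> : 19 / 20 * (r * l) = (19 / 20 * n%:R) * (r * y) by rewrite lE; ring.
  rewrite ler_wpM2r ?mulr_ge0 //; apply: le_trans MR.
  have : 40 * h%:R <= n%:R :> R by rewrite -natrM ler_nat.
  have : r * 100 <= n%:R by apply: le_trans rLn; rewrite ler_pM2l.
  by lra.
apply: (@le_trans _ _ ((expR (l * (11 / 10)) * expR r) * expR (r * l / 100) *
    (expR (r * l / 100) * expR (- (19 / 20 * (r * l))) * expR r))).
  have rl0 : 0 <= (r * l) ^+ h by rewrite exprn_ge0 // mulr_ge0.
  have rn0 : 0 <= (r / n%:R) ^+ #|A|.-1 by rewrite exprn_ge0 // divr_ge0.
  have qA0 : 0 <= q ^+ #|A|.-1 by rewrite exprn_ge0.
  apply: ler_pM; rewrite ?mulr_ge0 ?expR_ge0 //.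
    apply: ler_pM; rewrite ?mulr_ge0 //.
    by apply: le_trans binr _; rewrite ler_wpM2r ?expR_ge0.
  apply: ler_pM; rewrite ?mulr_ge0 ?expR_ge0 //.
  by apply: ler_pM; rewrite ?expR_ge0.
have -> : (1 / 2) ^+ #|A| = expR (- (r * ln 2)) :> R.
  by rewrite -mulrN expRM_natl expRN lnK ?posrE // mul1r.
(* The exponent is [11 l / 10 + 2 r + r l / 50 - 19 r l / 20]; with [r >= 2] and [l >= 100] it
   leaves room for [- l / 40 - r ln 2]. *)
rewrite -!expRD ler_expR.
have ln2 : ln 2 <= 1 :> R by apply: le_trans (le_ln1Dx _) _; lra.
by nra.
Qed.

Lemma small_cut_dense A (eta : R) :
  (0 < #|A|)%N -> (#|A|.*2 <= n)%N -> (40 * h <= n)%N -> 100 <= L -> L <= n%:R ->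
  0 < eta <= 1 ->
  L * expR lam <= expR (L / 100) ->
  (forall x, L <= x -> h.+1%:R * x ^+ h <= expR (x / 100)) ->
  h.+1%:R * (n%:R * n%:R) ^+ h <= expR n%:R :> R ->
  expR (- (L / 40)) <= eta -> expR (- n%:R) <= eta -> (48 <= K)%N ->
  expR 1 * (lam * expR (- (K%:R / 2))) <= eta / 2 ->
  n%:R <= #|A|%:R * (L * expR lam) ->
  'C(n, #|A|)%:R * E (fun S => (small_cut h.+1 S A)%:R) <=
  2 * eta * (1 / 2) ^+ #|A|.
Proof.
move=> A0 A2 hn; have [l lE] : exists l, l = L by exists L.
rewrite -lE => L100 Ln /andP[eta0 eta1] Lexp polyexp polyn Leta neta K48 lameta Abig.
set r : R := #|A|%:R in Abig *.
have r1 : 1 <= r by rewrite ler1n.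
have r0 : 0 < r by lra.
have L0 : 0 < l by lra.
have n0 : 0 < n%:R :> R by lra.
have P0 : 0 < P%:R :> R by rewrite ltr0n.
have [rge0 lge0 nge0 ege0] : [/\ 0 <= r, 0 <= l, 0 <= n%:R :> R & 0 <= eta] by split; apply: ltW.
have Pi0 : 0 <= P%:R^-1 :> R by rewrite invr_ge0.
have q0 : 0 <= K%:R / P%:R :> R by rewrite divr_ge0.
have lam0 : 0 <= lam by rewrite mulr_ge0.
have rn : r <= n%:R.
  by rewrite ler_nat (leq_trans _ A2) // -addnn leq_addr.
have half0 : 0 <= (1 / 2 : R) ^+ #|A| by rewrite exprn_ge0 ?divr_ge0.
have ln2 : ln 2 <= 1 :> R by apply: le_trans (le_ln1Dx _) _; lra.
have halfE : (1 / 2) ^+ #|A| = expR (- (r * ln 2)) :> R.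
  by rewrite -mulrN expRM_natl expRN lnK ?posrE // mul1r.
pose m := minn (#|A| * K) P; pose x := (m %/ 4)%N.
have mA : (m <= #|A| * K)%N by apply: geq_minl.
have mP : (m <= P)%N by apply: geq_minr.
have x4 : (x * 4 <= m)%N by apply: leq_trunc_div.
have x4' : (m <= x.+1 * 4)%N by rewrite ltnW // ltn_ceil.
have split_pool : E (fun S => (small_cut h.+1 S A)%:R) <=
    E (fun S => (#|pool A S| <= x)%:R) +
    E (fun S => (x < #|pool A S|)%:R * (#|nbhd (intersection_graph S) A| <= h)%:R).
  rewrite -ExD; apply: Ex_le => // S _; rewrite /small_cut ltnS.
  case: leqP => _; first by rewrite mul0r addr0; case: (_ && _).
  by rewrite add0r mul1r ler_nat; case: (connected_set _ _).
apply: le_trans (ler_wpM2l (ler0n _ _) split_pool) _.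
have -> : 2 * eta * (1 / 2) ^+ #|A| = eta * (1 / 2) ^+ #|A| + eta * (1 / 2) ^+ #|A| by ring.
rewrite mulrDr; apply: lerD.
  apply: le_trans (ler_wpM2l (ler0n _ _) (@pool_small R n P K P_gt0 KP A x _)) _.
    by apply: leq_trans mP; apply: leq_div.
  have KA0 : (0 < K * #|A|)%N by rewrite muln_gt0 A0 andbT (leq_trans _ K48).
  have [x0|x0] := posnP x.
    by rewrite x0 mul0r expr0n gtn_eqF // !mulr0 mulr_ge0.
  have xP : 0 <= x%:R / P%:R :> R by rewrite divr_ge0.
  (* The exponent [K * #|A|] is split as [x + d]: the power [x] pays for the choice of the superset
     of the pool, at a cost [exp x], and the power [d] has to beat this and the choice of [A]. *)
  pose d := (K * #|A| - x)%N.
  have KAE : (K * #|A| = x + d)%N by rewrite /d subnKC // mulnC (leq_trans _ mA) // leq_div.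
  have Cx : 'C(P, x)%:R * (x%:R / P%:R) ^+ x <= expR x%:R :> R.
    apply: le_trans (pow_fact_le x (ler0n R x)).
    have -> : x%:R ^+ x / x`!%:R = P%:R ^+ x / x`!%:R * (x%:R / P%:R) ^+ x :> R.
      rewrite expr_div_n; field.
      by rewrite !gt_eqF ?exprn_gt0 // ltr0n fact_gt0.
    by rewrite ler_wpM2r ?exprn_ge0 // binR_le.
  pose b : R := m%:R / P%:R.
  have b0 : 0 <= b by rewrite divr_ge0.
  have b1 : b <= 1 by rewrite ler_pdivrMr // mul1r ler_nat.
  have xb : x%:R / P%:R <= b / 4.
    rewrite /b mulrAC ler_pM2r ?invr_gt0 // ler_pdivlMr //.
    by rewrite -natrM ler_nat.
  have xA := leq_trans x4 mA.
  have dA : (#|A| <= d)%N by apply: quarter_le_sub.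
  (* As [b <= 1], only [#|A|] of the [d] factors [b] are kept, to pay for the choice of [A]. The
     threshold is a quarter because [1 / 4 <= exp (- 1)]. *)
  have Cd : (x%:R / P%:R) ^+ d <= (r * (K%:R / P%:R)) ^+ #|A| * expR (- d%:R) :> R.
    apply: (@le_trans _ _ ((b / 4) ^+ d)); first by rewrite lerXn2r ?nnegrE ?divr_ge0.
    rewrite exprMn; apply: ler_pM; rewrite ?exprn_ge0 ?invr_ge0 //.
      apply: (@le_trans _ _ (b ^+ #|A|)); first by rewrite ler_wiXn2l.
      rewrite lerXn2r ?nnegrE ?mulr_ge0 //.
      by rewrite /b mulrA ler_pM2r ?invr_gt0 // -natrM ler_nat.
    have -> : - d%:R = d%:R * (-1) :> R by rewrite mulrN1.
    rewrite expRM_natl lerXn2r ?nnegrE ?expR_ge0 ?invr_ge0 // expRN.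
    by rewrite lef_pV2 ?posrE ?expR_gt0 // expR1_le4.
  have Cn : 'C(n, #|A|)%:R * (r * (K%:R / P%:R)) ^+ #|A| <= (expR 1 * lam) ^+ #|A|.
    apply: (@le_trans _ _ (n%:R ^+ #|A| / #|A|`!%:R * (r * (K%:R / P%:R)) ^+ #|A|)).
      by rewrite ler_wpM2r ?binR_le // exprn_ge0 // mulr_ge0.
    have -> : n%:R ^+ #|A| / #|A|`!%:R * (r * (K%:R / P%:R)) ^+ #|A| =
        (r ^+ #|A| / #|A|`!%:R) * lam ^+ #|A| by rewrite !exprMn; ring.
    rewrite [leRHS]exprMn ler_wpM2r ?exprn_ge0 //.
    by rewrite -expRM_natl mulr1 pow_fact_le.
  have ed : expR x%:R * expR (- d%:R) <= expR (- (K%:R / 2)) ^+ #|A| :> R.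
    rewrite -expRD -expRM_natl ler_expR -/r.
    have : (K * #|A| + 2 * x <= 2 * d)%N by apply: quarter_sub_double.
    by rewrite -(ler_nat R) !natrD !natrM -/r => H2; lra.
  rewrite KAE exprD.
  have -> : 'C(n, #|A|)%:R * ('C(P, x)%:R * ((x%:R / P%:R) ^+ x * (x%:R / P%:R) ^+ d)) =
      'C(n, #|A|)%:R * ('C(P, x)%:R * (x%:R / P%:R) ^+ x * (x%:R / P%:R) ^+ d) :> R.
    by congr (_ * _); rewrite mulrA.
  apply: (@le_trans _ _ ('C(n, #|A|)%:R * (expR x%:R *
      ((r * (K%:R / P%:R)) ^+ #|A| * expR (- d%:R))))).
    by rewrite ler_wpM2l // ler_pM // ?mulr_ge0 ?exprn_ge0.
  have -> : 'C(n, #|A|)%:R * (expR x%:R * ((r * (K%:R / P%:R)) ^+ #|A| * expR (- d%:R))) =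
      'C(n, #|A|)%:R * (r * (K%:R / P%:R)) ^+ #|A| * (expR x%:R * expR (- d%:R)) by ring.
  apply: (@le_trans _ _ ((expR 1 * lam) ^+ #|A| * expR (- (K%:R / 2)) ^+ #|A|)).
    by rewrite ler_pM ?mulr_ge0 ?expR_ge0 // exprn_ge0 // mulr_ge0.
  rewrite -exprMn -mulrA.
  apply: (@le_trans _ _ ((eta / 2) ^+ #|A|)).
    rewrite lerXn2r ?nnegrE //; last by rewrite divr_ge0.
    by rewrite mulr_ge0 ?expR_ge0 // mulr_ge0 ?expR_ge0.
  rewrite -[eta / 2]/(eta * 2^-1) exprMn mul1r ler_wpM2r ?exprn_ge0 ?invr_ge0 //.
  by rewrite -[leRHS]expr1 ler_wiXn2l.
have := @nbhd_tail R n P K P_gt0 KP A h (fun S => (x < #|pool A S|)%:R) _ _.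
set M := (n - #|A| - h)%N => tail.
have MR : n%:R / 3 <= M%:R :> R.
  have : (n <= 3 * M)%N by apply: third_le_rest.
  by rewrite -(ler_nat R) natrM; lra.
have {tail} tail : E (fun S => (x < #|pool A S|)%:R *
      (#|nbhd (intersection_graph S) A| <= h)%:R) <=
    h.+1%:R * (r * l) ^+ h * expR (- (n%:R / 3 * (K%:R * (m%:R / 4) / P%:R))).
  apply: le_trans (tail _ _) _ => //.
    by move=> i t S iA; rewrite pool_upd.
  apply: ler_pM.
  - by apply: sumr_ge0 => C _; rewrite exprn_ge0 // mulr_ge0.
  - by apply: Ex_ge0 => // S; rewrite mulr_ge0 ?expR_ge0.
  - by rewrite lE; apply: sum_small_sets_pow_le => //; rewrite -lE; lra.
  rewrite -[leRHS](Ex_cst 'I_n u1); apply: Ex_le => // S _.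
  case: leqP => xp; first by rewrite mul0r expR_ge0.
  rewrite mul1r ler_expR lerN2; apply: ler_pM => //.
  - by rewrite divr_ge0.
  - by rewrite !mulr_ge0 ?invr_ge0.
  rewrite ler_pM2r ?invr_gt0 // ler_wpM2l // ler_pdivrMr // -natrM ler_nat.
  by apply: leq_trans x4' _; rewrite leq_mul2r.
apply: le_trans (ler_wpM2l (ler0n _ _) tail) _.
(* While [r K <= P], the exponent gained is [r l / 12], and [n <= r l exp lam] bounds the choices of
   [A] by [exp (r + r l / 100)]. Beyond, the gain [n K / 12 >= 4 n] beats the crude bound
   [exp (2 n)] for everything else. *)
have [AP|PA] := leqP (#|A| * K) P.
  have mE : m = (#|A| * K)%N by apply/minn_idPl.
  have -> : n%:R / 3 * (K%:R * (m%:R / 4) / P%:R) = r * l / 12.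
    by rewrite mE natrM -/r lE; field; rewrite gt_eqF.
  have Cn : 'C(n, #|A|)%:R <= expR r * expR (r * l / 100).
    apply: le_trans (binR_le R n #|A|) _.
    apply: (@le_trans _ _ ((r * (l * expR lam)) ^+ #|A| / #|A|`!%:R)).
      by rewrite ler_wpM2r ?invr_ge0 // lerXn2r ?nnegrE ?(le_trans nge0 Abig).
    rewrite exprMn mulrAC; apply: ler_pM; rewrite ?divr_ge0 ?exprn_ge0 //.
    - by rewrite mulr_ge0 ?expR_ge0.
    - by rewrite pow_fact_le.
    have -> : r * l / 100 = #|A|%:R * (l / 100) by rewrite -/r mulrA.
    rewrite expRM_natl lerXn2r ?nnegrE ?expR_ge0 //.
    by rewrite mulr_ge0 ?expR_ge0.
  have rLexp := polyexp (r * l) (ltac:(nra)).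
  apply: (@le_trans _ _ (expR r * expR (r * l / 100) *
      (expR (r * l / 100) * expR (- (r * l / 12))))).
    have rl0 : 0 <= (r * l) ^+ h by rewrite exprn_ge0 // mulr_ge0.
    apply: ler_pM => //; first by rewrite !mulr_ge0 ?expR_ge0.
    by rewrite ler_wpM2r ?expR_ge0.
  apply: (@le_trans _ _ (expR (- (l / 40)) * (1 / 2) ^+ #|A|)); last first.
    by rewrite ler_wpM2r.
  rewrite halfE -!expRD ler_expR.
  by nra.
have mE : m = P by apply/minn_idPr; apply: ltnW.
have -> : n%:R / 3 * (K%:R * (m%:R / 4) / P%:R) = n%:R * K%:R / 12 :> R.
  by rewrite mE; field; rewrite gt_eqF.
have Cn : 'C(n, #|A|)%:R <= expR n%:R :> R.
  by apply: le_trans (binR_le R n #|A|) _; apply: pow_fact_le.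
have Cr : h.+1%:R * (r * l) ^+ h <= expR n%:R.
  apply: le_trans polyn; rewrite ler_wpM2l // lerXn2r ?nnegrE ?mulr_ge0 //.
  exact: ler_pM.
apply: (@le_trans _ _ (expR n%:R * (expR n%:R * expR (- (n%:R * K%:R / 12))))).
  apply: ler_pM => //.
    by rewrite !mulr_ge0 ?expR_ge0 ?exprn_ge0 // mulr_ge0.
  by rewrite ler_wpM2r ?expR_ge0.
apply: (@le_trans _ _ (expR (- n%:R) * (1 / 2) ^+ #|A|)); last by rewrite ler_wpM2r.
rewrite halfE -!expRD ler_expR.
have : 48 <= K%:R :> R by rewrite ler_nat.
by nra.
Qed.

End SmallCut.

(** * Asymptotics *)

From mathcomp Require Import all_classical all_reals all_analysis.

Import numFieldNormedType.Exports.
Local Open Scope classical_set_scope.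

(** * Elementary inequalities and limits *)

Section Calculus.
Variable R : realType.

(** The term of degree [d + 1] of the exponential series suffices: its spare factor [x] absorbs the
    constants once [x] exceeds the witness. *)
Lemma pow_le_exp (d : nat) (C c : R) : 0 < c ->
  exists X, forall x, X <= x -> C * x ^+ d <= expR (c * x).
Proof.
move=> c0; exists (Num.max 1 (C * d.+1`!%:R / c ^+ d.+1)) => x.
rewrite ge_max => /andP[x1 xC]; have x0 : 0 <= x by lra.
apply: le_trans (pow_fact_le d.+1 (mulr_ge0 (ltW c0) x0)).
rewrite ler_pdivlMr ?ltr0n ?fact_gt0 // exprMn.
have -> : C * x ^+ d * d.+1`!%:R = (C * d.+1`!%:R) * x ^+ d by ring.
have -> : c ^+ d.+1 * x ^+ d.+1 = (x * c ^+ d.+1) * x ^+ d by rewrite [x ^+ _]exprS; ring.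
by rewrite ler_wpM2r ?exprn_ge0 // -ler_pdivrMr ?exprn_gt0.
Qed.

Lemma cvgM1 (u v : nat -> R) : u @ \oo --> (1 : R) -> v @ \oo --> (1 : R) ->
  (fun n => u n * v n) @ \oo --> (1 : R).
Proof. by move=> u1 v1; rewrite -[X in _ --> X]mulr1; apply: cvgM. Qed.

Lemma cvgX1 (u : nat -> R) j : u @ \oo --> (1 : R) -> (fun n => u n ^+ j) @ \oo --> (1 : R).
Proof.
move=> u1; elim: j => [|j IH]; first exact: cvg_cst.
have -> : (fun n => u n ^+ j.+1) = (fun n => u n * u n ^+ j).
  by apply/funext => n; rewrite exprS.
exact: cvgM1.
Qed.

Lemma cvg_addcM (u : nat -> R) (c : R) : u @ \oo --> (0 : R) ->
  (fun n => 1 + c * u n) @ \oo --> (1 : R).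
Proof.
move=> u0; rewrite -[X in _ --> X]addr0; apply: cvgD; first exact: cvg_cst.
by rewrite -(mulr0 c); apply: cvgMr.
Qed.

Lemma cvg_expcM (u : nat -> R) (c : R) : u @ \oo --> (0 : R) ->
  (fun n => expR (c * u n)) @ \oo --> (1 : R).
Proof.
move=> u0; rewrite -[X in _ --> X]expR0.
apply: (@continuous_cvg _ _ _ _ _ (fun n => c * u n) expR 0).
  exact: continuous_expR.
by rewrite -(mulr0 c); apply: cvgMr.
Qed.

Lemma cvg0_nneg (u : nat -> R) : (forall n, 0 <= u n) ->
  (forall e, 0 < e -> \forall n \near \oo, u n <= e) -> u @ \oo --> (0 : R).
Proof.
move=> u0 ue; apply/cvgr0Pnorm_le => e e0.
by near=> n; rewrite ger0_norm //; near: n; apply: ue.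
Unshelve. all: by end_near. Qed.

Lemma inv_expR_le (x : R) : 0 < x -> expR (- x) <= x^-1.
Proof.
move=> x0; rewrite expRN lef_pV2 ?posrE ?expR_gt0 //.
by apply: le_trans (expR_ge1Dx _); rewrite lerDr.
Qed.

(** For [x <= 1 / 2] one has [1 / (1 - x) <= 1 + x + 2 x^2 <= exp (x + 2 x^2)]. *)
Lemma one_sub_exp (x : R) (n : nat) : 0 <= x -> x <= 1 / 2 ->
  expR (- (n%:R * x) - 2 * (n%:R * x ^+ 2)) <= (1 - x) ^+ n.
Proof.
move=> x0 x2; have -> : - (n%:R * x) - 2 * (n%:R * x ^+ 2) = n%:R * (- (x + 2 * x ^+ 2)) by ring.
have x1 : 0 < 1 - x by lra.
have x1' : 0 <= 1 - x := ltW x1.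
rewrite expRM_natl lerXn2r ?nnegrE ?expR_ge0 //.
rewrite expRN invf_ple ?posrE ?expR_gt0 //.
apply: le_trans (expR_ge1Dx _); rewrite -[leLHS]mul1r ler_pdivrMr; last by lra.
by nra.
Qed.

Lemma ffact_ge n m : ((n - m) ^ m <= n ^_ m)%N.
Proof.
have H j : (j <= m)%N -> ((n - m) ^ j <= n ^_ j)%N.
  elim: j => // j IH jm; have jm' := ltnW jm.
  by rewrite expnSr ffactnSr leq_mul ?IH ?leq_sub2l.
exact: H.
Qed.

Lemma binR_ge n m : (0 < n)%N -> (m <= n)%N ->
  (1 - m%:R / n%:R) ^+ m * (n%:R ^+ m / m`!%:R) <= 'C(n, m)%:R :> R.
Proof.
move=> n0 mn; rewrite mulrA ler_pdivrMr ?ltr0n ?fact_gt0 //.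
rewrite -natrM bin_ffact -exprMn mulrBl mul1r divfK ?pnatr_eq0 -?lt0n //.
by rewrite -natrB // -natrX ler_nat ffact_ge.
Qed.

(** The top term dominates for large [x]: among degrees at most [h], only degree [h] contributes to
    the limit. *)
Lemma sum_pow_top h (x : R) : 1 <= x ->
  \sum_(c < h.+1) x ^+ c / c`!%:R <= x ^+ h / h`!%:R * (1 + h%:R * h`!%:R / x).
Proof.
move=> x1; have x0 : 0 < x by lra.
rewrite big_ord_recr /= mulrDr mulr1 addrC lerD2l.
have -> : x ^+ h / h`!%:R * (h%:R * h`!%:R / x) = h%:R * (x ^+ h / x).
  by field; rewrite gt_eqF //= pnatr_eq0 -lt0n fact_gt0.
case: h => [|h]; first by rewrite big_ord0 mul0r.
rewrite exprSr mulfK ?gt_eqF //; have := @sum_pow_le R h x x1.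
exact.
Qed.

End Calculus.

Lemma cvg_sum_ord (R : realType) (u : nat -> nat -> R) (l : nat -> R) M :
  (forall m, u m @ \oo --> l m) ->
  (fun n => \sum_(m < M) u m n) @ \oo --> \sum_(m < M) l m.
Proof.
move=> ul; elim: M => [|M IH].
  under eq_fun do rewrite big_ord0.
  by rewrite big_ord0; apply: cvg_cst.
have -> : (fun n => \sum_(m < M.+1) u m n) = (fun n => \sum_(m < M) u m n + u M n).
  by apply/funext => n; rewrite big_ord_recr.
by rewrite big_ord_recr; apply: cvgD.
Qed.

Lemma sum_half (R : realType) n : \sum_(r < n) (1 / 2 : R) ^+ r <= 2.
Proof.
suff -> : \sum_(r < n) (1 / 2 : R) ^+ r = 2 - 2 * (1 / 2) ^+ n.
  by rewrite gerBl mulr_ge0 // exprn_ge0 // divr_ge0.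
by elim: n => [|n IH]; rewrite ?big_ord0 ?big_ord_recr ?IH /= ?exprS; field.
Qed.

(** * Growth of [L] and [lam], and vanishing of the small cuts *)

Section Asymptotics.
Variables (R : realType) (h : nat) (K P : nat -> nat) (alpha : nat -> R).
Hypothesis hKP : forall n, (0 < n)%N -> (1 <= K n <= P n)%N.
Hypothesis halpha : forall n, (1 < n)%N -> (K n)%:R ^+ 2 / (P n)%:R =
  (ln n%:R + h%:R * ln (ln n%:R) + alpha n) / n%:R.
Variable cK : R.
Hypothesis cK0 : 0 < cK.
Hypothesis hK : \forall n \near \oo, cK * Num.sqrt (ln n%:R) <= (K n)%:R.
Hypothesis ho : forall e : R, 0 < e -> \forall n \near \oo, `|alpha n| <= e * ln n%:R.

Let y n : R := (K n)%:R ^+ 2 / (P n)%:R.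
Let L n : R := n%:R * y n.
Let lam n : R := n%:R * ((K n)%:R / (P n)%:R).

Lemma ln_nat_ge A : \forall n \near \oo, A <= ln n%:R :> R.
Proof.
have /cvgryPge/(_ (expR A)) := @cvgr_idn R.
apply: filterS => n An; rewrite -ler_expR lnK // posrE.
exact: lt_le_trans (expR_gt0 _) An.
Qed.

Lemma L_expansion n : (1 < n)%N -> L n = ln n%:R + h%:R * ln (ln n%:R) + alpha n.
Proof.
move=> n1; rewrite /L /y halpha // mulrC divfK // pnatr_eq0 -lt0n.
exact: ltnW.
Qed.

Lemma L_ln e : 0 < e -> \forall n \near \oo, `|L n - ln n%:R| <= e * ln n%:R.
Proof.
move=> e0; pose e2 := e / 2 / h.+1%:R.
have e20 : 0 < e2 by rewrite !divr_gt0.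
have [X HX] := @pow_le_exp R 1 1 e2 e20.
near=> n; have n1 : (1 < n)%N by near: n; apply: nbhs_infty_gt.
have l1 : 1 <= ln n%:R :> R by near: n; apply: ln_nat_ge.
have lX : X <= ln n%:R by near: n; apply: ln_nat_ge.
have an : `|alpha n| <= e / 2 * ln n%:R by near: n; apply: ho; rewrite divr_gt0.
have ll0 : 0 <= ln (ln n%:R) :> R by rewrite ln_ge0.
have ll : ln (ln n%:R) <= e2 * ln n%:R.
  rewrite -ler_expR lnK ?posrE; last by lra.
  by have := HX _ lX; rewrite mul1r expr1.
rewrite L_expansion //.
have -> : ln n%:R + h%:R * ln (ln n%:R) + alpha n - ln n%:R =
  h%:R * ln (ln n%:R) + alpha n :> R by ring.
apply: le_trans (ler_normD _ _) _; rewrite [X in X + _]ger0_norm ?mulr_ge0 //.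
have : h%:R * ln (ln n%:R) <= e / 2 * ln n%:R.
  apply: (@le_trans _ _ (h.+1%:R * (e2 * ln n%:R))).
    by apply: ler_pM => //; rewrite ler_nat.
  by rewrite /e2 mulrA [X in X * _ <= _]mulrC divfK.
by lra.
Unshelve. all: by end_near. Qed.

Lemma L_ge A : \forall n \near \oo, A <= L n.
Proof.
have e0 : 0 < (1 / 2 : R) by rewrite divr_gt0.
near=> n; have H : `|L n - ln n%:R| <= 1 / 2 * ln n%:R by near: n; apply: L_ln.
have l1 : 2 * A <= ln n%:R by near: n; apply: ln_nat_ge.
by move: H; rewrite ler_norml => /andP[H _]; lra.
Unshelve. all: by end_near. Qed.

(** This is how the lower bound on [K] enters. As [L] is unbounded, so is [K], hence [lam = L / K]
    is [o(L)]; moreover [lam] is at most a constant times [K]. *)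
Lemma K2_ge : exists2 C : R, 0 < C & \forall n \near \oo, L n <= C * (K n)%:R ^+ 2.
Proof.
exists (2 / cK ^+ 2); first by rewrite divr_gt0 // exprn_gt0.
have e0 : 0 < (1 : R) by [].
near=> n; have H : `|L n - ln n%:R| <= 1 * ln n%:R by near: n; apply: L_ln.
have l1 : 1 <= ln n%:R :> R by near: n; apply: ln_nat_ge.
have HK : cK * Num.sqrt (ln n%:R) <= (K n)%:R by near: n.
have l0 : 0 <= ln n%:R :> R by lra.
have : (cK * Num.sqrt (ln n%:R)) ^+ 2 <= (K n)%:R ^+ 2.
  by rewrite lerXn2r ?nnegrE // mulr_ge0 ?sqrtr_ge0 // ltW.
rewrite exprMn sqr_sqrtr // -ler_pdivlMl ?exprn_gt0 // => H2.
move: H; rewrite ler_norml => /andP[_ H].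
by rewrite -mulrA; lra.
Unshelve. all: by end_near. Qed.

Lemma K_ge A : \forall n \near \oo, A <= (K n)%:R :> R.
Proof.
have [C C0 HC] := K2_ge.
near=> n; have H : L n <= C * (K n)%:R ^+ 2 by near: n.
have HL : C * A ^+ 2 + C <= L n by near: n; apply: L_ge.
rewrite leNgt; apply/negP=> KA.
have k0 : 0 <= (K n)%:R :> R by [].
have : C * (K n)%:R ^+ 2 <= C * A ^+ 2.
  by rewrite ler_pM2l // lerXn2r ?nnegrE // ?ltW // (le_lt_trans k0).
by lra.
Unshelve. all: by end_near. Qed.

Lemma KP_pos n : (0 < n)%N -> (0 < P n)%N /\ (K n <= P n)%N.
Proof. by move=> /hKP/andP[K1 KP]; split=> //; apply: leq_trans KP. Qed.

Lemma L_ge0 n : 0 <= L n.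
Proof. by rewrite mulr_ge0 // y_ge0. Qed.

Lemma lamE n : (0 < n)%N -> lam n * (K n)%:R = L n.
Proof. by move=> _; rewrite /lam /L /y expr2; ring. Qed.

Lemma lam_ge0 n : 0 <= lam n.
Proof. by rewrite mulr_ge0 // divr_ge0. Qed.

Lemma lam_le (C : nat) : (0 < C)%N -> \forall n \near \oo, lam n <= L n / C%:R.
Proof.
move=> C0; near=> n; have n0 : (0 < n)%N by near: n; apply: nbhs_infty_gt.
have KC : C%:R <= (K n)%:R :> R by near: n; apply: K_ge.
rewrite ler_pdivlMr ?ltr0n // -(lamE n0) ler_wpM2l // lam_ge0.
Unshelve. all: by end_near. Qed.

Lemma nat_le_exp_L c : 1 < c -> \forall n \near \oo, n%:R <= expR (L n * c).
Proof.
move=> c1; have e0 : 0 < (c - 1) / c by rewrite divr_gt0; lra.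
near=> n; have n0 : (0 < n)%N by near: n; apply: nbhs_infty_gt.
have H : `|L n - ln n%:R| <= (c - 1) / c * ln n%:R by near: n; apply: L_ln.
rewrite -[leLHS]lnK ?posrE ?ltr0n // ler_expR.
move: H; rewrite ler_norml => /andP[H _].
have -> : ln n%:R = (ln n%:R - (c - 1) / c * ln n%:R) * c :> R by field; lra.
by rewrite ler_pM2r; lra.
Unshelve. all: by end_near. Qed.

Lemma exp_L_le_nat : \forall n \near \oo, expR (L n / 2) <= n%:R.
Proof.
have e0 : 0 < (1 : R) by [].
near=> n; have n0 : (0 < n)%N by near: n; apply: nbhs_infty_gt.
have H : `|L n - ln n%:R| <= 1 * ln n%:R by near: n; apply: L_ln.
rewrite -[leRHS]lnK ?posrE ?ltr0n // ler_expR.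
by move: H; rewrite ler_norml => /andP[_ H]; lra.
Unshelve. all: by end_near. Qed.

(** Eventually [exp lam <= exp (L / 4)], the power of [L] is below any multiple of [exp (L / 4)],
    and [exp (L / 2) <= n]. *)
Lemma L_pow_exp_negl d : (fun n => L n ^+ d * expR (lam n) / n%:R) @ \oo --> (0 : R).
Proof.
apply: cvg0_nneg => [n|e e0].
  by rewrite divr_ge0 // mulr_ge0 ?expR_ge0 // exprn_ge0 // L_ge0.
have c0 : 0 < (1 / 4 : R) by rewrite divr_gt0.
have [X HX] := @pow_le_exp R d e^-1 _ c0.
near=> n; have n0 : (0 < n)%N by near: n; apply: nbhs_infty_gt.
have LX : X <= L n by near: n; apply: L_ge.
have ln4 : lam n <= L n / 4%:R by near: n; apply: lam_le.
have en : expR (L n / 2) <= n%:R by near: n; apply: exp_L_le_nat.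
rewrite ler_pdivrMr ?ltr0n //; apply: (@le_trans _ _ (e * expR (L n / 2))); last first.
  by rewrite ler_pM2l.
have -> : L n / 2 = 1 / 4 * L n + L n / 4%:R by field.
rewrite expRD mulrA; apply: ler_pM; rewrite ?expR_ge0 ?exprn_ge0 ?L_ge0 ?ler_expR //.
by rewrite -ler_pdivrMl // HX.
Unshelve. all: by end_near. Qed.

Lemma inv_L_cvg0 : (fun n => (L n)^-1) @ \oo --> (0 : R).
Proof.
apply: cvg0_nneg => [n|e e0]; first by rewrite invr_ge0 L_ge0.
near=> n; have : e^-1 <= L n by near: n; apply: L_ge.
by move=> H; rewrite -[e]invrK lef_pV2 ?posrE ?invr_gt0 // (lt_le_trans _ H) // invr_gt0.
Unshelve. all: by end_near. Qed.

Notation E n := (@Ex R 'I_n {set 'I_(P n)} (@unif_subset R (P n) (K n))).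

Let cuts n : R := \sum_(A : {set 'I_n} | (1 < #|A|)%N && (#|A|.*2 <= n)%N)
  E n (fun S => (small_cut h.+1 S A)%:R).

Lemma cuts_ge0 n : 0 <= cuts n.
Proof. by apply: sumr_ge0 => A _; apply: Ex_ge0 => // s; apply: unif_ge0. Qed.

Lemma cuts_cvg0 : cuts @ \oo --> (0 : R).
Proof.
apply: cvg0_nneg => [n|e e0]; first exact: cuts_ge0.
(* Each size [r] will contribute at most [2 eta / 2^r], and these sum to at most [4 eta <= e]. *)
pose eta := Num.min 1 (e / 4).
have eta0 : 0 < eta by rewrite lt_min ltr01 divr_gt0.
have eta1 : eta <= 1 by rewrite ge_min lexx.
have etae : eta <= e / 4 by rewrite ge_min lexx orbT.
have [X1 HX1] : exists X, forall x, X <= x -> 1 * x ^+ 1 <= expR (1 / 200 * x) :> R.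
  by apply: pow_le_exp; rewrite divr_gt0.
have [X2 HX2] : exists X, forall x, X <= x -> h.+1%:R * x ^+ h <= expR (1 / 100 * x) :> R.
  by apply: pow_le_exp; rewrite divr_gt0.
have [X3 HX3] : exists X, forall x, X <= x -> h.+1%:R * x ^+ (2 * h) <= expR (1 * x) :> R.
  by apply: pow_le_exp.
have [C C0 HC] := K2_ge.
(* This threshold is for [K]: with [lam <= C K] it makes [exp 1 * lam * exp (- K / 2)] at most
   [eta / 2], as the union bound for small pools requires. *)
have [X4 HX4] : exists X, forall x, X <= x ->
    (expR 1 * C * 2 / eta) * x ^+ 1 <= expR (1 / 2 * x) :> R.
  by apply: pow_le_exp; rewrite divr_gt0.
near=> n.
have n0 : (0 < n)%N by near: n; apply: nbhs_infty_gt.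
have [P0 KP] := KP_pos n0.
have hn : (40 * h <= n)%N by near: n; apply: nbhs_infty_ge.
have L100 : 100 <= L n by near: n; apply: L_ge.
have LX1 : X1 <= L n by near: n; apply: L_ge.
have LX2 : X2 <= L n by near: n; apply: L_ge.
have nX3 : X3 <= n%:R.
  by near: n; have /cvgryPge/(_ X3) := @cvgr_idn R.
have KX4 : X4 <= (K n)%:R by near: n; apply: K_ge.
have K48 : (48 <= K n)%N by rewrite -(ler_nat R); near: n; apply: K_ge.
have LC : L n <= C * (K n)%:R ^+ 2 by near: n.
have lam200 : lam n <= L n / 200%:R by near: n; apply: lam_le.
have nexp : n%:R <= expR (L n * (11 / 10)) by near: n; apply: nat_le_exp_L; lra.
have expn : expR (L n / 2) <= n%:R by near: n; apply: exp_L_le_nat.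
have Leta : 40 / eta <= L n by near: n; apply: L_ge.
have neta : eta^-1 <= n%:R.
  by near: n; have /cvgryPge/(_ eta^-1) := @cvgr_idn R.
have K0 : 0 < (K n)%:R :> R by rewrite ltr0n (leq_trans _ K48).
have nR0 : 0 < n%:R :> R by rewrite ltr0n.
have L0 : 0 < L n by lra.
have [Lge0 etage0] : 0 <= L n /\ 0 <= eta by split; apply: ltW.
have c2 : L n * expR (lam n) <= expR (L n / 100).
  have -> : L n / 100 = 1 / 200 * L n + L n / 200%:R by field.
  rewrite expRD; apply: ler_pM; rewrite ?expR_ge0 ?ler_expR //.
  by have := HX1 _ LX1; rewrite mul1r expr1.
have c3 x : L n <= x -> h.+1%:R * x ^+ h <= expR (x / 100).
  move=> Lx; have -> : x / 100 = 1 / 100 * x by ring.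
  exact: HX2 (le_trans LX2 Lx).
have c7 : L n <= n%:R.
  apply: le_trans expn; have := HX1 _ LX1; rewrite mul1r expr1 => /le_trans; apply.
  by rewrite ler_expR; lra.
have c8 : h.+1%:R * (n%:R * n%:R) ^+ h <= expR n%:R :> R.
  by have := HX3 _ nX3; rewrite mul1r exprM expr2.
have c6 : expR (- (L n / 40)) <= eta.
  have L40 : 0 < L n / 40 by rewrite divr_gt0.
  apply: le_trans (inv_expR_le L40) _; rewrite -[eta]invrK lef_pV2 ?posrE ?invr_gt0 //.
  by rewrite ler_pdivlMr // mulrC.
have c9 : expR (- n%:R) <= eta.
  apply: le_trans (inv_expR_le nR0) _; rewrite -[eta]invrK lef_pV2 ?posrE ?invr_gt0 //.
have c10 : expR 1 * (lam n * expR (- ((K n)%:R / 2))) <= eta / 2.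
  have lamK : lam n <= C * (K n)%:R.
    rewrite -(ler_pM2r K0) (lamE n0); apply: le_trans LC _.
    by rewrite expr2 mulrA.
  have := HX4 _ KX4; rewrite expr1 => H4.
  apply: (@le_trans _ _ (expR 1 * (C * (K n)%:R * expR (- ((K n)%:R / 2))))).
    by rewrite ler_wpM2l ?expR_ge0 // ler_wpM2r ?expR_ge0.
  rewrite expRN mulrA ler_pdivrMr ?expR_gt0 //.
  have -> : expR 1 * (C * (K n)%:R) = (eta / 2) * (expR 1 * C * 2 / eta * (K n)%:R).
    by field; rewrite gt_eqF.
  rewrite ler_wpM2l ?divr_ge0 //.
  by rewrite (_ : (K n)%:R / 2 = 1 / 2 * (K n)%:R); [exact: H4|ring].
apply: (@le_trans _ _ (\sum_(r < n.+1) 2 * eta * (1 / 2) ^+ r)); last first.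
  rewrite -mulr_sumr; have := sum_half R n.+1.
  have s0 : 0 <= \sum_(r < n.+1) (1 / 2 : R) ^+ r.
    by apply: sumr_ge0 => r _; rewrite exprn_ge0 // divr_ge0.
  by move=> H; nra.
apply: (@sum_by_card R n _ (fun r => (1 < r)%N && (r.*2 <= n)%N)
  (fun r => 2 * eta * (1 / 2) ^+ r)); last first.
  by move=> r; rewrite !mulr_ge0 ?exprn_ge0 ?divr_ge0.
move=> A /andP[A1 A2].
have [Asmall|Abig] := leP (#|A|%:R * (L n * expR (lam n))) n%:R.
  apply: le_trans (small_cut_sparse P0 KP A1 hn L100 c2 c3 nexp Asmall) _.
  rewrite ler_wpM2r ?exprn_ge0 ?divr_ge0 //; apply: le_trans c6 _.
  by lra.
apply: small_cut_dense => //; [exact: ltnW|by rewrite eta0 eta1|exact: ltW].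
Unshelve. all: by end_near. Qed.

End Asymptotics.

(** * Asymptotics of the moments and of the probability of having no low-degree node *)

Section Moments.
Variables (R : realType) (h : nat) (K P : nat -> nat).
Hypothesis hKP : forall n, (0 < n)%N -> (1 <= K n <= P n)%N.

Let y n : R := (K n)%:R ^+ 2 / (P n)%:R.
Let L n : R := n%:R * y n.
Let lam n : R := n%:R * ((K n)%:R / (P n)%:R).

Hypothesis L_large : forall A, \forall n \near \oo, A <= L n.
Hypothesis L_negl :
  forall d, (fun n => L n ^+ d * expR (lam n) / n%:R) @ \oo --> (0 : R).
Hypothesis invL_cvg0 : (fun n => (L n)^-1) @ \oo --> (0 : R).

Notation E n := (@Ex R 'I_n {set 'I_(P n)} (@unif_subset R (P n) (K n))).

Lemma L_nneg n : 0 <= L n.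
Proof. by rewrite mulr_ge0 // y_ge0. Qed.

Lemma lam_nneg n : 0 <= lam n.
Proof. by rewrite mulr_ge0 // divr_ge0. Qed.

(** One limit for most of the error factors: this is why [upper] and [lower] spell out [L n ^+ 0]
    and [L n ^+ 1]. *)
Lemma L_pow_negl d : (fun n => L n ^+ d / n%:R) @ \oo --> (0 : R).
Proof.
apply: (squeeze_cvgr _ (@cvg_cst _ 0 _ \oo _) (L_negl d)); near=> n.
rewrite divr_ge0 ?exprn_ge0 ?L_nneg //= ler_wpM2r ?invr_ge0 // ler_peMr //.
  by rewrite exprn_ge0 ?L_nneg.
by rewrite -expR0 ler_expR lam_nneg.
Unshelve. all: by end_near. Qed.

Let FM m n : R := factorial_moment R n (P n) (K n) h.+1 m.
Let mu n : R := n%:R * expR (- L n) * (L n ^+ h / h`!%:R).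

(** The cost of overlapping sets, relative to [(L^h / h!)^m]: the number of terms in the sum over
    neighbourhood sizes, the conversion of [(m L)^(m h)], the factor [m] in [exp lam / z] for
    [z = n / (m L)], and [exp m] from the moment of the deficit. *)
Let upper_const m : R :=
  (m * h).+1%:R * (m%:R ^+ (m * h) * h`!%:R ^+ m) * (m%:R * expR m%:R).

(* [upper] and [lower] are the relative errors of [FM m] against [mu ^+ m / m!]. *)
Let upper m n : R := expR ((m * (m * h.+1))%:R * (L n ^+ 1 / n%:R)) *
  ((1 + (h%:R * h`!%:R) * (L n)^-1) ^+ m +
   upper_const m * (L n ^+ 1 * expR (lam n) / n%:R)).

Let lower m n : R := (1 + (- m%:R) * (L n ^+ 0 / n%:R)) ^+ m *
  ((1 + (- h%:R) * (L n ^+ 0 / n%:R)) ^+ h) ^+ m *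
  (expR ((- (2 * m%:R ^+ 2)) * (L n ^+ 2 / n%:R)) *
   ((1 + (- m%:R) * (L n ^+ 1 / n%:R)) ^+ h) ^+ m) *
  ((1 + (- m%:R ^+ 2) * (L n ^+ 1 / n%:R)) *
   (1 + (- (m%:R ^+ 2 * h%:R ^+ 2 + m%:R ^+ 2 * h%:R)) * (L n ^+ 0 / n%:R))).

Lemma upper_ge0 m n : 0 <= upper m n.
Proof.
rewrite mulr_ge0 ?expR_ge0 // addr_ge0 ?exprn_ge0 //.
  by rewrite addr_ge0 // divr_ge0 ?L_nneg // mulr_ge0.
rewrite mulr_ge0 //; first by rewrite !mulr_ge0 ?exprn_ge0 ?expR_ge0.
by rewrite divr_ge0 // mulr_ge0 ?expR_ge0 // exprn_ge0 // L_nneg.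
Qed.

Lemma upper_cvg m : upper m @ \oo --> (1 : R).
Proof.
apply: cvgM1; first by apply: cvg_expcM; apply: L_pow_negl.
rewrite -[X in _ --> X]addr0; apply: cvgD.
  by apply: cvgX1; apply: cvg_addcM; apply: invL_cvg0.
by rewrite -(mulr0 (upper_const m)); apply: cvgMr; apply: L_negl.
Qed.

Lemma lower_cvg m : lower m @ \oo --> (1 : R).
Proof.
apply: cvgM1; last by apply: cvgM1; apply: cvg_addcM; apply: L_pow_negl.
apply: cvgM1; last first.
  apply: cvgM1; first by apply: cvg_expcM; apply: L_pow_negl.
  by do 2 apply: cvgX1; apply: cvg_addcM; apply: L_pow_negl.
apply: cvgM1; last by do 2 apply: cvgX1; apply: cvg_addcM; apply: L_pow_negl.
by apply: cvgX1; apply: cvg_addcM; apply: L_pow_negl.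
Qed.

Lemma factorial_moment_upper m : (0 < m)%N ->
  \forall n \near \oo, FM m n <= mu n ^+ m / m`!%:R * upper m n.
Proof.
move=> m0; have mR0 : 0 < m%:R :> R by rewrite ltr0n.
have negl1 : \forall n \near \oo, L n ^+ 1 * expR (lam n) / n%:R <= m%:R^-1.
  have /cvgr0Pnorm_le/(_ m%:R^-1) := L_negl 1; rewrite invr_gt0 => /(_ mR0).
  by apply: filterS => n; apply: le_trans; apply: ler_norm.
near=> n.
have n0 : (0 < n)%N by near: n; apply: nbhs_infty_gt.
have [P0 KP] := KP_pos hKP n0.
have mn : (m + m * h <= n)%N by near: n; apply: nbhs_infty_ge.
have L1 : 1 <= L n by near: n; apply: L_large.
have nR0 : 0 < n%:R :> R by rewrite ltr0n.
have L0 : 0 < L n by lra.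
have nge0 : 0 <= n%:R :> R by [].
have Lge0 : 0 <= L n by lra.
have small : m%:R * (L n * expR (lam n)) <= n%:R.
  have : L n ^+ 1 * expR (lam n) / n%:R <= m%:R^-1 by near: n.
  by rewrite expr1 ler_pdivrMr // ler_pdivlMl.
pose z := n%:R / (m%:R * L n).
have mL0 : 0 < m%:R * L n by rewrite mulr_gt0.
have lamz : expR (lam n) <= z by rewrite ler_pdivlMr // mulrC -mulrA.
have z1 : 1 <= z.
  by apply: le_trans lamz; rewrite -expR0 ler_expR lam_nneg.
pose W := L n ^+ h / h`!%:R.
have W0 : 0 <= W by rewrite divr_ge0 // exprn_ge0.
have hf0 : h`!%:R != 0 :> R by rewrite pnatr_eq0 -lt0n fact_gt0.
pose c := (expR (- L n) * W) ^+ m * upper m n.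
have bound (A : {set 'I_n}) : #|A| = m -> E n (fun S =>
    [forall i in A, low_degree (intersection_graph S) h.+1 i]%:R) <= c.
  move=> Am; have low := @E_low_le R n (P n) (K n) P0 KP A h z z1 lamz.
  rewrite Am in low; apply: le_trans low _; rewrite -/(y n) -/(L n) -/(lam n).
  have -> : - ((n - m - m * h)%:R * (m%:R * y n)) =
      m%:R * (- L n) + (m * (m * h.+1))%:R * (L n ^+ 1 / n%:R).
    rewrite -subnDA natrB // expr1 /L natrD !natrM -natr1.
    by field; rewrite gt_eqF.
  rewrite expRD (expRM_natl m) /c /upper.
  set v := expR ((m * (m * h.+1))%:R * _); set D := _ + _ / L n.
  set q := L n ^+ 1 * expR _ / _.
  have -> : (expR (- L n) * W) ^+ m * (v * (D ^+ m + upper_const m * q)) =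
      expR (- L n) ^+ m * v * (W ^+ m * D ^+ m + W ^+ m * (upper_const m * q)).
    by rewrite exprMn; ring.
  have D0 : 0 <= D by rewrite addr_ge0 // divr_ge0 // mulr_ge0.
  rewrite ler_wpM2l ?mulr_ge0 ?exprn_ge0 ?expR_ge0 //; apply: lerD.
    rewrite -exprMn lerXn2r ?nnegrE //.
    - by apply: sumr_ge0 => i _; rewrite divr_ge0 ?exprn_ge0.
    - by rewrite mulr_ge0.
    - exact: sum_pow_top.
  have -> : z * (m%:R ^+ 2 * y n) = m%:R.
    have -> : z * (m%:R ^+ 2 * y n) = m%:R * ((n%:R * y n) / L n).
      by rewrite /z; field; rewrite !gt_eqF.
    by rewrite divff ?mulr1 // gt_eqF.
  have -> : n%:R * (m%:R * y n) = m%:R * L n by rewrite mulrCA.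
  apply: (@le_trans _ _ ((m * h).+1%:R * (m%:R * L n) ^+ (m * h) *
      (expR (lam n) / z) * expR m%:R)).
    have z0 : 0 <= z^-1 by rewrite invr_ge0 (le_trans ler01).
    apply: ler_wpM2r; first exact: expR_ge0.
    apply: ler_wpM2r; first by rewrite mulr_ge0 ?expR_ge0.
    apply: sum_pow_le; have : 1 <= m%:R :> R by rewrite ler1n.
    by nra.
  have -> : expR (lam n) / z = m%:R * q.
    by rewrite /q /z expr1; field; rewrite !gt_eqF.
  have -> : (m%:R * L n) ^+ (m * h) = m%:R ^+ (m * h) * (h`!%:R ^+ m * W ^+ m).
    rewrite [LHS]exprMn; congr (_ * _); rewrite -exprMn /W [h`!%:R * _]mulrC divfK //.
    by rewrite -exprM mulnC.
  rewrite /upper_const; move: (m%:R ^+ (m * h)) (h`!%:R ^+ m) (W ^+ m) => t1 t2 t3.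
  by rewrite le_eqVlt; apply/orP; left; apply/eqP; ring.
apply: le_trans (factorial_moment_le bound) _.
have c0 : 0 <= c by rewrite mulr_ge0 ?upper_ge0 // exprn_ge0 // mulr_ge0 ?expR_ge0.
apply: le_trans (ler_wpM2r c0 (binR_le R n m)) _.
rewrite /c /mu -/W le_eqVlt; apply/orP; left; apply/eqP.
by rewrite -[n%:R * _ * W]mulrA [(n%:R * _) ^+ m]exprMn; ring.
Unshelve. all: by end_near. Qed.

(** The factors of [lower] correct, in this order, ['C(n, m)], ['C(n, h)^m], [(1 - m y)^n],
    [(y - m y^2)^(m h)], the probability that the sets in [A] are disjoint, and the proportion of
    admissible families [J]. *)
Lemma factorial_moment_lower m : (0 < m)%N ->
  \forall n \near \oo, mu n ^+ m / m`!%:R * lower m n <= FM m n.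
Proof.
move=> m0; have mR0 : 0 < m%:R :> R by rewrite ltr0n.
have small_u d (c e : R) : 0 < e -> \forall n \near \oo, c * (L n ^+ d / n%:R) <= e.
  move=> e0; have H : (fun n => c * (L n ^+ d / n%:R)) @ \oo --> (0 : R).
    by rewrite -(mulr0 c); apply: cvgMr; apply: L_pow_negl.
  have /cvgr0Pnorm_le/(_ e e0) := H.
  by apply: filterS => n; apply: le_trans; apply: ler_norm.
have half0 : 0 < (1 / 2 : R) by rewrite divr_gt0.
near=> n.
have n0 : (0 < n)%N by near: n; apply: nbhs_infty_gt.
have [P0 KP] := KP_pos hKP n0.
have mn : (m <= n)%N by near: n; apply: nbhs_infty_ge.
have hn : (h <= n)%N by near: n; apply: nbhs_infty_ge.
have nR0 : 0 < n%:R :> R by rewrite ltr0n.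
have yE : y n = L n ^+ 1 / n%:R by rewrite /L expr1 [n%:R * _]mulrC mulfK // gt_eqF.
have s1 : m%:R * (L n ^+ 1 / n%:R) <= 1 / 2 by near: n; apply: small_u.
have s2 : m%:R ^+ 2 * (L n ^+ 1 / n%:R) <= 1 / 2 by near: n; apply: small_u.
have s3 : (m%:R ^+ 2 * h%:R ^+ 2 + m%:R ^+ 2 * h%:R) * (L n ^+ 0 / n%:R) <= 1 / 2.
  by near: n; apply: small_u.
have yge0 : 0 <= y n by apply: y_ge0.
have my0 : 0 <= m%:R * y n by rewrite mulr_ge0.
have my1 : m%:R * y n <= 1 / 2 by rewrite yE.
have my1' : m%:R * y n <= 1 by lra.
have a1 : 0 <= 1 - m%:R * y n by lra.
have a2 : 0 <= 1 - m%:R ^+ 2 * y n by rewrite yE; lra.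
pose g := 1 - m%:R ^+ 2 * (h%:R ^+ 2 / n%:R) - m%:R ^+ 2 * (h%:R / n%:R) : R.
have gE : g = 1 + (- (m%:R ^+ 2 * h%:R ^+ 2 + m%:R ^+ 2 * h%:R)) * (L n ^+ 0 / n%:R).
  by rewrite /g expr0; ring.
have g0 : 0 <= g by rewrite gE; lra.
pose q := y n - m%:R * y n ^+ 2.
have qE : q = y n * (1 - m%:R * y n) by rewrite /q; ring.
have q0 : 0 <= q by rewrite qE mulr_ge0.
pose c := 'C(n, h)%:R ^+ m * ((1 - m%:R * y n) ^+ n * q ^+ (m * h) *
  (1 - m%:R ^+ 2 * y n)) * g.
have bound (A : {set 'I_n}) : #|A| = m -> c <= E n (fun S =>
    [forall i in A, low_degree (intersection_graph S) h.+1 i]%:R).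
  move=> Am; have A0 : (0 < #|A|)%N by rewrite Am.
  have Ay : #|A|%:R * y n <= 1 by rewrite Am.
  have low := @E_low_ge R n (P n) (K n) h P0 KP hn A A0 Ay.
  rewrite Am -/(y n) -/q in low; apply: le_trans low; rewrite /c.
  have Ed := @E_disjoint_on R n (P n) (K n) P0 KP A; rewrite Am in Ed.
  have Eg := @EJ_good R n h n0 hn A; rewrite Am in Eg.
  have f1 : 0 <= (1 - m%:R * y n) ^+ n * q ^+ (m * h) by rewrite mulr_ge0 ?exprn_ge0.
  apply: ler_pM => //.
    by rewrite mulr_ge0 ?exprn_ge0 // mulr_ge0.
  by rewrite ler_wpM2l ?exprn_ge0 // ler_wpM2l.
apply: le_trans (factorial_moment_ge bound).
have e1 := @one_sub_exp R (m%:R * y n) n my0 my1.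
have b1 := @binR_ge R n m n0 mn.
have b2 := @binR_ge R n h n0 hn.
have hR : 0 <= 1 - h%:R / n%:R :> R.
  by rewrite subr_ge0 ler_pdivrMr // mul1r ler_nat.
have mR : 0 <= 1 - m%:R / n%:R :> R.
  by rewrite subr_ge0 ler_pdivrMr // mul1r ler_nat.
pose b1v := (1 - m%:R / n%:R) ^+ m * (n%:R ^+ m / m`!%:R) : R.
pose b2v := (1 - h%:R / n%:R) ^+ h * (n%:R ^+ h / h`!%:R) : R.
pose e1v := expR (- (n%:R * (m%:R * y n)) - 2 * (n%:R * (m%:R * y n) ^+ 2)).
have b1v0 : 0 <= b1v by rewrite mulr_ge0 ?divr_ge0 ?exprn_ge0.
have b2v0 : 0 <= b2v by rewrite mulr_ge0 ?divr_ge0 ?exprn_ge0.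
apply: (@le_trans _ _ (b1v * (b2v ^+ m * (e1v * q ^+ (m * h) *
    (1 - m%:R ^+ 2 * y n)) * g))); last first.
  apply: ler_pM => //.
    by rewrite !mulr_ge0 ?exprn_ge0 ?expR_ge0.
  apply: ler_wpM2r => //; apply: ler_pM; rewrite ?exprn_ge0 ?mulr_ge0 ?expR_ge0 ?exprn_ge0 //.
    by rewrite lerXn2r ?nnegrE.
  by apply: ler_wpM2r => //; apply: ler_wpM2r => //; rewrite exprn_ge0.
have -> : e1v = expR (- L n) ^+ m * expR ((- (2 * m%:R ^+ 2)) * (L n ^+ 2 / n%:R)).
  rewrite -expRM_natl -expRD; congr expR; rewrite /L.
  by field; rewrite gt_eqF.
have -> : q ^+ (m * h) = (y n ^+ h) ^+ m * ((1 - m%:R * y n) ^+ h) ^+ m.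
  by rewrite qE exprMn mulnC !exprM -exprMn.
rewrite /lower -gE -!yE /mu.
have -> : L n ^+ h = n%:R ^+ h * y n ^+ h by rewrite -exprMn.
rewrite /b1v /b2v !expr0 !exprMn.
have -> : 1 + - m%:R * (1 / n%:R) = 1 - m%:R / n%:R :> R by ring.
have -> : 1 + - h%:R * (1 / n%:R) = 1 - h%:R / n%:R :> R by ring.
have -> : 1 + - m%:R * y n = 1 - m%:R * y n by ring.
have -> : 1 + - m%:R ^+ 2 * y n = 1 - m%:R ^+ 2 * y n by ring.
move: ((1 - m%:R / n%:R) ^+ m) (((1 - h%:R / n%:R) ^+ h) ^+ m).
move: (((1 - m%:R * y n) ^+ h) ^+ m) (1 - m%:R ^+ 2 * y n).
move: (expR (- L n) ^+ m) (expR _) ((n%:R ^+ h) ^+ m) ((y n ^+ h) ^+ m) ((h`!%:R^-1) ^+ m).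
move=> t1 t2 t3 t4 t5 t6 t7 t8 t9.
by rewrite le_eqVlt; apply/orP; left; apply/eqP; ring.
Unshelve. all: by end_near. Qed.

Let p0 n : R := prob_no_low R n (P n) (K n) h.+1.

Lemma cvg_pow (u : nat -> R) (l : R) j : u @ \oo --> l -> (fun n => u n ^+ j) @ \oo --> l ^+ j.
Proof.
move=> ul; elim: j => [|j IH]; first exact: cvg_cst.
have -> : (fun n => u n ^+ j.+1) = (fun n => u n * u n ^+ j).
  by apply/funext => n; rewrite exprS.
by rewrite exprS; apply: cvgM.
Qed.

Lemma factorial_moment_cvg m (l : R) : mu @ \oo --> l -> FM m @ \oo --> l ^+ m / m`!%:R.
Proof.
move=> mul; have [->|m0] := posnP m.
  apply: (@squeeze_cvgr _ \oo _ _ (fun=> 1) (fun=> 1)); last 2 first.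
  - by rewrite expr0 fact0 divr1; apply: cvg_cst.
  - by rewrite expr0 fact0 divr1; apply: cvg_cst.
  near=> n; have n0 : (0 < n)%N by near: n; apply: nbhs_infty_gt.
  by have [_ KP] := KP_pos hKP n0; rewrite /FM factorial_moment0 // lexx.
apply: (@squeeze_cvgr _ \oo _ _ (fun n => mu n ^+ m / m`!%:R * lower m n)
  (fun n => mu n ^+ m / m`!%:R * upper m n)).
- near=> n; apply/andP; split; near: n; [exact: factorial_moment_lower|exact: factorial_moment_upper].
- rewrite -[X in _ --> X]mulr1; apply: cvgM; last exact: lower_cvg.
  by apply: cvgMl; apply: cvg_pow.
- rewrite -[X in _ --> X]mulr1; apply: cvgM; last exact: upper_cvg.
  by apply: cvgMl; apply: cvg_pow.
Unshelve. all: by end_near. Qed.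

(** The truncation level [M] is fixed before [n], so that only finitely many moments have to
    converge. *)
Lemma no_low_cvg_poisson (l : R) : mu @ \oo --> l -> p0 @ \oo --> expR (- l).
Proof.
move=> mul; apply/cvgrPdist_le => e e0; have e4 : 0 < e / 4 by rewrite divr_gt0.
have S : series (exp_coeff (- l)) @ \oo --> expR (- l).
  exact: is_cvg_series_exp_coeff.
have T := pi_irrational.exp_fact l.
(* The error [e] is shared by the tail of the exponential series, the convergence of the truncated
   sum, the first omitted term of the limit, and the convergence of the corresponding moment. *)
have /filter_ex[M [[M1 HS] HT]] : \forall M \near \oo,
    ((0 < M)%N /\ `|expR (- l) - series (exp_coeff (- l)) M| <= e / 4) /\
    `|l ^+ M / M`!%:R| <= e / 4.
  near=> M; split; [split|].
  - by near: M; apply: nbhs_infty_gt.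
  - by near: M; move/cvgrPdist_le : S; apply.
  - by near: M; move/cvgr0Pnorm_le : T; apply.
case: M M1 HS HT => // M _ HS HT.
have sumE : series (exp_coeff (- l)) M.+1 = \sum_(m < M.+1) (-1) ^+ m * (l ^+ m / m`!%:R).
  rewrite /series /= big_mkord; apply: eq_bigr => m _.
  have -> : exp_coeff (- l) m = (- l) ^+ m / m`!%:R by [].
  by rewrite (exprNn l) mulrA.
have FMsum : (fun n => \sum_(m < M.+1) (-1) ^+ m * FM m n) @ \oo -->
    \sum_(m < M.+1) (-1) ^+ m * (l ^+ m / m`!%:R).
  apply: (@cvg_sum_ord R (fun m n => (-1) ^+ m * FM m n)
    (fun m => (-1) ^+ m * (l ^+ m / m`!%:R)) M.+1) => m.
  by apply: cvgMr; apply: factorial_moment_cvg.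
have FMM := @factorial_moment_cvg M.+1 l mul.
near=> n.
have H1 : `|series (exp_coeff (- l)) M.+1 - \sum_(m < M.+1) (-1) ^+ m * FM m n| <= e / 4.
  by rewrite sumE; near: n; move/cvgrPdist_le : FMsum; apply.
have H2 : `|l ^+ M.+1 / M.+1`!%:R - FM M.+1 n| <= e / 4.
  by near: n; move/cvgrPdist_le : FMM; apply.
have H3 := @prob_no_low_bonferroni R n (P n) (K n) h.+1 M.
rewrite -/(p0 n) in H3; move: H1 H2 H3 HS HT.
rewrite -/(FM M.+1 n); set s := \sum_(m < M.+1) _.
move: (series _ _) (l ^+ _ / _) (FM _ _) s => a b c s.
rewrite !ler_norml => /andP[? ?] /andP[? ?] /andP[? ?] /andP[? ?] /andP[? ?].
by apply/andP; split; lra.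
Unshelve. all: by end_near. Qed.

Lemma mu_gt0 : \forall n \near \oo, 0 < mu n.
Proof.
near=> n; have n0 : (0 < n)%N by near: n; apply: nbhs_infty_gt.
have L1 : 1 <= L n by near: n; apply: L_large.
have L0 : 0 < L n by lra.
apply: mulr_gt0; first by rewrite mulr_gt0 ?expR_gt0 ?ltr0n.
by rewrite divr_gt0 ?exprn_gt0 ?ltr0n ?fact_gt0.
Unshelve. all: by end_near. Qed.

Lemma prob_no_low_ge0 n : 0 <= p0 n.
Proof. by apply: Ex_ge0 => // s; apply: unif_ge0. Qed.

(** Here [mu] is unbounded, so the moments have no limits and only their relative errors are used:
    in Chebyshev's bound twice the second moment over the square of the first is at most a quantity
    tending to [1], and the inverse of the first moment tends to [0]. *)
Lemma no_low_cvg0 : (fun n => (mu n)^-1) @ \oo --> (0 : R) -> p0 @ \oo --> (0 : R).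
Proof.
move=> mu0.
have low1 := lower_cvg 1; have up2 := upper_cvg 2.
have ilow1 : (fun n => (lower 1 n)^-1) @ \oo --> (1 : R).
  by rewrite -[X in _ --> X]invr1; apply: cvgV => //; rewrite oner_neq0.
apply: (@squeeze_cvgr _ \oo _ _ (fun=> 0)
  (fun n => (upper 2 n * ((lower 1 n)^-1) ^+ 2 - 1) + (mu n)^-1 * (lower 1 n)^-1)).
- near=> n; rewrite prob_no_low_ge0 /=.
  have n0 : (0 < n)%N by near: n; apply: nbhs_infty_gt.
  have [P0 KP] := KP_pos hKP n0.
  have m0 : 0 < mu n by near: n; apply: mu_gt0.
  have F1 : mu n ^+ 1 / 1`!%:R * lower 1 n <= FM 1 n by near: n; apply: factorial_moment_lower.
  have F2 : FM 2 n <= mu n ^+ 2 / 2`!%:R * upper 2 n by near: n; apply: factorial_moment_upper.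
  have l1 : `|1 - lower 1 n| <= 1 / 2.
    by near: n; move/cvgrPdist_le : low1; apply; rewrite divr_gt0.
  have l0 : 0 < lower 1 n by move: l1; rewrite ler_norml => /andP[_]; lra.
  rewrite expr1 -[1`!]/1%N divr1 in F1.
  have ml : 0 < mu n * lower 1 n by rewrite mulr_gt0.
  have f1 : 0 < FM 1 n by apply: lt_le_trans F1.
  have u2 := upper_ge0 2 n.
  have cheb := prob_no_low_le KP f1; apply: le_trans cheb _.
  rewrite -/(FM 1 n) -/(FM 2 n) mulrDl addrAC; apply: lerD.
    rewrite lerD2r ler_pdivrMr ?exprn_gt0 //.
    apply: (@le_trans _ _ (mu n ^+ 2 * upper 2 n)).
      by move: F2; rewrite -[2`!]/2%N => F2; lra.
    have -> : mu n ^+ 2 * upper 2 n =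
        upper 2 n * ((lower 1 n)^-1) ^+ 2 * (mu n * lower 1 n) ^+ 2.
      by field; rewrite gt_eqF.
    apply: ler_wpM2l; first by rewrite mulr_ge0 ?exprn_ge0 // invr_ge0 ltW.
    by rewrite lerXn2r ?nnegrE // ltW.
  have -> : FM 1 n / FM 1 n ^+ 2 = (FM 1 n)^-1 by field; rewrite gt_eqF.
  by rewrite -invfM lef_pV2 ?posrE.
- exact: cvg_cst.
- rewrite -[X in _ --> X]addr0; apply: cvgD; last first.
    by rewrite -[X in _ --> X](mul0r 1); apply: cvgM.
  rewrite -[X in _ --> X](subrr 1); apply: cvgB; last exact: cvg_cst.
  by apply: cvgM1 => //; apply: cvgX1.
Unshelve. all: by end_near. Qed.

Lemma no_low_cvg1 : mu @ \oo --> (0 : R) -> p0 @ \oo --> (1 : R).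
Proof.
move=> mu0; have F1 := @factorial_moment_cvg 1 0 mu0.
apply: (@squeeze_cvgr _ \oo _ _ (fun n => 1 - FM 1 n) (fun=> 1)).
- near=> n; have n0 : (0 < n)%N by near: n; apply: nbhs_infty_gt.
  have [P0 KP] := KP_pos hKP n0; rewrite prob_no_low_ge //=.
  rewrite -[leRHS](Ex_cst 'I_n (@unif_sum1 R (P n) (K n) KP)).
  by apply: Ex_le => [s|S _]; [apply: unif_ge0|case: (_ == _)].
- rewrite -[X in _ --> X](subr0 1); apply: cvgB; first exact: cvg_cst.
  by move: F1; rewrite expr1 mul0r.
- exact: cvg_cst.
Unshelve. all: by end_near. Qed.

End Moments.

(** * The three regimes of [alpha] *)

Section Limits.
Variables (R : realType) (h : nat) (K P : nat -> nat) (alpha : nat -> R).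
Hypothesis halpha : forall n, (1 < n)%N -> (K n)%:R ^+ 2 / (P n)%:R =
  (ln n%:R + h%:R * ln (ln n%:R) + alpha n) / n%:R.
Hypothesis ho : forall e : R, 0 < e -> \forall n \near \oo, `|alpha n| <= e * ln n%:R.

Let L n : R := n%:R * ((K n)%:R ^+ 2 / (P n)%:R).
Let mu n : R := n%:R * expR (- L n) * (L n ^+ h / h`!%:R).
Let ratio n : R := (L n / ln n%:R) ^+ h.

Lemma eq_near_cvg (u v : nat -> R) (l : R) :
  (\forall n \near \oo, u n = v n) -> v @ \oo --> l -> u @ \oo --> l.
Proof.
move=> uv vl; apply: (@squeeze_cvgr _ \oo _ _ v v) => //.
by apply: filterS uv => n ->; rewrite lexx.
Qed.

Lemma squeeze_sub (u v w : nat -> R) (l : R) :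
  w @ \oo --> (0 : R) -> v @ \oo --> l ->
  (\forall n \near \oo, v n - w n <= u n <= v n) -> u @ \oo --> l.
Proof.
move=> w0 vl uvw; apply: (@squeeze_cvgr _ \oo _ _ (fun n => v n - w n) v) => //.
by rewrite -[X in _ --> X]subr0; apply: cvgB.
Qed.

Lemma ratio_cvg : ratio @ \oo --> (1 : R).
Proof.
apply: cvgX1; apply/cvgrPdist_le => e e0; near=> n.
have l1 : 1 <= ln n%:R :> R by near: n; apply: ln_nat_ge.
have H : `|L n - ln n%:R| <= e * ln n%:R by near: n; apply: (L_ln halpha ho).
have l0 : 0 < ln n%:R :> R by lra.
have -> : 1 - L n / ln n%:R = - ((L n - ln n%:R) / ln n%:R) by field; rewrite gt_eqF.
have li : 0 <= (ln n%:R)^-1 :> R by rewrite invr_ge0 ltW.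
by rewrite normrN normrM (ger0_norm li) ler_pdivrMr.
Unshelve. all: by end_near. Qed.

(** By the expansion of [L], [n exp (- L) = exp (- alpha) / (ln n)^h]; the power of [ln n] combines
    with [L^h] into [ratio]. *)
Lemma mu_alpha : \forall n \near \oo, mu n = expR (- alpha n) * ratio n / h`!%:R.
Proof.
near=> n; have n1 : (1 < n)%N by near: n; apply: nbhs_infty_gt.
have l1 : 1 <= ln n%:R :> R by near: n; apply: ln_nat_ge.
have l0 : 0 < ln n%:R :> R by lra.
have n0 : 0 < n%:R :> R by rewrite ltr0n ltnW.
rewrite /mu [X in expR (- X)](L_expansion halpha n1).
have -> : - (ln n%:R + h%:R * ln (ln n%:R) + alpha n) =
  - ln n%:R + (- (h%:R * ln (ln n%:R)) - alpha n) :> R by ring.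
rewrite expRD expRN lnK ?posrE // mulVKf ?gt_eqF // expRD expRN expRM_natl lnK ?posrE //.
by rewrite /ratio expr_div_n; ring.
Unshelve. all: by end_near. Qed.

Lemma mu_cvg a : alpha @ \oo --> a -> mu @ \oo --> expR (- a) / h`!%:R.
Proof.
move=> aa; apply: (eq_near_cvg mu_alpha); apply: cvgMl.
rewrite -[X in _ --> X]mulr1; apply: cvgM; last exact: ratio_cvg.
apply: (@continuous_cvg _ _ _ _ _ (fun n => - alpha n) expR (- a)).
  exact: continuous_expR.
exact: cvgN.
Qed.

Lemma expR_Noo (u : nat -> R) : u @ \oo --> -oo -> (fun n => expR (u n)) @ \oo --> (0 : R).
Proof.
move=> /cvgrNyPle uoo; apply: cvg0_nneg => [n|e e0]; first exact: expR_ge0.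
near=> n; have H : u n <= - e^-1 by near: n; apply: uoo.
apply: (@le_trans _ _ (expR (- e^-1))); first by rewrite ler_expR.
by apply: le_trans (inv_expR_le _) _; rewrite ?invr_gt0 // invrK.
Unshelve. all: by end_near. Qed.

Lemma mu_cvg0 : alpha @ \oo --> +oo -> mu @ \oo --> (0 : R).
Proof.
move=> /cvgryPge aoo; apply: (eq_near_cvg mu_alpha).
rewrite -[X in _ --> X](mul0r h`!%:R^-1); apply: cvgMl.
rewrite -[X in _ --> X](mul0r 1); apply: cvgM; last exact: ratio_cvg.
apply: expR_Noo; apply/cvgrNyPle => A.
by near=> n; rewrite lerNl; near: n; apply: aoo.
Unshelve. all: by end_near. Qed.

Lemma inv_mu_cvg0 : alpha @ \oo --> -oo -> (fun n => (mu n)^-1) @ \oo --> (0 : R).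
Proof.
move=> aoo.
apply: (@eq_near_cvg _ (fun n => expR (alpha n) * (ratio n)^-1 * h`!%:R)).
  apply: filterS mu_alpha => n ->.
  by rewrite !invfM invrK expRN invrK.
rewrite -[X in _ --> X](mul0r h`!%:R); apply: cvgMl.
rewrite -[X in _ --> X](mul0r 1^-1); apply: cvgM; first exact: expR_Noo.
by apply: cvgV; [rewrite oner_neq0|exact: ratio_cvg].
Qed.

End Limits.

Theorem theorem3 (R : realType) (k : nat) (K P : nat -> nat) (alpha : nat -> R)
    (hk : (0 < k)%N)
    (hKP : forall n, (0 < n)%N -> (1 <= K n <= P n)%N)
    (halpha : forall n, (1 < n)%N ->
       (K n)%:R ^+ 2 / (P n)%:R =
       (ln n%:R + (k%:R - 1) * ln (ln n%:R) + alpha n) / n%:R)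
    (hK : (fun n => (K n)%:R : R^o) =Omega_\oo
            (fun n => Num.sqrt (ln (n%:R : R)) : R^o))
    (ho : (fun n => `|alpha n| : R^o) =o_\oo (fun n => ln (n%:R : R) : R^o)) :
  let p : nat -> R :=
    fun n => Gu_prob R (P n) (K n) (fun e : rel 'I_n => k_connected e k) in
  [/\ alpha @ \oo --> -oo -> p @ \oo --> (0 : R),
      alpha @ \oo --> +oo -> p @ \oo --> (1 : R) &
      forall a : R, alpha @ \oo --> a ->
        p @ \oo --> expR (- (expR (- a) / (k.-1)`!%:R))].
Proof.
case: k hk halpha => // h _ halpha p.
have {}halpha n : (1 < n)%N -> (K n)%:R ^+ 2 / (P n)%:R =
    (ln n%:R + h%:R * ln (ln n%:R) + alpha n) / n%:R :> R.
  by move=> n1; rewrite halpha // -natr1 addrK.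
have {}ho (e : R) : 0 < e -> \forall n \near \oo, `|alpha n| <= e * ln n%:R.
  move=> e0; move/eqoP : ho => /(_ e e0) H; near=> n.
  have l0 : 0 <= ln n%:R :> R by near: n; apply: ln_nat_ge.
  have : `| `|alpha n| | <= e * `|ln (n%:R : R)| by near: n; exact: H.
  by rewrite normr_id (ger0_norm l0).
have [cK cK0 {}hK] : exists2 cK : R, 0 < cK &
    \forall n \near \oo, cK * Num.sqrt (ln n%:R) <= (K n)%:R.
  move: hK; rewrite eqOmegaE eqOmegaO => /eqO_exP[c c0 H].
  exists c^-1; first by rewrite invr_gt0.
  near=> n; have : `|Num.sqrt (ln (n%:R : R))| <= c * `|(K n)%:R : R|.
    by near: n; exact: H.
  by rewrite ger0_norm ?sqrtr_ge0 // ger0_norm // ler_pdivrMl.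
have large := L_ge halpha ho.
have small := L_pow_exp_negl halpha cK0 hK ho.
have invL0 := inv_L_cvg0 halpha ho.
have cuts0 := cuts_cvg0 hKP halpha cK0 hK ho.
(* The probability of [k]-connectivity lies below that of having no low-degree node by at most the
   expected number of small cuts, so each case reduces to the limit of the latter probability. *)
have fin (l : R) : (fun n => prob_no_low R n (P n) (K n) h.+1) @ \oo --> l ->
    p @ \oo --> l.
  move=> p0l; apply: (squeeze_sub cuts0 p0l).
  near=> n; have n1 : (1 < n)%N by near: n; apply: nbhs_infty_gt.
  have hn : (h.+1 < n)%N by near: n; apply: nbhs_infty_gt.
  have [P0 KP] := KP_pos hKP (ltnW n1).
  by apply/andP; split; [apply: Gu_prob_ge|apply: Gu_prob_le].
split=> [aNy|ay|a aa]; apply: fin.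
- by apply: (no_low_cvg0 hKP large small invL0); apply: (inv_mu_cvg0 halpha ho).
- by apply: (no_low_cvg1 hKP large small invL0); apply: (mu_cvg0 halpha ho).
- by apply: (no_low_cvg_poisson hKP large small invL0); apply: (mu_cvg halpha ho).
Unshelve. all: by end_near. Qed.
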